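(* Assume that the base flow $(\Omega,\sigma,\mathbb{R})$ is minimal, that H1 and H2 hold, that $\mathcal{K}\subset\Omega\times W^{1,\infty}$ is a positively $\Pi$-invariant compact set projecting over the whole base and such that each one of its elements admits at least one backward extension in $\mathcal{K}$, and that $\lambda_{\mathcal{K}}<0$. Then there exists $k\in\mathbb{N}$ such that $\mathcal{K}$ is a $k$-cover of $(\Omega,\sigma,\mathbb{R})$, and the semiflow $(\mathcal{K},\Pi,\mathbb{R}^+)$ admits a flow extension. In addition: (i) For each $\tilde\omega\in\Omega$ there exist a neighborhood $\mathcal{U}_{\tilde\omega}\subset\Omega$ of $\tilde\omega$ and $k$ continuous maps $x_1,\ldots,x_k:\mathcal{U}_{\tilde\omega}\to W^{1,\infty}$ such that $$\mathcal{K}_\omega=\{\bar x\in W^{1,\infty}\,|\;(\omega,\bar x)\in\mathcal{K}\}=\{x_1(\omega),\ldots,x_k(\omega)\}$$ for all $\omega\in\mathcal{U}_{\tilde\omega}$. (ii) The set $\mathcal{K}$ is the disjoint union of a finite number of minimal sets $\mathcal{M}_1,\ldots,\mathcal{M}_l$, where $\mathcal{M}_j$ is an exponentially stable $m_j$-cover of the base for $j=1,\ldots,l$.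
   Context: Fix $r>0$ and $n\ge1$. $C=C([-r,0],\mathbb{R}^n)$ with the supremum norm $\|\cdot\|_C$; $W^{1,\infty}$ is the Banach space of Lipschitz functions $\psi:[-r,0]\to\mathbb{R}^n$ with norm $\|\psi\|_{W^{1,\infty}}=\max\{\|\psi\|_C,\|\dot\psi\|_{L^\infty}\}$. For a continuous function $y$ on $[t-r,t]$, $y_t(s)=y(t+s)$, $s\in[-r,0]$. $(\Omega,\sigma,\mathbb{R})$ is a continuous flow on a compact metric space, and $\omega\cdot t=\sigma(t,\omega)$; it is minimal if every orbit is dense in $\Omega$. $\mathrm{Lin}(X,Y)$ is the space of bounded linear maps with the operator norm. Consider the family of equations, for $\omega\in\Omega$, $$\dot y(t)=F(\omega\cdot t,\,y(t),\,y(t-\tau(\omega\cdot t,y_t))),\quad t\ge0,$$ with $F:\Omega\times\mathbb{R}^n\times\mathbb{R}^n\to\mathbb{R}^n$ and $\tau:\Omega\times C\to[0,r]$. Conditions: H1: $F$ is continuous and its partial derivatives with respect to the second and third arguments exist and are continuous on $\Omega\times\mathbb{R}^n\times\mathbb{R}^n$. H2: (1) $\tau$ is continuous and differentiable with respect to its second argument, with $D_2\tau:\Omega\times C\to\mathrm{Lin}(C,\mathbb{R})$ continuous. (2) For every compact subset $\mathcal{C}\subset\Omega\times C$ there is $L_2=L_2(\mathcal{C})>0$ with $\|D_2\tau(\omega,x_1)-D_2\tau(\omega,x_2)\|_{\mathrm{Lin}(C,\mathbb{R})}\le L_2\|x_1-x_2\|_C$ for all $(\omega,x_1),(\omega,x_2)\in\mathcal{C}$.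 Under these conditions, for each $\omega\in\Omega$ and $x\in W^{1,\infty}$ there is a unique maximal solution $y(t,\omega,x)$ with $y(s,\omega,x)=x(s)$ for $s\in[-r,0]$, defined on $[-r,\beta_{\omega,x})$, $0<\beta_{\omega,x}\le\infty$. Put $u(t,\omega,x)(s)=y(t+s,\omega,x)$, which belongs to $W^{1,\infty}$, and $\Pi(t,\omega,x)=(\omega\cdot t,u(t,\omega,x))$ for $t\in[0,\beta_{\omega,x})$. A set $\mathcal{M}$ is positively $\Pi$-invariant if $\beta_{\omega,x}=\infty$ and $\Pi(t,\omega,x)\in\mathcal{M}$ for all $(\omega,x)\in\mathcal{M}$, $t\ge0$. The restriction of $\Pi$ to a positively $\Pi$-invariant compact set is a continuous semiflow. A set projects over the whole base if for every $\omega\in\Omega$ it contains some $(\omega,x)$. A point $(\omega,x)\in\mathcal{M}$ admits a backward extension in $\mathcal{M}$ if there is a continuous $\theta:(-\infty,0]\to\mathcal{M}$ with $\theta(0)=(\omega,x)$ and $\Pi(t,\theta(s))=\theta(t+s)$ whenever $s\le-t\le0$. A minimal set is a nonempty positively $\Pi$-invariant compact set containing properly no nonempty positively $\Pi$-invariant compact set. The semiflow $(\mathcal{K},\Pi,\mathbb{R}^+)$ admits a flow extension if there is a continuous flow on $\mathcal{K}$ that agrees with $\Pi$ for $t\ge0$. $\mathcal{K}$ is a $k$-cover of the base if each fiber $\mathcal{K}_\omega=\{x\,|\,(\omega,x)\in\mathcal{K}\}$, $\omega\in\Omega$, contains exactly $k$ elements. A positively $\Pi$-invariant compact set $\mathcal{M}$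 projecting over the whole base is exponentially stable if there are $\delta_0>0$, $c>0$, $\alpha>0$ such that, if $(\omega,\bar x)\in\mathcal{M}$ and $\|x-\bar x\|_{W^{1,\infty}}<\delta_0$, then $\beta_{\omega,x}=\infty$ and $\|u(t,\omega,x)-u(t,\omega,\bar x)\|_{W^{1,\infty}}\le c\,e^{-\alpha t}\|x-\bar x\|_{W^{1,\infty}}$ for all $t\ge0$. The existence of backward extensions implies that $\bar x$ is $C^1$ for all $(\omega,\bar x)\in\mathcal{K}$. For $(\omega,\bar x)\in\mathcal{K}$ and $\phi\in C$ define $$\begin{aligned}L(\omega,\bar x)\phi={}&D_2F(\omega,\bar x(0),\bar x(-\tau(\omega,\bar x)))\phi(0)+D_3F(\omega,\bar x(0),\bar x(-\tau(\omega,\bar x)))\phi(-\tau(\omega,\bar x))\\&-D_3F(\omega,\bar x(0),\bar x(-\tau(\omega,\bar x)))\,\dot{\bar x}(-\tau(\omega,\bar x))\cdot D_2\tau(\omega,\bar x)\phi .\end{aligned}$$ For $v\in C$ let $z(t,\omega,\bar x,v)$, $t\ge-r$, be the solution of $\dot z(t)=L(\Pi(t,\omega,\bar x))z_t$, $t\ge0$, with $z(s)=v(s)$ on $[-r,0]$, and let $w(t,\omega,\bar x,v)(s)=z(t+s,\omega,\bar x,v)$, $s\in[-r,0]$ (which lies in $W^{1,\infty}$ if $v$ does). The upper Lyapunov exponent of $\mathcal{K}$ is (with $\ln0=-\infty$) $$\lambda_{\mathcal{K}}=\sup_{(\omega,\bar x)\in\mathcal{K}}\ \sup_{0\ne v\in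 W^{1,\infty}}\limsup_{t\to\infty}\tfrac1t\ln\|w(t,\omega,\bar x,v)\|_{W^{1,\infty}},$$ which coincides with the analogous quantity $\sup_{(\omega,\bar x)\in\mathcal{K}}\sup_{0\ne v\in C}\limsup_{t\to\infty}\frac1t\ln\|w(t,\omega,\bar x,v)\|_C$. *)

(* Defs.v *)
From HB Require Import structures.
From mathcomp Require Import all_boot all_order all_algebra.
From mathcomp Require Import all_classical all_reals all_analysis.
From mathcomp Require Import ess_sup_inf ring lra.

Set Implicit Arguments.
Unset Strict Implicit.
Unset Printing Implicit Defensive.

Import Order.TTheory GRing.Theory Num.Theory.
Import numFieldNormedType.Exports.

Local Open Scope classical_set_scope.
Local Open Scope ring_scope.

(* A Lipschitz function of one variable is differentiable almost everywhere:
   [f x + k x] is nondecreasing and its Stieltjes measure is dominated by the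
   Lebesgue measure. *)
Section Rademacher.
Context {R : realType}.
Variables (f : R -> R) (k : R).
Hypothesis f_lip : forall x y, `|f x - f y| <= k * `|x - y|.
Local Notation mu := (@lebesgue_measure R).

Let g (x : R) : R := f x + k * x.

Let k_ge0 : 0 <= k.
Proof.
have := f_lip 1 0; rewrite subr0 normr1 mulr1; exact: le_trans.
Qed.

Let f_lipW x y : x <= y -> `|f x - f y| <= k * (y - x).
Proof. by move=> xy; rewrite (le_trans (f_lip x y))// distrC ger0_norm ?subr_ge0. Qed.

Let g_nd : {homo g : x y / x <= y}.
Proof.
by move=> x y /f_lipW; rewrite /g ler_norml => /andP[_]; lra.
Qed.

Let g_le x y : x <= y -> g y - g x <= 2 * k * (y - x).
Proof.
by move=> /f_lipW; rewrite /g ler_norml => /andP[]; lra.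
Qed.

Let f_cont : continuous f.
Proof.
move=> x; apply/cvgrPdist_lt => e e0; near=> y.
rewrite (le_lt_trans (f_lip _ _))//.
rewrite (@le_lt_trans _ _ ((k + 1) * `|x - y|))//.
  by rewrite ler_wpM2r// lerDl.
rewrite mulrC -ltr_pdivlMr ?ltr_wpDl//.
near: y; apply: (@cvgr_dist_lt _ _ _ (nbhs x) _ id) => //.
by rewrite divr_gt0// ltr_wpDl.
Unshelve. all: by end_near. Qed.

Let g_rc x : g @ at_right x --> g x.
Proof.
apply: right_continuousW => {}x; apply: cvgD; first exact: f_cont.
by apply: cvgM; [exact: cvg_cst|exact: cvg_id].
Qed.

Let gc : cumulative R R := HB.pack g (@isCumulative.Build R _ R g g_nd g_rc).

Local Notation nu := (lebesgue_stieltjes_measure gc).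

Let nu_itv (a b : R) : a <= b -> nu `]a, b]%classic = (g b - g a)%:E.
Proof.
move=> ab; rewrite /lebesgue_stieltjes_measure /measure_extension/=.
rewrite -[LHS]/(mu_ext (wlength gc) _) (measurable_mu_extE (wlength gc))//=; last by exists (a, b).
by rewrite wlength_itv_bnd.
Qed.

Let nu_le (A : set R) : (nu A <= (2 * k + 1)%:E * mu A)%E.
Proof.
have K0 : 0 < 2 * k + 1 by rewrite ltr_wpDl// mulr_ge0.
rewrite -lee_pdivrMl//; apply: le_ereal_inf_tmp => _ [B [mB AB] <-].
rewrite lee_pdivrMl// -nneseriesZl//.
apply: (@le_trans _ _ (\sum_(n <oo) wlength gc (B n))%E).
  by apply: ereal_inf_lbound; exists B.
apply: lee_nneseries => [n _ _|n _]; first exact: wlength_ge0.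
have [[u v] _ <-] := mB n.
have [uv|vu] := leP u v; last first.
  have -> : `](u, v).1, (u, v).2]%classic = set0 :> set R.
    by apply: set_itv_ge; rewrite bnd_simp -leNgt ltW.
  rewrite (wlength0 gc).
  by rewrite [X in (_ <= _ * X)%E](wlength0 idfun) mule0.
rewrite wlength_itv_bnd// [X in (_ <= _ * X)%E]wlength_itv_bnd// -EFinM lee_fin (le_trans (g_le uv))//.
by rewrite ler_wpM2r ?subr_ge0// lerDl.
Qed.

Let nu_dom : nu `<< mu.
Proof.
apply/null_content_dominatesP => A mA A0; apply/eqP.
rewrite eq_le measure_ge0 andbT.
by rewrite (le_trans (nu_le A))// A0 mule0.
Qed.

Lemma lipschitz_derivable_ae (a b : R) :
  {ae mu, forall x, x \in `]a, b[ -> derivable f x 1}.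
Proof.
have [ab|] := ltP a b; last first.
  move=> ba; apply: nearW => x; rewrite in_itv/= => /andP[ax xb].
  by have := lt_trans ax xb; rewrite ltNge ba.
have mD : measurable (`]a, b]%classic : set (measurableTypeR R)).
  exact: measurable_itv.
have nuD : (nu `]a, b]%classic < +oo)%E.
  by rewrite nu_itv ?ltry// ltW.
pose nu' : {finite_measure set (measurableTypeR R) -> \bar R} := mfrestr mD nuD.
have nu'mu : nu' `<< mu.
  apply/null_content_dominatesP => A mA A0 /=; rewrite /mfrestr /mrestr.
  apply/eqP; rewrite eq_le measure_ge0 andbT.
  have := (null_content_dominatesP _ _).1 nu_dom A mA A0 => <-.
  apply: le_measure; rewrite ?inE//.
  exact: measurableI.
have [h [h_ge0 h_fin h_int h_nu]] := radon_nikodym_sigma_finite nu'mu.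
pose h' := fine \o h.
have hE : h = EFin \o h' by apply/funext => x /=; rewrite fineK.
rewrite hE in h_int h_nu.
have h'loc : locally_integrable setT h'.
  exact: open_integrable_locally (openT) h_int.
suff H (x : R) : a < x -> x < b -> lebesgue_pt h' x -> derivable f x 1.
  have := lebesgue_differentiation h'loc.
  apply: (@filterS _ _ (ae_filter_ringOfSetsType mu)) => x hx.
  by rewrite in_itv/= => /andP[ax xb]; exact: H.
move=> ax xb hx.
have h_intab : mu.-integrable [set` Interval (BRight a) (BRight b)] (EFin \o h').
  by apply: integrableS h_int => //.
have [dF _] := @FTC1_lebesgue_pt R h' (BRight a) x b xb h_intab ax hx.
set F := (X in derivable X _ _) in dF.
have Fg y : y \in `]a, b[ -> F y = g y - g a.
  rewrite in_itv/= => /andP[ay yb].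
  rewrite /F /Rintegral.
  have := h_nu `]a, y]%classic (measurable_itv _).
  rewrite /= => <-.
  rewrite /mfrestr /mrestr setIidl; last first.
    by move=> z /=; rewrite !in_itv/= => /andP[-> /le_trans]; apply; exact: ltW.
  by rewrite nu_itv// ltW.
have Fgx : {near x, F + cst (g a) - k *: @id R =1 f}.
  near=> y; rewrite !fctE Fg.
    by rewrite /g /GRing.scale/=; ring.
  by near: y; apply: near_in_itvoo; rewrite in_itv/= ax.
apply: (near_eq_derivable Fgx).
apply: derivableB; last by apply: derivableZ; exact: derivable_id.
by apply: derivableD; [exact: dF|exact: derivable_cst].
Unshelve. all: by end_near. Qed.

End Rademacher.

Section History.
Context {R : realType} (r : {posnum R}) (n : nat).
Local Notation I := (`[- r%:num, 0]%classic : set R).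
Local Notation mu := (@lebesgue_measure R).

Definition clamp (s : R) : R := Num.max (- r%:num) (Num.min s 0).

Lemma clamp_in s : I (clamp s).
Proof.
rewrite /= in_itv/= /clamp le_max lexx/= ge_max ge_min lexx orbT andbT.
by rewrite oppr_le0.
Qed.

Lemma clamp_id s : I s -> clamp s = s.
Proof.
rewrite /= in_itv/= /clamp => /andP[rs s0].
by rewrite (min_idPl s0) (max_idPr rs).
Qed.

Lemma clamp_lip s t : `|clamp s - clamp t| <= `|s - t|.
Proof.
have r0 : 0 < r%:num by [].
rewrite /clamp /Num.max /Num.min; move: r%:num r0 => r' r0.
case: (ltP s 0) => s0; case: (ltP t 0) => t0; case: (ltP (- r') 0) => ?;
  case: (ltP (- r') s) => ?; case: (ltP (- r') t) => ?;
  case: (ger0P (s - t)) => ?; rewrite ?ler_norml; lra.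
Qed.

Definition hist_pred : {pred R -> 'rV[R]_n} :=
  [pred f : R -> 'rV[R]_n |
    `[< continuous f /\ forall s, f s = f (clamp s) >]].

(* C([-r, 0], R^n): continuous functions on [-r, 0] are represented by their
   unique extension to [R] that is constant on ]-oo, -r] and on [0, +oo[.
   The norm on ['rV[R]_n] is the maximum norm. *)
Record histC := Hist { hist_fun :> R -> 'rV[R]_n ; _ : hist_fun \in hist_pred }.

HB.instance Definition _ := [isSub for hist_fun].
HB.instance Definition _ := [Choice of histC by <:].

Lemma hist_submod_closed : submod_closed hist_pred.
Proof.
split=> [|a f g /asboolP[cf ef] /asboolP[cg eg]]; apply/asboolP; split=> //.
- exact: cst_continuous.
- by move=> x; apply: cvgD; [apply: cvgZr; exact: cf|exact: cg].
- by move=> s; rewrite !fctE -ef -eg.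
Qed.

HB.instance Definition _ := GRing.isSubmodClosed.Build R (R -> 'rV[R]_n)
  hist_pred hist_submod_closed.
HB.instance Definition _ := [SubChoice_isSubLmodule of histC by <:].

Implicit Types x y : histC.

Lemma hist_continuous x : continuous x.
Proof. by case: x => f /= /asboolP[]. Qed.

Lemma hist_clamp x s : x s = x (clamp s).
Proof. by case: x => f /= /asboolP[]. Qed.

Lemma histP x y : {in I, x =1 y} -> x = y.
Proof.
move=> xy; apply/val_inj/funext => s /=; rewrite hist_clamp [RHS]hist_clamp.
by apply: xy; rewrite inE; exact: clamp_in.
Qed.

Definition supnorm x : R := sup [set `|x s| | s in I].

Lemma supnorm_has_sup x : has_sup [set `|x s| | s in I].
Proof.
apply: compact_has_sup.
  by exists `|x 0|, 0 => //=; rewrite in_itv/= lexx oppr_le0 andbT.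
apply: continuous_compact; last exact: segment_compact.
apply: continuous_subspaceT => s.
by apply: continuous_comp; [exact: hist_continuous|exact: norm_continuous].
Qed.

Lemma supnorm_ub x s : I s -> `|x s| <= supnorm x.
Proof.
move=> Is; apply: sup_upper_bound; first exact: supnorm_has_sup.
by exists s.
Qed.

Lemma supnorm_le x M : (forall s, I s -> `|x s| <= M) -> supnorm x <= M.
Proof.
move=> xM; apply: sup_le_ub; first by case: (supnorm_has_sup x).
by move=> _ [s Is <-]; exact: xM.
Qed.

Lemma ler_supnormD x y : supnorm (x + y) <= supnorm x + supnorm y.
Proof.
apply: supnorm_le => s Is; rewrite (le_trans (ler_normD _ _))//.
by apply: lerD; exact: supnorm_ub.
Qed.

Lemma supnormZ (a : R) x : supnorm (a *: x) = `|a| * supnorm x.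
Proof.
have le b y : supnorm (b *: y) <= `|b| * supnorm y.
  apply: supnorm_le => s Is; rewrite [leLHS](_ : _ = `|b| * `|y s|).
    by rewrite ler_wpM2l// supnorm_ub.
  exact: normrZ.
apply/eqP; rewrite eq_le le/=; have [->|a0] := eqVneq a 0.
  rewrite normr0 mul0r scale0r; apply: le_trans (supnorm_ub 0 (clamp_in 0)).
  exact: normr_ge0.
rewrite mulrC -ler_pdivlMr ?normr_gt0// mulrC -normfV.
by rewrite -{1}(scalerK a0 x); exact: le.
Qed.

Lemma supnorm_eq0 x : supnorm x = 0 -> x = 0.
Proof.
move=> x0; apply: histP => s; rewrite inE => Is.
by apply/eqP; rewrite -normr_le0 -x0 supnorm_ub.
Qed.

HB.instance Definition _ :=
  Lmodule_isNormed.Build R histC ler_supnormD supnormZ supnorm_eq0.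

Lemma histC_normE x : `|x| = sup [set `|x s| | s in I].
Proof. by []. Qed.


Definition has_deriv_within {V : normedModType R} (A : set R) (f : R -> V)
    (t : R) (l : V) : Prop :=
  (fun h => h^-1 *: (f (h + t) - f t)) @ within [set h | A (h + t)] 0^' --> l.

(* Derivative of the restriction of [f] to [A]: one-sided at end points. *)
Definition deriv_within {V : normedModType R} (A : set R) (f : R -> V) (t : R) : V :=
  lim ((fun h => h^-1 *: (f (h + t) - f t)) @ within [set h | A (h + t)] 0^').

Lemma deriv_within_interior (V : normedModType R) (A : set R) (f : R -> V) (t : R) :
  nbhs t A -> deriv_within A f t = 'D_1 f t.
Proof.
move=> At; rewrite -derive1E /deriv_within /derive1.
suff -> : within [set h | A (h + t)] 0^' = 0^' by [].
have At' : \forall h \near 0^', A (h + t).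
  have c : (h + t) @[h --> (0 : R)] --> t.
    by rewrite -[X in _ --> X]add0r; apply: cvgD; [exact: cvg_id|exact: cvg_cst].
  by apply: cvg_within; exact: (c A At).
apply/seteqP; split => B; rewrite /within/= => BP; near=> h.
  by apply: (near BP h) => //; near: h.
by move=> _; near: h.
Unshelve. all: by end_near. Qed.

Definition lip_pred : {pred histC} :=
  [pred x : histC | `[< [lipschitz x s | s in I] >]].

(* W^{1,oo}([-r, 0], R^n) *)
Record histW := Lip { lip_hist :> histC ; _ : lip_hist \in lip_pred }.

HB.instance Definition _ := [isSub for lip_hist].
HB.instance Definition _ := [Choice of histW by <:].

Lemma lip_predP x : reflect
  (exists2 k, 0 <= k & forall s t, `|x s - x t| <= k * `|s - t|) (x \in lip_pred).
Proof.
apply: (iffP (asboolP _)) => [[M [_ /(_ (`|M| + 1))]]|[k k0 xk]].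
  have -> : M < `|M| + 1 by rewrite (le_lt_trans (ler_norm M))// ltrDl.
  move=> /(_ isT) xM; exists (`|M| + 1); first by rewrite addr_ge0.
  move=> s t; rewrite (hist_clamp x s) (hist_clamp x t).
  apply: (le_trans (xM (clamp s, clamp t) _)) => /=.
    by split; exact: clamp_in.
  by rewrite ler_wpM2l ?clamp_lip// addr_ge0.
exists k; split; first exact: num_real.
move=> M kM [s t] _ /=; rewrite (le_trans (xk s t))// ler_wpM2r//.
exact: ltW.
Qed.

Lemma lip_submod_closed : submod_closed lip_pred.
Proof.
split=> [|a x y /lip_predP[k k0 xk] /lip_predP[m m0 ym]]; apply/lip_predP.
  by exists 0 => // s t; rewrite subrr normr0 mul0r.
exists (`|a| * k + m) => [|s t]; first by rewrite addr_ge0// mulr_ge0.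
rewrite [X in `|X|](_ : _ = a *: (x s - x t) + (y s - y t)); last first.
  by rewrite scalerBr addrACA -opprD.
rewrite (le_trans (ler_normD _ _))// normrZ mulrDl -mulrA.
by apply: lerD => //; rewrite ler_wpM2l.
Qed.

HB.instance Definition _ := GRing.isSubmodClosed.Build R histC lip_pred
  lip_submod_closed.
HB.instance Definition _ := [SubChoice_isSubLmodule of histW by <:].

Definition hist_mu := mrestr mu (measurable_itv `[- r%:num, 0]).

HB.instance Definition _ := Measure.on hist_mu.

Definition deriv_Linfty (u : histW) : \bar R :=
  ess_sup hist_mu (fun s => (`|deriv_within I u s|)%:E).

Lemma hist_muT : (0 < hist_mu setT)%E.
Proof.
rewrite /hist_mu /mrestr setTI lebesgue_measure_itv/= lte_fin oppr_lt0.
have r0 : 0 < r%:num by [].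
by rewrite r0 -EFinD lte_fin sub0r opprK.
Qed.

Lemma deriv_within_ae (u : histW) :
  {ae hist_mu, forall s, deriv_within I u s = 'D_1 u s /\ derivable u s 1}.
Proof.
have /lip_predP[k k0 uk] : (u : histC) \in lip_pred by case: u.
have aeT : {ae hist_mu, forall s, s \in `]- r%:num, 0[}.
  exists (~` `]- r%:num, 0[); split => //.
    by apply: measurableC; exact: measurable_itv.
  rewrite /hist_mu /mrestr; apply: (@subset_measure0 _ _ _ mu _ [set - r%:num; 0]).
  - by apply: measurableI => //; apply: measurableC; exact: measurable_itv.
  - exact: measurableU.
  - move=> s [/= /negP]; rewrite !in_itv/= negb_and -!leNgt => /orP[] a /andP[b c].
      by left; apply/eqP; rewrite eq_le a b.
    by right; apply/eqP; rewrite eq_le a c.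
  - by apply: countable_lebesgue_measure0; exact/finite_set_countable/finite_set2.
have hist_mu_dom (P : set R) : {ae mu, forall s, P s} -> {ae hist_mu, forall s, P s}.
  move=> [B [mB B0 PB]]; exists B; split => //.
  apply/eqP; rewrite eq_le measure_ge0 andbT -B0 /hist_mu /mrestr.
  by apply: le_measure; rewrite ?inE//; exact: measurableI.
have der (j : 'I_n) : {ae hist_mu, forall s, s \in `]- r%:num, 0[ ->
    derivable (fun t => u t ord0 j) s 1}.
  apply: hist_mu_dom; apply: (@lipschitz_derivable_ae _ _ k) => s t.
  apply: le_trans (uk s t).
  have coord_le (v : 'rV[R]_n) : `|v ord0 j| <= `|v|.
    rewrite [leRHS]mx_normrE; exact: (le_bigmax _ (fun i => `|v i.1 i.2|) (ord0, j)).
  by apply: le_trans (coord_le _); rewrite !mxE.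
have {}der := @filter_forall _ _ _ _ (ae_filter_ringOfSetsType hist_mu) der.
move: aeT der; apply: (@filterS2 _ _ (ae_filter_ringOfSetsType hist_mu)) => s Is ds.
split.
  apply: deriv_within_interior; rewrite /=.
  have : s \in `]- r%:num, 0[%R by [].
  move=> /near_in_itvoo; apply: filterS => t; rewrite /= !in_itv/= => /andP[a b].
  by rewrite !ltW.
apply/derivable_mxP => i j; rewrite (ord1 i); exact: ds.
Qed.

Lemma deriv_Linfty_ge0 (u : histW) : (0 <= deriv_Linfty u)%E.
Proof.
by apply: ess_sup_gee; [exact: hist_muT|apply: nearW => s; rewrite lee_fin].
Qed.

Lemma deriv_Linfty_fin (u : histW) : deriv_Linfty u \is a fin_num.
Proof.
have /lip_predP[k k0 uk] : (u : histC) \in lip_pred by case: u.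
rewrite ge0_fin_numE ?deriv_Linfty_ge0// (@le_lt_trans _ _ k%:E) ?ltry//.
apply/ess_supP; move: (deriv_within_ae u).
apply: (@filterS _ _ (ae_filter_ringOfSetsType hist_mu)) => s [-> du].
rewrite lee_fin -[leLHS](cvg_lim _ (cvg_norm du))//.
apply: limr_le; first exact: (cvgP _ (cvg_norm du)).
near=> h; rewrite normrZ normfV ler_pdivrMl; last first.
  by rewrite normr_gt0; near: h; exact: nbhs_dnbhs_neq.
by rewrite (le_trans (uk _ _))//= addrK mulrC /GRing.scale/= mulr1.
Unshelve. all: by end_near. Qed.

Lemma deriv_LinftyD (u v : histW) :
  (deriv_Linfty (u + v)%R <= deriv_Linfty u + deriv_Linfty v)%E.
Proof.
apply: (le_trans _ (ess_supD _ _ _)); apply: le_ess_sup.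
move: (deriv_within_ae u) (deriv_within_ae v) (deriv_within_ae (u + v)).
apply: (@filterS3 _ _ (ae_filter_ringOfSetsType hist_mu)) => s.
move=> [-> du] [-> dv] [-> _] /=.
rewrite -EFinD lee_fin.
rewrite [X in `|X| <= _](_ : _ = 'D_1 ((u : R -> 'rV[R]_n) + (v : R -> 'rV[R]_n)) s)//.
by rewrite deriveD// ler_normD.
Qed.

Lemma deriv_LinftyZ (a : R) (u : histW) :
  deriv_Linfty (a *: u) = (`|a|%:E * deriv_Linfty u)%E.
Proof.
rewrite -ess_supZl ?hist_muT//; apply: eq_ess_sup.
move: (deriv_within_ae u) (deriv_within_ae (a *: u)).
apply: (@filterS2 _ _ (ae_filter_ringOfSetsType hist_mu)) => s.
move=> [-> du] [-> _] /=.
rewrite [X in `|X|](_ : _ = 'D_1 (a *: (u : R -> 'rV[R]_n)) s)//.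
by rewrite deriveZ// normrZ EFinM.
Qed.

Definition lipnorm (u : histW) : R :=
  Num.max `|u : histC| (fine (deriv_Linfty u)).

Lemma ler_lipnormD (u v : histW) : lipnorm (u + v) <= lipnorm u + lipnorm v.
Proof.
rewrite ge_max; apply/andP; split.
  by rewrite (le_trans (ler_normD _ _))// lerD// le_max lexx.
apply: (@le_trans _ _ (fine (deriv_Linfty u) + fine (deriv_Linfty v))).
  rewrite -fineD; [|exact: deriv_Linfty_fin|exact: deriv_Linfty_fin].
  apply: fine_le; [exact: deriv_Linfty_fin| |exact: deriv_LinftyD].
  by rewrite fin_numD; apply/andP; split; exact: deriv_Linfty_fin.
by apply: lerD; rewrite /lipnorm le_max lexx orbT.
Qed.

Lemma lipnormZ (a : R) (u : histW) : lipnorm (a *: u) = `|a| * lipnorm u.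
Proof.
rewrite /lipnorm [X in Num.max X _](normrZ a (u : histC)) deriv_LinftyZ.
rewrite fineM//; last exact: deriv_Linfty_fin.
by rewrite maxr_pMr.
Qed.

Lemma lipnorm_eq0 (u : histW) : lipnorm u = 0 -> u = 0.
Proof.
move=> u0; apply/val_inj/eqP; rewrite -normr_le0 -u0.
by rewrite /lipnorm le_max lexx.
Qed.

HB.instance Definition _ :=
  Lmodule_isNormed.Build R histW ler_lipnormD lipnormZ lipnorm_eq0.

Lemma histW_normE (u : histW) :
  `|u| = Num.max `|u : histC| (fine (deriv_Linfty u)).
Proof. by []. Qed.

(* The segment [y_t], i.e. [s |-> y (t + s)] on [-r, 0]. [insubd] returns the
   junk value [0] when [y] is not continuous on [t - r, t] (for [segC]), or
   not Lipschitz there (for [segW]). *)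
Definition segC (y : R -> 'rV[R]_n) (t : R) : histC :=
  insubd (0 : histC) (fun s => y (t + clamp s)).

Lemma segCE (y : R -> 'rV[R]_n) (t s : R) :
  {within `[t - r%:num, t], continuous y} -> I s -> segC y t s = y (t + s).
Proof.
move=> yc Is; rewrite /segC val_insubd ifT ?clamp_id//.
apply/asboolP; split=> [a|a]; last by rewrite (clamp_id (clamp_in a)).
have tI b : `[t - r%:num, t]%classic (t + clamp b).
  have := clamp_in b; rewrite /= !in_itv/= => /andP[rb b0].
  by rewrite lerD2l rb gerDl b0.
have cc : continuous (fun b => t + clamp b).
  move=> b; apply/cvgrPdist_lt => e e0.
  apply: filterS (nbhsx_ballx b e e0) => c; rewrite -ball_normE /= => bc.
  by rewrite opprD addrACA subrr add0r (le_lt_trans (clamp_lip _ _)).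
move=> B /= nB.
have /subspace_continuousP/(_ (t + clamp a) (tI a) B nB) := yc.
by move=> /(cc a); apply: (@filterS _ _ (nbhs_filter a)) => c /(_ (tI c)).
Qed.

Definition segW (y : R -> 'rV[R]_n) (t : R) : histW :=
  insubd (0 : histW) (segC y t).

End History.

Section OperatorNorm.
Context {R : realType} {X Y : normedModType R}.

Definition opnorm (f : X -> Y) : R :=
  sup [set `|f x| | x in [set x | `|x| <= 1]].

Definition op_continuous {T : topologicalType} (D : T -> X -> Y) : Prop :=
  forall p, opnorm (fun x => D q x - D p x) @[q --> p] --> (0 : R).

End OperatorNorm.

Section Flow.
Context {R : realType} {Omega : metricType R}.
Implicit Types sigma : R -> Omega -> Omega.

Definition is_flow sigma : Prop :=
  [/\ continuous (fun p : R * Omega => sigma p.1 p.2),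
      forall w, sigma 0 w = w
    & forall s t w, sigma (s + t) w = sigma s (sigma t w)].

Definition minimal_flow sigma : Prop := forall w, dense (range (sigma^~ w)).

End Flow.

Section DelayEquation.
Context {R : realType} {Omega : metricType R} {r : {posnum R}} {n : nat}.
Local Notation E := 'rV[R]_n.
Local Notation C := (histC r n).
Local Notation W := (histW r n).
Local Notation I := (`[- r%:num, 0]%classic : set R).

Variables (sigma : R -> Omega -> Omega) (F : Omega -> E -> E -> E)
  (tau : Omega -> C -> R).

Definition D2F (w : Omega) (u v : E) : E -> E := 'd (fun u' => F w u' v) u.

Definition D3F (w : Omega) (u v : E) : E -> E := 'd (F w u) v.

Definition D2tau (w : Omega) (x : C) : C -> R := 'd (tau w) x.

Definition H1 : Prop :=
  [/\ continuous (fun q : Omega * E * E => F q.1.1 q.1.2 q.2),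
      forall w u v, differentiable (fun u' => F w u' v) u,
      forall w u v, differentiable (F w u) v,
      op_continuous (fun q : Omega * E * E => D2F q.1.1 q.1.2 q.2)
    & op_continuous (fun q : Omega * E * E => D3F q.1.1 q.1.2 q.2)].

Definition H2 : Prop :=
  [/\ continuous (fun q : Omega * C => tau q.1 q.2),
      forall w x, differentiable (tau w) x,
      op_continuous (fun q : Omega * C => D2tau q.1 q.2)
    & forall K : set (Omega * C), compact K ->
        exists2 L : R, 0 < L &
          forall w x1 x2, K (w, x1) -> K (w, x2) ->
            opnorm (fun phi => D2tau w x1 phi - D2tau w x2 phi)
              <= L * `|x1 - x2|].

(* [is_solution w x b y]: [y] solves the initial value problem on [-r, b[;
   values of [y] outside of that interval are irrelevant. At [t = 0] the
   derivative is the right derivative. *)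
Definition is_solution (w : Omega) (x : W) (b : R) (y : R -> E) : Prop :=
  [/\ 0 < b,
      forall s, I s -> y s = x s,
      {within `[- r%:num, b[, continuous y}
    & forall t, 0 <= t < b ->
        has_deriv_within `[0, b[ y t
          (F (sigma t w) (y t) (y (t - tau (sigma t w) (segC r y t))))].

(* [beta_{w, x}] *)
Definition lifespan (p : Omega * W) : \bar R :=
  ereal_sup [set b%:E | b in [set b | exists y, is_solution p.1 p.2 b y]].

(* The maximal solution, obtained by gluing the local ones; junk value [0]
   where no solution is defined. *)
Definition solution (p : Omega * W) (t : R) : E :=
  xget 0 [set v | exists b y, [/\ is_solution p.1 p.2 b y, t < b & v = y t]].

(* [u(t, w, x)] *)
Definition state (t : R) (p : Omega * W) : W := segW r (solution p) t.

(* The skew-product semiflow [Pi]. *)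
Definition skew_product (t : R) (p : Omega * W) : Omega * W := (sigma t p.1, state t p).

Implicit Types (K M : set (Omega * W)).

Definition pos_invariant M : Prop :=
  forall p, M p -> lifespan p = +oo%E /\ forall t, 0 <= t -> M (skew_product t p).

Definition projects_over_base M : Prop := forall w, exists x, M (w, x).

Definition backward_extension M (p : Omega * W) : Prop :=
  exists theta : R -> Omega * W,
    [/\ {within [set s | s <= 0], continuous theta},
        forall s, s <= 0 -> M (theta s),
        theta 0 = p
      & forall s t, 0 <= t -> s <= - t -> skew_product t (theta s) = theta (t + s)].

Definition minimal_set M : Prop :=
  [/\ M !=set0, pos_invariant M, compact M
    & forall N, N !=set0 -> pos_invariant N -> compact N -> N `<=` M -> N = M].

Definition flow_extension K : Prop :=
  exists Phi : R -> Omega * W -> Omega * W,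
    [/\ forall t p, K p -> K (Phi t p),
        {within [set: R] `*` K,
          continuous (fun q : R * (Omega * W) => Phi q.1 q.2)},
        forall p, K p -> Phi 0 p = p,
        forall s t p, K p -> Phi (s + t) p = Phi s (Phi t p)
      & forall t p, 0 <= t -> K p -> Phi t p = skew_product t p].

Definition k_cover (k : nat) M : Prop := forall w, (xsection M w #= `I_k)%card.

Definition exp_stable M : Prop :=
  [/\ pos_invariant M, compact M, projects_over_base M
    & exists delta0 c alpha : R, [/\ 0 < delta0, 0 < c, 0 < alpha
      & forall w (xb x : W), M (w, xb) -> `|x - xb| < delta0 ->
          lifespan (w, x) = +oo%E /\
          forall t, 0 <= t ->
            `|state t (w, x) - state t (w, xb)|
              <= c * expR (- (alpha * t)) * `|x - xb|]].

(* [L(w, x)] *)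
Definition linearization (p : Omega * W) (phi : C) : E :=
  let: (w, x) := p in
  let d := tau w x in
  D2F w (x 0) (x (- d)) (phi 0) + D3F w (x 0) (x (- d)) (phi (- d))
  - D2tau w x phi *: D3F w (x 0) (x (- d)) (deriv_within I x (- d)).

Definition is_linear_solution (p : Omega * W) (v : C) (z : R -> E) : Prop :=
  [/\ forall s, I s -> z s = v s,
      {within `[- r%:num, +oo[, continuous z}
    & forall t, 0 <= t ->
        has_deriv_within `[0, +oo[ z t (linearization (skew_product t p) (segC r z t))].

Definition linear_solution (p : Omega * W) (v : C) : R -> E :=
  xget (fun=> 0) [set z | is_linear_solution p v z].

(* [w(t, w, x, v)] *)
Definition linear_state (t : R) (p : Omega * W) (v : W) : W :=
  segW r (linear_solution p v) t.

(* [lne 0 = -oo] *)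
Definition upper_lyapunov K : \bar R :=
  ereal_sup [set limf_esup
      (fun t : R => ((t^-1)%:E * lne (`|linear_state t q.1 q.2|)%:E)%E) (pinfty_nbhs R)
    | q in [set q : Omega * W * W | K q.1 /\ q.2 != 0]].

End DelayEquation.

(* Main.v *)
(* The upper Lyapunov exponent being negative, every solution of the linearized
   equation becomes small in the sup norm at arbitrarily large times.  The right-hand
   side is strictly differentiable along histories in W^{1,oo} of points of K, because
   these are C^1 (they have a past), so the difference of a solution and of a nearby
   solution in K, rescaled by its initial size, shadows a linear solution.  The rescaled
   differences lie in a set of uniformly Lipschitz histories, which is compact in C, so
   one time bound halves the W^{1,oo} size of every small difference, whence K is
   exponentially stable.  To have global solutions, the equation is first modified
   outside of a large ball.

   Exponential stability forces the backward orbits of distinct points of a fiber to be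
   eventually a fixed distance d apart.  The set of base points whose fiber contains m
   points at mutual distance >= d is closed, and backward semiorbits are dense in a
   minimal base, so if one fiber has m points then every fiber has m points that are
   d-separated: all fibers have the same finite number k of points.  Hence the time-t
   maps are bijective on K; the same counting applies to every positively invariant
   compact subset, whose complement in K is thus again compact and positively
   invariant, and K splits into finitely many minimal sets. *)

Require Import Defs.
From HB Require Import structures.
From mathcomp Require Import all_boot all_order all_algebra.
From mathcomp Require Import all_classical all_reals all_analysis.
From mathcomp Require Import ess_sup_inf ring lra.

Set Implicit Arguments.
Unset Strict Implicit.
Unset Printing Implicit Defensive.

Import Order.TTheory GRing.Theory Num.Theory.
Import numFieldNormedType.Exports.

Local Open Scope classical_set_scope.
Local Open Scope ring_scope.

(** * Curves in finite dimension *)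

(** The obstacle is that no single norm serves. With a state-dependent delay, [x (- tau w x)] is
    Lipschitz in the sup norm only among histories sharing a Lipschitz constant, and the
    linearization error is small only relative to the W^{1,oo} norm; yet balls of W^{1,oo} are
    compact only as subsets of C. So rescaled differences are compared with linear solutions in the
    sup norm, with an error controlled by a W^{1,oo} growth bound. Smallness in the sup norm at a
    time t0 becomes smallness in W^{1,oo} after one more delay r, because the equation bounds the
    derivative of a difference by its sup norm. Continuity of the linearization in its base point is
    not read off its formula: strict approximations at two close points describe the same
    increments, so the linear maps are close, and this makes the approximation uniform over K. The
    modification of the equation truncates the values of histories, which keeps their Lipschitz
    constants; its solutions thus stay in the class where the field is Lipschitz. Halving within
    times in [r, T] gives the rate ln 2 / T. *)

Lemma lipschitz_continuous {R : realType} {V : normedModType R} (k : R) (f : R -> V) :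
  (forall s t, `|f s - f t| <= k * `|s - t|) -> continuous f.
Proof.
move=> fk s; have k0 : 0 <= k by have := fk 1 0; rewrite subr0 normr1 mulr1; exact: le_trans.
apply/cvgrPdist_lt => e e0; near=> t; rewrite (le_lt_trans (fk _ _))//.
rewrite (@le_lt_trans _ _ ((k + 1) * `|s - t|))//; first by rewrite ler_wpM2r// lerDl.
rewrite mulrC -ltr_pdivlMr ?ltr_wpDl//.
near: t; apply: (@cvgr_dist_lt _ _ _ (nbhs s) _ id) => //.
by rewrite divr_gt0// ltr_wpDl.
Unshelve. all: by end_near. Qed.

Section VectorCalculus.
Context {R : realType} {n : nat}.
Local Notation E := 'rV[R]_n.
Implicit Types (y : R -> E) (v : E).

Lemma is_derive_mull (k u : R) : is_derive u 1 (fun a : R => k * a) k.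
Proof.
by apply: is_derive_eq; exact: mulr1.
Qed.

Lemma rV_norm_leP v (M : R) : 0 <= M ->
  `|v| <= M <-> forall j, `|v ord0 j| <= M.
Proof.
move=> M0; rewrite [`|v|]mx_normrE; split=> [vM j|vM].
  by apply: le_trans vM; exact: (le_bigmax _ (fun i => `|v i.1 i.2|) (ord0, j)).
by apply: bigmax_le => // -[i j] _ /=; rewrite (ord1 i).
Qed.

Lemma rV_coord_le v j : `|v ord0 j| <= `|v|.
Proof. by move: (lexx `|v|) => /(rV_norm_leP v (normr_ge0 v)); exact. Qed.

Lemma is_derive_coord y (t : R) (l : E) : is_derive t 1 y l ->
  forall j, is_derive t 1 (fun s => y s ord0 j) (l ord0 j).
Proof.
move=> [dy <-] j; apply: DeriveDef.
  by have /derivable_mxP := dy; exact.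
by rewrite derive_mx// mxE.
Qed.

Lemma coord_is_derive y (t : R) (l : E) :
  (forall j, is_derive t 1 (fun s => y s ord0 j) (l ord0 j)) ->
  is_derive t 1 y l.
Proof.
move=> dy; have dy' : derivable y t 1.
  by apply/derivable_mxP => i j; rewrite (ord1 i); apply: ex_derive; exact: dy.
apply: DeriveDef => //; rewrite derive_mx//; apply/rowP => j; rewrite mxE.
exact: derive_val.
Qed.

Lemma continuous_coord y j : continuous y -> continuous (fun s => y s ord0 j).
Proof.
move=> yc s; apply: (@cvg_comp _ _ _ y (fun M : E => M ord0 j)); first exact: yc.
exact: coord_continuous.
Qed.

Lemma coord_cvg {T : Type} (F : set_system T) (FF : Filter F) (f : T -> E) (l : E) :
  (forall j, f x ord0 j @[x --> F] --> l ord0 j) -> f @ F --> l.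
Proof.
move=> fl; apply/cvgrPdist_le => e e0.
have : \forall x \near F, forall j : 'I_n, `|l ord0 j - f x ord0 j| <= e.
  apply: filter_forall => j; move/cvgrPdist_le : (fl j); exact.
apply: filterS => x xe; apply/rV_norm_leP; first exact: ltW.
by move=> j; rewrite !mxE.
Qed.

(** For the maximum norm it suffices to bound each signed coordinate, and [b - e * y_j] with
    [|e| = 1] is nondecreasing because its derivative [db - e * dy_j] is nonnegative. *)
Lemma derive_le_comparison y dy (b db : R -> R) (s t : R) : s <= t ->
  continuous y -> continuous b ->
  (forall u, s < u < t -> is_derive u 1 y (dy u)) ->
  (forall u, s < u < t -> is_derive u 1 b (db u)) ->
  (forall u, s < u < t -> `|dy u| <= db u) ->
  `|y t - y s| <= b t - b s.
Proof.
move=> st yc bc ydy bdb dyb.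
have main (e : R) j : `|e| = 1 -> e * (y t ord0 j - y s ord0 j) <= b t - b s.
  move=> e1; pose f := b - (e \*o (fun u => y u ord0 j)).
  have fd u : s < u < t -> is_derive u 1 f (db u - e * dy u ord0 j).
    move=> sut; have dj := is_derive_coord (ydy _ sut) j.
    have db' := bdb _ sut.
    by apply: is_deriveB.
  have fE u : f u = b u - e * y u ord0 j by [].
  suff : f s <= f t by rewrite !fE; lra.
  apply: (@ger0_derive1_ndecr _ f s t) => //.
  - by move=> u; rewrite in_itv/= => /fd [].
  - move=> u; rewrite in_itv/= => sut; rewrite derive1E.
    have -> : 'D_1 f u = db u - e * dy u ord0 j by have [] := fd _ sut.
    rewrite subr_ge0 (le_trans (ler_norm _))// normrM e1 mul1r.
    exact: le_trans (rV_coord_le _ _) (dyb _ sut).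
  - apply: continuous_subspaceT => u; apply: cvgB; first exact: bc.
    by apply: cvgM; [exact: cvg_cst|exact: continuous_coord].
have dist_ge0 : 0 <= b t - b s.
  have fd u : s < u < t -> is_derive u 1 b (db u) by exact: bdb.
  rewrite subr_ge0; apply: (@ger0_derive1_ndecr _ b s t) => //.
  - by move=> u; rewrite in_itv/= => /fd [].
  - move=> u; rewrite in_itv/= => sut; rewrite derive1E.
    have -> : 'D_1 b u = db u by have [] := fd _ sut.
    exact: le_trans (normr_ge0 _) (dyb _ sut).
  - exact: continuous_subspaceT.
apply/rV_norm_leP => // j; rewrite !mxE ler_norml.
have := main 1 j (normr1 _); have := main (-1) j (normrN1 _).
lra.
Qed.

Lemma derive_le_lipschitz y dy (M s t : R) : s <= t -> continuous y ->
  (forall u, s < u < t -> is_derive u 1 y (dy u)) ->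
  (forall u, s < u < t -> `|dy u| <= M) ->
  `|y t - y s| <= M * (t - s).
Proof.
move=> st yc ydy dyM; rewrite mulrBr.
apply: (@derive_le_comparison y dy (fun u => M * u) (fun=> M)) => //.
  by move=> u; apply: cvgM; [exact: cvg_cst|exact: cvg_id].
by move=> u _; exact: is_derive_mull.
Qed.

(* The weighted supremum of [e^(-2 L t) |y t|] is attained; comparing [y] up to
   that time with [m/2 e^(2 L t)] bounds it. *)
Lemma delay_gronwall y (r T A L g : R) : 0 <= A -> 0 <= L -> 0 <= g -> 0 <= T -> 0 <= r ->
  continuous y ->
  (forall s : R, - r <= s <= 0 -> `|y s| <= A) ->
  (forall t : R, 0 < t < T -> exists2 l : E, is_derive t 1 y l &
    forall B : R, 0 <= B -> (forall s : R, t - r <= s <= t -> `|y s| <= B) -> `|l| <= L * B + g) ->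
  forall t : R, - r <= t <= T ->
    `|y t| <= 2 * (A * (1 + L * T) + g * T) * expR (2 * L * T).
Proof.
move=> A0 L0 g0 T0 r0 yc yA ydl t /andP[rt tT].
have E1 (s : R) : 0 <= s -> 1 <= expR (2 * L * s).
  by move=> s0; rewrite -expR0 ler_expR !mulr_ge0.
have bnd_ge s : s <= T -> expR (2 * L * s) <= expR (2 * L * T).
  by move=> sT; rewrite ler_expR ler_wpM2l// mulr_ge0.
have LT : 0 <= L * T by rewrite mulr_ge0.
have gT : 0 <= g * T by rewrite mulr_ge0.
have ALT : 0 <= A * (L * T) by rewrite mulr_ge0.
have [t0|t0] := leP t 0.
  rewrite (le_trans (yA t _)) ?rt//.
  rewrite (@le_trans _ _ (2 * (A * (1 + L * T) + g * T)))//; first by lra.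
  by rewrite ler_peMr ?E1//; lra.
pose w u := expR (- (2 * L * u)) * `|y u|.
have wc : continuous w.
  move=> u; apply: cvgM.
    apply: continuous_comp; last exact: continuous_expR.
    by apply: cvgN; apply: cvgM; [exact: cvg_cst|exact: cvg_id].
  by apply: cvg_norm; exact: yc.
have [t1 t1T tm] := EVT_max T0 (continuous_subspaceT wc).
move: t1T; rewrite in_itv/= => /andP[t10 t1T].
set m := w t1 in tm.
have m0 : 0 <= m by rewrite mulr_ge0 ?expR_ge0.
have ym s : 0 <= s <= T -> `|y s| <= m * expR (2 * L * s).
  move=> sT; have : w s <= m by apply: tm; rewrite in_itv.
  by rewrite /w expRN ler_pdivrMl ?expR_gt0// mulrC.
have yt1 : `|y t1| = m * expR (2 * L * t1).
  by rewrite /m /w mulrAC -expRD addNr expR0 mul1r.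
pose dy (u : R) := xget 0 [set l : E | is_derive u 1 y l /\ forall B : R, 0 <= B ->
   (forall s : R, u - r <= s <= u -> `|y s| <= B) -> `|l| <= L * B + g].
have dyP u : 0 < u < t1 -> is_derive u 1 y (dy u) /\ forall B : R, 0 <= B ->
   (forall s : R, u - r <= s <= u -> `|y s| <= B) -> `|dy u| <= L * B + g.
  move=> /andP[u0 ut1]; rewrite /dy; case: xgetP => [l _ //|] /=.
  have [|l ? lB] := ydl u; first by rewrite u0 (lt_le_trans ut1).
  by move=> /(_ l); case.
(* On [[u - r, u]] the curve is bounded by [A + m e^(2 L u)], so [db] dominates the derivative. The
   rate [2 L] leaves the coefficient [m / 2] after integration, which the left side [m e^(2 L t1)]
   absorbs. *)
pose b u := (L * A + g) * u + m / 2 * expR (2 * L * u).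
pose db u := L * A + g + m * L * expR (2 * L * u).
have dlin k u := @is_derive_mull k u.
have dexp (u : R) : is_derive u 1 (fun v : R => expR (2 * L * v)) (2 * L * expR (2 * L * u)).
  rewrite [X in is_derive _ _ _ X]mulrC.
  exact: (is_derive1_comp (is_derive_expR _) (dlin (2 * L) u)).
have bdb (u : R) : is_derive u 1 b (db u).
  have -> : db u = (L * A + g) + (m / 2) *: (2 * L * expR (2 * L * u)).
    by rewrite /db /GRing.scale/=; field.
  apply: is_deriveD.
have bc : continuous b.
  by move=> u; apply/differentiable_continuous/derivable1_diffP; case: (bdb u).
have : `|y t1 - y 0| <= b t1 - b 0.
  apply: (@derive_le_comparison y dy b db 0 t1) => //.
  - by move=> u /dyP[].
  - move=> u u1; have /andP[u0 ut1] := u1; have [_ dyB] := dyP _ u1.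
    rewrite (le_trans (dyB (A + m * expR (2 * L * u)) _ _)) //.
    + by rewrite addr_ge0// mulr_ge0 ?expR_ge0.
    + move=> s /andP[us su]; have [s0|s0] := leP s 0.
        rewrite (le_trans (yA _ _)) ?lerDl ?mulr_ge0 ?expR_ge0// s0 andbT.
        by move: us u0; lra.
      have sT : 0 <= s <= T by move: su ut1 t1T s0; lra.
      rewrite (le_trans (ym _ sT))// ler_wpDl// ler_wpM2l// ler_expR ler_wpM2l//.
      by rewrite mulr_ge0.
    + by rewrite /db; lra.
have y0 : `|y 0| <= A by apply: yA; rewrite lexx andbT oppr_le0.
move=> yb.
have : `|y t1| <= A + (b t1 - b 0).
  by rewrite -[y t1](subrK (y 0)) addrC (le_trans (ler_normD _ _))// lerD.
rewrite yt1 /b !mulr0 expR0 add0r => mE.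
have LAg : (L * A + g) * t1 <= (L * A + g) * T.
  by rewrite ler_wpM2l// addr_ge0// mulr_ge0.
have mE1 : m <= m * expR (2 * L * t1) by rewrite ler_peMr// E1.
have mle : m <= 2 * (A * (1 + L * T) + g * T) by move: mE LAg mE1; lra.
have t0T : 0 <= t <= T by rewrite ltW.
rewrite (le_trans (ym _ t0T))// ler_pM ?expR_ge0// bnd_ge//.
Qed.

End VectorCalculus.

(** * The norm of Lipschitz functions *)

Section LipschitzDerivative.
Context {R : realType}.
Local Notation mu := (@lebesgue_measure R).

(* Cover the exceptional null set by an open [O] of small measure; up to
   [mu (O `&` `]a, x])], which absorbs the growth of [f] inside [O], the
   inequality propagates to the right from every point. *)
Lemma ae_derive_le_increment (f : R -> R) (k M a b : R) (N : set R) :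
  (forall x y, `|f x - f y| <= k * `|x - y|) -> mu.-negligible N -> a <= b -> 0 <= M ->
  (forall x, a < x < b -> ~ N x -> derivable f x 1 /\ 'D_1 f x <= M) ->
  f b - f a <= M * (b - a).
Proof.
move=> f_lip N0 ab M0 dfM.
have k0 : 0 <= k.
  have := f_lip 1 0; rewrite subr0 normr1 mulr1; exact: le_trans.
have fc : continuous f by exact: lipschitz_continuous f_lip.
suff H (e : R) : 0 < e -> f b - f a <= (M + e) * (b - a) + k * e.
  apply/ler_addgt0Pr => /= e e0.
  have K0 : 0 < (b - a) + k + 1 by rewrite ltr_wpDl// addr_ge0// subr_ge0.
  apply: (le_trans (H (e / ((b - a) + k + 1)) _)); first by rewrite divr_gt0.
  set i := _^-1; have iK : (b - a + k) * i <= 1 by rewrite ler_pdivrMr// mul1r lerDl.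
  have : e * ((b - a + k) * i) <= e by apply: ler_piMr => //; exact: ltW.
  lra.
move=> e0.
have [B [mB B0 NB]] := N0.
(* Adding [a] ensures that a supremum [c] outside [O] satisfies [a < c], where the derivative
   hypothesis applies. *)
pose B' := B `|` [set a].
have mB' : measurable B' by apply: measurableU.
have B'0 : mu B' = 0%E by rewrite measureU0//; exact: lebesgue_measure_set1.
have [|O [oO B'O]] := @lebesgue_regularity_outer R B' e mB' _ e0.
  by rewrite [X in (X < _)%E](B'0 : mu B' = 0%E) ltry.
have mO : measurable O by exact: measurable_realfun.open_measurable.
move=> Oe; have {}Oe : (mu O < e%:E)%E.
  rewrite -(setDUK B'O) setUC measureU0//.
  exact: measurableD.
pose phi x := fine (mu (O `&` `]a, x])).
have mI x : measurable (O `&` `]a, x]) by exact: measurableI.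
have phi_fin x : mu (O `&` `]a, x]) \is a fin_num.
  rewrite ge0_fin_numE//; apply: le_lt_trans (lt_trans Oe (ltry _)).
  by apply: le_measure; [rewrite inE; exact: mI|rewrite inE; exact: mO|exact: subIsetl].
have phi_le x y : x <= y -> phi x <= phi y.
  move=> xy; apply: fine_le => //; apply: le_measure; [rewrite inE; exact: mI|rewrite inE; exact: mI|].
  by apply: setIS => z /=; rewrite !in_itv/= => /andP[-> /le_trans]; apply.
have phi_e x : phi x <= e.
  rewrite -lee_fin fineK// ltW//; apply: le_lt_trans Oe.
  by apply: le_measure; [rewrite inE; exact: mI|rewrite inE; exact: mO|exact: subIsetl].
have phi_ge0 x : 0 <= phi x by exact: fine_ge0.
have phi_add x y : a <= x -> x <= y -> (forall z, x < z <= y -> O z) ->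
    phi y - phi x = y - x.
  move=> ax xy xyO.
  have disj : (O `&` `]a, x]) `&` `]x, y] = set0.
    apply/seteqP; split=> z //=; rewrite !in_itv/= => -[[_ /andP[_ zx]] /andP[xz _]].
    by move: (lt_le_trans xz zx); rewrite ltxx.
  have -> : phi y = phi x + fine (mu `]x, y]%classic).
    rewrite /phi -fineD//; last first.
      by rewrite lebesgue_measure_itv/=; case: ifP.
    congr fine; rewrite -(measureU mu (mI x) (measurable_itv `]x, y]) disj).
    - congr (mu _); apply/seteqP; split=> z /=; rewrite !in_itv/=.
        move=> [Oz /andP[az zy]]; have [zx|xz] := leP z x; first by left; rewrite az.
        by right; rewrite zy.
      move=> [[Oz /andP[az zx]]|/andP[xz zy]].
        by rewrite az (le_trans zx).
      by rewrite zy (le_lt_trans ax xz); split=> //; apply: xyO; rewrite xz.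
  rewrite lebesgue_measure_itv/= lte_fin; case: ltP => [_|yx].
    by rewrite -EFinD/=; lra.
  have -> : x = y by apply/eqP; rewrite eq_le xy yx.
  rewrite /=; lra.
pose S := [set x | a <= x <= b /\ f x - f a <= (M + e) * (x - a) + k * phi x].
have Sa : S a.
  by split; rewrite ?lexx//= !subrr mulr0 add0r mulr_ge0.
have Sb : has_sup S by split; [exists a|exists b => x [/andP[]]].
pose c := sup S.
have ac : a <= c by apply: ub_le_sup => //; case: Sb.
have cb : c <= b by apply: ge_sup; [exists a|move=> x [/andP[]]].
(* [f] is continuous and [phi] nondecreasing, so the inequality passes to the supremum from the
   left. *)
have Sc : S c.
  split; first by rewrite ac.
  apply/ler_addgt0Pr => d d0.
  have /cvgrPdist_lt /(_ (d / 2)) := fc c.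
  rewrite divr_gt0// => /(_ isT) /nbhs_ballP[d1 /= d10 fd1].
  pose K := `|M + e| + 1.
  have K0 : 0 < K by rewrite ltr_wpDl.
  have d20 : 0 < Num.min d1 (d / 2 / K) by rewrite lt_min d10 !divr_gt0.
  have [x [axb Sx] cx] := sup_adherent d20 Sb.
  rewrite -/c in cx.
  have xc : x <= c by apply: ub_le_sup; [case: Sb|split].
  have [cx1 cx2] : c - d1 < x /\ c - d / 2 / K < x.
    by move: cx; rewrite ltrBlDr -ltrBlDl lt_min => /andP[]; lra.
  have fx : f c - f x <= d / 2.
    apply: le_trans (ler_norm _) _; apply/ltW/fd1.
    by rewrite /ball/= ger0_norm ?subr_ge0//; lra.
  have px := phi_le _ _ xc.
  have : k * phi x <= k * phi c by rewrite ler_wpM2l.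
  have : (M + e) * (x - a) <= (M + e) * (c - a) + d / 2.
    rewrite -lerBlDl -mulrBr (le_trans (ler_norm _))// normrM.
    rewrite (_ : x - a - (c - a) = - (c - x)); last by lra.
    rewrite normrN (@ger0_norm _ (c - x)) ?subr_ge0//.
    rewrite (@le_trans _ _ (K * (c - x)))//.
      by rewrite ler_wpM2r ?subr_ge0// lerDl.
    by rewrite mulrC -ler_pdivlMr//; lra.
  lra.
have [cbE|cltb] : c = b \/ c < b.
  by move: cb; rewrite le_eqVlt => /orP[/eqP|]; [left|right].
  rewrite cbE in Sc; case: Sc => _ /le_trans; apply.
  by rewrite lerD2l ler_wpM2l.
suff [y [cy yb] yS] : exists2 y, c < y /\ y <= b &
    f y - f c <= (M + e) * (y - c) + k * (phi y - phi c).
  exfalso; have : S y.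
    split; first by rewrite (le_trans ac (ltW cy)).
    by have [_] := Sc; lra.
  move=> Sy; have : y <= c by apply: ub_le_sup => //; case: Sb.
  by rewrite leNgt cy.
(* Inside [O] the increment of [phi] equals [y - c] and pays for the Lipschitz bound; outside [O]
   the point is not exceptional and the derivative bound holds. *)
have [Oc|Oc] := pselect (O c).
  have /nbhs_ballP[d /= d0 dO] : nbhs c O by exact: open_nbhs_nbhs.
  pose y := Num.min b (c + d / 2).
  have cy : c < y by rewrite lt_min cltb ltrDl divr_gt0.
  have yd : y <= c + d / 2 by rewrite ge_min lexx orbT.
  exists y; first by split=> //; rewrite ge_min lexx.
  have -> : phi y - phi c = y - c.
    apply: phi_add => //; first exact: ltW.
    move=> z /andP[cz zy]; apply: dO; rewrite /ball/= distrC ger0_norm; lra.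
  have := f_lip y c; rewrite (@ger0_norm _ (y - c)) ?subr_ge0 ?(ltW cy)// => fyc.
  have : f y - f c <= k * (y - c) by apply: le_trans (ler_norm _) fyc.
  have Me : 0 <= (M + e) * (y - c) by rewrite mulr_ge0 ?subr_ge0 ?ltW// ltr_wpDl.
  lra.
have altc : a < c.
  rewrite lt_neqAle ac andbT; apply/negP => /eqP aE; apply: Oc; rewrite -aE.
  by apply: B'O; right.
have Nc : ~ N c by move=> /NB Bc; apply: Oc; apply: B'O; left.
have [|dfc dfcM] := dfM c _ Nc; first by rewrite altc.
have Dlt : 'D_1 f c < M + e by rewrite (le_lt_trans dfcM)// ltrDl.
have := cvgr_lt _ dfc _ Dlt => -[d /= d0 dP].
pose h := Num.min (b - c) (d / 2).
have h0 : 0 < h by rewrite lt_min subr_gt0 cltb divr_gt0.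
have hd : h <= d / 2 by rewrite ge_min lexx orbT.
have hb : h <= b - c by rewrite ge_min lexx.
exists (c + h); first by split; lra.
have : h^-1 *: (f (h *: 1 + c) - f c) < M + e.
  apply: dP; last by rewrite gt_eqF.
  by rewrite /ball/= sub0r normrN gtr0_norm//; lra.
rewrite /GRing.scale/= mulr1 mulrC ltr_pdivrMr// (addrC h) => fh.
have : phi c <= phi (c + h) by apply: phi_le; lra.
rewrite -subr_ge0 => /(mulr_ge0 k0) kphi.
have -> : c + h - c = h by lra.
lra.
Unshelve. all: by end_near. Qed.

End LipschitzDerivative.

Section WNorm.
Context {R : realType} {r : {posnum R}} {n : nat}.
Local Notation I := (`[- r%:num, 0]%classic : set R).
Implicit Types (u : histW r n) (x : histC r n).

Lemma hist_norm_ub x (s : R) : `|x s| <= `|x|.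
Proof. by rewrite hist_clamp; apply: supnorm_ub; exact: clamp_in. Qed.

Lemma hist_norm_le x (k : R) : (forall s, I s -> `|x s| <= k) -> `|x| <= k.
Proof. exact: supnorm_le. Qed.

Lemma hist_lipschitz x (k : R) : 0 <= k ->
  (forall s t : R, I s -> I t -> `|x s - x t| <= k * `|s - t|) ->
  forall s t : R, `|x s - x t| <= k * `|s - t|.
Proof.
move=> k0 xk s t; rewrite (hist_clamp x s) (hist_clamp x t).
apply: le_trans (xk _ _ _ _) _; [exact: clamp_in|exact: clamp_in|].
by rewrite ler_wpM2l ?clamp_lip.
Qed.

Lemma histW_lipP u : exists2 k : R, 0 <= k & forall s t : R, `|u s - u t| <= k * `|s - t|.
Proof. by have /lip_predP : (u : histC r n) \in @lip_pred R r n by case: u. Qed.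

Lemma deriv_Linfty_le u (k : R) :
  (forall s t : R, `|u s - u t| <= k * `|s - t|) -> (deriv_Linfty u <= k%:E)%E.
Proof.
move=> uk; apply/ess_supP; move: (deriv_within_ae u).
apply: (@filterS _ _ (ae_filter_ringOfSetsType _)) => s [-> du].
rewrite lee_fin -[leLHS](cvg_lim _ (cvg_norm du))//.
apply: limr_le; first exact: (cvgP _ (cvg_norm du)).
near=> h; rewrite normrZ normfV ler_pdivrMl; last first.
  by rewrite normr_gt0; near: h; exact: nbhs_dnbhs_neq.
by rewrite (le_trans (uk _ _))//= addrK mulrC /GRing.scale/= mulr1.
Unshelve. all: by end_near. Qed.

(** Membership in W provides some Lipschitz constant [m], which rules out growth on a null set; the
    almost everywhere bound on the derivative then yields the sharp constant [k]. *)
Lemma deriv_Linfty_lipschitz u (k : R) : 0 <= k -> (deriv_Linfty u <= k%:E)%E ->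
  forall s t : R, `|u s - u t| <= k * `|s - t|.
Proof.
move=> k0 uk; apply: hist_lipschitz => //.
suff H s t : I s -> I t -> s <= t -> `|u t - u s| <= k * (t - s).
  move=> s t Is It; have [st|/ltW ts] := leP s t.
    by rewrite distrC (le_trans (H _ _ Is It st))// distrC ger0_norm ?subr_ge0.
  by rewrite (le_trans (H _ _ It Is ts))// ger0_norm ?subr_ge0.
move=> Is It st; have [m m0 um] := histW_lipP u.
have [N [mN N0 NP]] : {ae @hist_mu R r, forall s, deriv_within I u s = 'D_1 u s /\ derivable u s 1 /\ `|deriv_within I u s| <= k}.
  move/ess_supP : uk; move: (deriv_within_ae u).
  apply: (@filterS2 _ _ (ae_filter_ringOfSetsType _)) => z [] -> du.
  by rewrite lee_fin.
have N0' : (@lebesgue_measure R).-negligible (N `&` `[- r%:num, 0]).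
  by exists (N `&` `[- r%:num, 0]); split => //; exact: measurableI.
have main (e : R) j : `|e| = 1 -> e * (u t ord0 j - u s ord0 j) <= k * (t - s).
  move=> e1; rewrite mulrBr.
  apply: (@ae_derive_le_increment R (fun z => e * u z ord0 j) m k s t _ _ N0') => //.
    move=> x y; rewrite -mulrBr normrM e1 mul1r.
    by apply: le_trans (um x y); rewrite (le_trans _ (rV_coord_le _ j))// !mxE.
  move=> x /andP[sx xt] Nx.
  have Ix : I x.
    move: Is It; rewrite /= !in_itv/= => /andP[rs _] /andP[_ t0].
    by rewrite !ltW ?(le_lt_trans rs)// ?(lt_le_trans xt).
  have : deriv_within I u x = 'D_1 u x /\ derivable u x 1 /\ `|deriv_within I u x| <= k.
    by apply: contra_notP Nx => Px; split=> //; exact: NP.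
  move=> [-> [du duk]].
  have dj := is_derive_coord (derivableP du) j.
  have dej : is_derive x 1 (fun z => e * u z ord0 j) (e * ('D_1 u x) ord0 j).
    exact: (@is_deriveZ _ _ _ (fun z => u z ord0 j) e x 1 _ dj).
  split; first by case: dej.
  have -> : 'D_1 (fun z => e * u z ord0 j) x = e * ('D_1 u x) ord0 j by case: dej.
  rewrite (le_trans (ler_norm _))// normrM e1 mul1r.
  exact: le_trans (rV_coord_le _ _) duk.
apply/rV_norm_leP; first by rewrite mulr_ge0 ?subr_ge0.
move=> j; rewrite !mxE ler_norml.
have := main 1 j (normr1 _); have := main (-1) j (normrN1 _).
lra.
Qed.

(** From here on the norm of W is handled as a sup bound together with a Lipschitz constant, and
    almost everywhere derivatives do not reappear. *)
Lemma histW_norm_leP u (k : R) : 0 <= k -> `|u| <= k <->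
  (forall s, `|u s| <= k) /\ (forall s t : R, `|u s - u t| <= k * `|s - t|).
Proof.
move=> k0; rewrite histW_normE ge_max; split=> [/andP[uk duk]|[uk ul]].
  split=> [s|]; first exact: le_trans (hist_norm_ub _ _) uk.
  by apply: deriv_Linfty_lipschitz => //; rewrite -(fineK (deriv_Linfty_fin u)) lee_fin.
apply/andP; split; first by apply: hist_norm_le => s _; exact: uk.
by rewrite -lee_fin (fineK (deriv_Linfty_fin u)) deriv_Linfty_le.
Qed.

Lemma histW_norm_ub u (s : R) : `|u s| <= `|u|.
Proof. by have /(histW_norm_leP u (normr_ge0 u)) [] := lexx `|u|. Qed.

Lemma histW_norm_lip u (s t : R) : `|u s - u t| <= `|u| * `|s - t|.
Proof. by have /(histW_norm_leP u (normr_ge0 u)) [] := lexx `|u|. Qed.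

Lemma lip_hist_norm_le u : `|u : histC r n| <= `|u|.
Proof. by rewrite histW_normE le_max lexx. Qed.

End WNorm.

(** * Compact balls of Lipschitz histories *)

Lemma fmap_ultra (T U : Type) (f : T -> U) (F : set_system T) :
  UltraFilter F -> UltraFilter (fmap f F).
Proof.
move=> FU; split=> [|G GF FG]; first exact: fmap_proper_filter.
apply/seteqP; split=> [A GA|]; last exact: FG.
have [//|FnA] := in_ultra_setVsetC (f @^-1` A) FU.
have GnA : G (~` A) by exact: FG.
by have /filter_ex [? []] : G (A `&` ~` A) by exact: filterI.
Qed.

Section HistoryBall.
Context {R : realType} {r : {posnum R}} {n : nat}.
Local Notation E := 'rV[R]_n.
Local Notation C := (histC r n).
Local Notation I := (`[- r%:num, 0]%classic : set R).

Definition lip_ball (rho kap : R) : set C :=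
  [set x | (forall s, `|x s| <= rho) /\ forall s t, `|x s - x t| <= kap * `|s - t|].

Lemma compact_rV_ball (rho : R) : compact [set v : E | `|v| <= rho].
Proof.
apply: bounded_closed_compact.
  by exists rho; split; [exact: num_real|move=> M /ltW rM v /= /le_trans; apply].
apply: (@closed_comp _ _ (fun v : E => `|v|) [set x : R | x <= rho]).
  by move=> v _; exact: norm_continuous.
exact: closed_le.
Qed.

(** Ascoli's theorem by ultrafilters: pointwise limits exist because balls of R^n are compact, they
    inherit both bounds, and the common Lipschitz constant with compactness of [I] makes the
    convergence uniform. *)
Lemma lip_ball_compact (rho kap : R) : 0 <= kap -> compact (lip_ball rho kap).
Proof.
move=> kap0; rewrite compact_ultra => F FU FS.
have cv (s : R) : exists l : E, (x : C) s @[x --> F] --> l.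
  have Fs : F [set x : C | `|x s| <= rho] by apply: filterS FS => x [xr xk]; first [exact: xr|exact: xk].
  have := @compact_rV_ball rho.
  rewrite compact_ultra => /(_ (fmap (fun x : C => x s) F) (fmap_ultra _ FU) Fs).
  by move=> [l [_ xl]]; exists l.
have [l lP] := choice cv.
have l_rho s : `|l s| <= rho.
  apply: (@closed_cvg _ _ F _ (fun x : C => x s) [set v : E | `|v| <= rho]) (lP s).
    exact: (compact_closed (@norm_hausdorff _ _) (@compact_rV_ball rho)).
  by apply: filterS FS => x [xr xk]; first [exact: xr|exact: xk].
have l_kap s t : `|l s - l t| <= kap * `|s - t|.
  have cst : `|(x : C) s - (x : C) t| @[x --> F] --> `|l s - l t|.
    by apply: cvg_norm; apply: cvgB; exact: lP.
  apply: (@closed_cvg _ _ F _ (fun x : C => `|x s - x t|) [set v : R | v <= kap * `|s - t|]) cst.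
    exact: closed_le.
  by apply: filterS FS => x [xr xk]; first [exact: xr|exact: xk].
have l_hist : l \in @hist_pred R r n.
  apply/asboolP; split; first exact: lipschitz_continuous l_kap.
  move=> s; apply: (@cvg_unique _ (@norm_hausdorff _ _) _ _ _ _ (lP s)).
  have -> : (fun x : C => x s) = (fun x : C => x (clamp r s)).
    by apply/funext => x; exact: hist_clamp.
  exact: lP.
exists (Hist l_hist); split => /=; first by split.
apply/cvgrPdist_le => e e0.
have : \forall x \near F, I `<=` (fun s => `|l s - (x : C) s| <= e).
  have := (compact_near_coveringP I).1 (@segment_compact _ _ _); apply => s Is.
  have K0 : 0 < kap + 1 by rewrite ltr_wpDl.
  have e40 : 0 < e / 4 / (kap + 1) by rewrite !divr_gt0.
  near=> t x.
  have st : `|s - t| <= e / 4 / (kap + 1).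
    near: t; apply: filterS (nbhsx_ballx s _ e40) => t; rewrite -ball_normE /=; exact: ltW.
  have kst : kap * `|s - t| <= e / 4.
    rewrite (@le_trans _ _ ((kap + 1) * `|s - t|)) ?ler_wpM2r ?lerDl//.
    by rewrite mulrC -ler_pdivlMr.
  have xs : `|l s - (x : C) s| <= e / 2.
    near: x; move/cvgrPdist_le : (lP s); apply; exact: divr_gt0.
  have [_ xk] : lip_ball rho kap x by near: x; exact: FS.
  have := xk s t; have := l_kap s t; move: xs kst => xs kst lk {}xk.
  rewrite (_ : l t - (x : C) t = (l t - l s) + (l s - (x : C) s) + ((x : C) s - (x : C) t)).
    rewrite (le_trans (ler_normD _ _))// (le_trans (lerD (ler_normD _ _) (lexx _)))//.
    by rewrite (distrC (l t)); lra.
  by rewrite !subrKA.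
apply: filterS => x xI; apply: hist_norm_le => s Is; exact: xI.
Unshelve. all: by end_near. Qed.

(** The mean value inequality for [tau] runs along segments, which must stay in the compact set
    where [D2tau] is bounded. *)
Lemma lip_ball_convex (rho kap : R) (x y : C) (t : R) : 0 <= t <= 1 ->
  lip_ball rho kap x -> lip_ball rho kap y -> lip_ball rho kap (y + t *: (x - y)).
Proof.
move=> /andP[t0 t1] [xr xk] [yr yk].
have zE s : (y + t *: (x - y)) s = t *: x s + (1 - t) *: y s.
  rewrite [LHS](_ : _ = y s + t *: (x s - y s))// scalerBr scalerBl scale1r.
  by rewrite addrC -addrA (addrC _ (y s)).
have H (u v : E) (k : R) : `|u| <= k -> `|v| <= k -> `|t *: u + (1 - t) *: v| <= k.
  move=> uk vk; rewrite (le_trans (ler_normD _ _))// !normrZ ger0_norm//.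
  rewrite (@ger0_norm _ (1 - t)) ?subr_ge0//.
  have : t * `|u| <= t * k by rewrite ler_wpM2l.
  have : (1 - t) * `|v| <= (1 - t) * k by rewrite ler_wpM2l ?subr_ge0.
  lra.
split=> [s|a b]; first by rewrite zE; exact: H.
rewrite !zE opprD addrACA -!scalerBr; exact: H.
Qed.

Lemma hist_eval_continuous : continuous (fun q : C * R => q.1 q.2).
Proof.
move=> [x s]; apply/cvgrPdist_le => /= e e0; near=> q => /=.
have -> : x s - q.1 q.2 = (x s - x q.2) + (x - q.1) q.2 by rewrite [X in _ + X]/= addrA subrK.
rewrite (splitr e) (le_trans (ler_normD _ _))// lerD//.
  near: q; apply: (@cvg_snd _ _ (nbhs x) (nbhs s) _ [set t | `|x s - x t| <= e / 2]).
  by have /cvgrPdist_le := @hist_continuous _ _ _ x s; apply; exact: divr_gt0.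
apply: le_trans (hist_norm_ub _ _) _.
near: q; apply: (@cvg_fst _ _ (nbhs x) (nbhs s) _ [set y | `|x - y| <= e / 2]).
by have /cvgrPdist_le := @cvg_id _ (nbhs x); apply; exact: divr_gt0.
Unshelve. all: by end_near. Qed.

End HistoryBall.

(** * Operator norms and mean value inequalities *)

Section BoundedLinear.
Context {R : realType}.

(** [opnorm] is a supremum with a default value on unbounded sets, so some bound [k] must be known
    before it bounds anything. *)
Lemma opnorm_ub {X Y : normedModType R} (f : X -> Y) :
  (forall (a : R) x, f (a *: x) = a *: f x) ->
  (exists k : R, forall x, `|f x| <= k * `|x|) ->
  forall x, `|f x| <= opnorm f * `|x|.
Proof.
move=> fZ [k fk].
have hs : has_sup [set `|f x| | x in [set x : X | `|x| <= 1]].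
  split; first by exists `|f 0|, 0 => //=; rewrite normr0.
  exists `|k| => _ [x /= x1 <-]; rewrite (le_trans (fk x))//.
  rewrite (le_trans (ler_norm _))// normrM normr_id.
  by rewrite ler_piMr.
move=> x; have [->|x0] := eqVneq x 0.
  by have := fZ 0 0; rewrite !scale0r => ->; rewrite !normr0 mulr0.
have nx0 : 0 < `|x| by rewrite normr_gt0.
rewrite -ler_pdivrMr//.
have : `|f (`|x|^-1 *: x)| <= opnorm f.
  apply: sup_upper_bound => //; exists (`|x|^-1 *: x) => //=.
  by rewrite normrZ normfV normr_id mulVf// gt_eqF.
by rewrite fZ normrZ normfV normr_id mulrC.
Qed.

Lemma diff_bounded {X Y : normedModType R} (f : X -> Y) x : differentiable f x ->
  exists k : R, forall v, `|'d f x v| <= k * `|v|.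
Proof.
move=> /diff_continuous /linear_lipschitz[k _ fk]; by exists k.
Qed.

Lemma opnorm_diff_ub {X Y : normedModType R} (f g : X -> Y) x y :
  differentiable f x -> differentiable g y ->
  forall v, `|'d f x v - 'd g y v| <= opnorm (fun v => 'd f x v - 'd g y v) * `|v|.
Proof.
move=> /diff_bounded[k fk] /diff_bounded[l gl]; apply: opnorm_ub.
  by move=> a v; rewrite scalerBr; congr (_ - _); exact: linearZZ.
exists (k + l) => v; rewrite (le_trans (ler_normB _ _))// mulrDl.
by apply: lerD.
Qed.

Lemma is_derive_segment {X Y : normedModType R} (f : X -> Y) (x v : X) (t : R) :
  (forall x, differentiable f x) ->
  is_derive t 1 (fun t : R => f (x + t *: v)) ('d f (x + t *: v) v).
Proof.
move=> df; pose g (t : R) := x + t *: v.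
have dg : is_diff t g ( *:%R^~ v).
  by apply: is_diff_eq; rewrite add0r.
have [dgt gE] := dg.
have dfg : differentiable (f \o g) t by exact: differentiable_comp.
apply: DeriveDef; first exact: diff_derivable.
rewrite -[fun _ => _]/(f \o g) deriveE// diff_comp//= gE /= scale1r//.
Qed.

Lemma is_derive_scalel {Y : normedModType R} (v : Y) (t : R) :
  is_derive t 1 (fun t : R => t *: v) v.
Proof.
have [dt tE] := is_diff_scalel t v.
by apply: DeriveDef; [exact: diff_derivable|rewrite deriveE// tE scale1r].
Qed.

(** With [A = 0] this is a Lipschitz bound; with [A] the value at [x - y] of the differential at a
    nearby point it is strict differentiability. *)
Lemma mean_value_ineq {X : normedModType R} {n : nat} (f : X -> 'rV[R]_n)
    (x y : X) (A : 'rV[R]_n) (e : R) :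
  (forall z, differentiable f z) ->
  (forall t, 0 <= t <= 1 -> `|'d f (y + t *: (x - y)) (x - y) - A| <= e) ->
  `|f x - f y - A| <= e.
Proof.
move=> df dfA.
pose g (t : R) := f (y + t *: (x - y)) - t *: A.
have dg (t : R) : is_derive t 1 g ('d f (y + t *: (x - y)) (x - y) - A).
  apply: is_deriveB; first exact: is_derive_segment.
  exact: is_derive_scalel.
have gc : continuous g.
  by move=> t; apply/differentiable_continuous/derivable1_diffP; case: (dg t).
have := @derive_le_lipschitz R n g _ e 0 1 ler01 gc (fun t _ => dg t).
have -> : g 1 = f x - A by rewrite /g !scale1r subrKC.
have -> : g 0 = f y by rewrite /g !scale0r addr0 subr0.
rewrite subr0 mulr1 addrAC; apply => u /andP[u0 u1]; apply: dfA.
by rewrite !ltW.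
Qed.

Lemma real_mean_value_ineq {X : normedModType R} (f : X -> R)
    (x y : X) (A : R) (e : R) :
  (forall z, differentiable f z) ->
  (forall t, 0 <= t <= 1 -> `|'d f (y + t *: (x - y)) (x - y) - A| <= e) ->
  `|f x - f y - A| <= e.
Proof.
move=> df dfA; pose o : 'rV[R]_1 := const_mx 1.
have no (a : R) : `|a *: o| = `|a|.
  rewrite normrZ [X in _ * X](_ : _ = 1) ?mulr1//.
  apply/eqP; rewrite eq_le; apply/andP; split.
    by apply/rV_norm_leP => // j; rewrite mxE normr1.
  by have := rV_coord_le o ord0; rewrite mxE normr1.
rewrite -no 2!scalerBl; apply: (@mean_value_ineq X 1 (fun z => f z *: o)) => [z|t t01].
  exact: differentiableZl.
by rewrite diffZl// -scalerBl no; exact: dfA.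
Qed.

End BoundedLinear.

(** * Picard iteration *)

Section Picard.
Context {R : realType}.

Lemma real_antiderivative (f : R -> R) : continuous f ->
  exists P : R -> R, [/\ continuous P, forall t : R, t <= 0 -> P t = 0
    & forall t : R, 0 < t -> is_derive t 1 P (f t)].
Proof.
(* Starting the integral at -1 puts 0 in the interior, so that [F] is differentiable, hence
   continuous, at 0. *)
move=> fc; pose F (x : R) := (\int[lebesgue_measure]_(t in [set` `[-1, x]]) f t)%R.
have dF (x : R) : -1 < x -> is_derive x 1 F (f x).
  move=> x1; have [||dFx FE] := @continuous_FTC1_closed R f (-1) x (x + 1) _ _ x1 (fc x).
  - by rewrite ltrDl.
  - apply: continuous_compact_integrable; first exact: segment_compact.
    exact: continuous_subspaceT.
  by apply: DeriveDef; [exact: dFx|rewrite -derive1E; exact: FE].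
have N10 : (-1 : R) < 0 by rewrite oppr_lt0.
(* [P] vanishes for [t <= 0], so adding it to an initial curve leaves the history unchanged. *)
pose P (t : R) := F (Num.max t 0) - F 0.
have Pc : continuous P.
  move=> t; apply: cvgB; last exact: cvg_cst.
  apply: (@continuous_comp _ _ _ (fun t : R => Num.max t 0) F).
    by apply: (@continuous_max _ _ (id : R -> R) (cst 0)); [exact: cvg_id|exact: cvg_cst].
  apply/differentiable_continuous/derivable1_diffP.
  by case: (dF (Num.max t 0)) => //; rewrite lt_max N10 orbT.
exists P; split=> // [t t0|t t0]; first by rewrite /P (max_idPr t0) subrr.
have dP : is_derive t 1 (fun u => F u - F 0) (f t).
  rewrite -[f t]subr0; apply: is_deriveB; first by apply: dF; exact: lt_trans t0.
apply: (near_eq_is_derive _ dP).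
near=> u; rewrite /P (max_idPl _)// ltW//.
near: u; exact: lt_nbhsr.
Unshelve. all: by end_near. Qed.

Context {n : nat}.
Local Notation E := 'rV[R]_n.

Lemma antiderivative (f : R -> E) : continuous f ->
  exists P : R -> E, [/\ continuous P, forall t : R, t <= 0 -> P t = 0
    & forall t : R, 0 < t -> is_derive t 1 P (f t)].
Proof.
move=> fc; have [P Pc] := choice (fun j : 'I_n => real_antiderivative (@continuous_coord _ _ _ j fc)).
exists (fun t => \row_j P j t); split => [t|t t0|t t0].
- apply: coord_cvg => j; rewrite mxE.
  have -> : (fun x => (\row_j0 P j0 x) ord0 j) = P j by apply/funext => x; rewrite mxE.
  by have [Pjc _ _] := Pc j; exact: Pjc.
- by apply/rowP => j; rewrite !mxE; have [_ P0 _] := Pc j; exact: P0.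
- apply: coord_is_derive => j.
  have -> : (fun x => (\row_j0 P j0 x) ord0 j) = P j by apply/funext => x; rewrite mxE.
  by have [_ _ dP] := Pc j; exact: dP.
Qed.

Lemma geometric_half_cvg (u : nat -> E) (c : R) : 0 <= c ->
  (forall k, `|u k.+1 - u k| <= c * 2^-1 ^+ k) ->
  exists2 l : E, u k @[k --> \oo] --> l & forall k, `|u k - l| <= 2 * c * 2^-1 ^+ k.
Proof.
move=> c0 uc.
have ukm k m : `|u (k + m)%N - u k| <= 2 * c * 2^-1 ^+ k.
  suff : `|u (k + m)%N - u k| <= 2 * c * 2^-1 ^+ k - 2 * c * 2^-1 ^+ (k + m).
    move=> /le_trans; apply; rewrite lerBlDr lerDl.
    by rewrite !mulr_ge0// exprn_ge0// invr_ge0.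
  elim: m => [|m IH]; first by rewrite addn0 !subrr normr0.
  rewrite addnS -[_ - u k](subrKA (u (k + m)%N)) (le_trans (ler_normD _ _))//.
  apply: (le_trans (lerD (uc _) IH)); rewrite exprS.
  set a := _ ^+ (k + m); set b := _ ^+ k; lra.
have small : 2 * c * 2^-1 ^+ k @[k --> \oo] --> (0 : R).
  apply: (@cvg_geometric _ (2 * c) 2^-1).
  by rewrite ger0_norm ?invr_ge0// invf_lt1// ltr1n.
have : cvgn u.
  apply: cauchy_cvg; apply/cauchy_exP => e e0.
  have /cvgrPdist_lt/(_ _ e0)[k _ ke] := small.
  exists (u k); exists k => // m /= km; rewrite -ball_normE /= distrC -(subnKC km).
  rewrite (le_lt_trans (ukm _ _))//.
  have := ke k (leqnn k); rewrite sub0r normrN ger0_norm//.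
  by rewrite !mulr_ge0// exprn_ge0// invr_ge0.
move=> /cvg_ex[l ul]; exists l => // k.
have : `|u m - u k| @[m --> \oo] --> `|l - u k|.
  by apply: cvg_norm; apply: cvgB => //; exact: cvg_cst.
rewrite distrC; apply: (@closed_cvg _ _ _ _ (fun m => `|u m - u k|)
  [set v : R | v <= 2 * c * 2^-1 ^+ k]); first exact: closed_le.
by exists k => // m /= km; rewrite -(subnKC km).
Qed.

(** For the weight [e^(-2 L t)], integrating a causal [L]-Lipschitz functional halves distances,
    which gives existence for all times at once. [Q] is stable under the iteration and under
    pointwise limits; it carries the regularity without which [A] fails to be Lipschitz or
    continuous in time. *)
Lemma picard (A : (R -> E) -> R -> E) (x : R -> E) (L M : R) (Q : set (R -> E)) :
  0 < L -> 0 <= M -> (forall t : R, 0 <= t -> x t = x 0) ->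
  (forall y, Q y -> continuous y) -> (forall y, Q y -> continuous (A y)) -> Q x ->
  (forall y Y, Q y -> continuous Y -> (forall t : R, t <= 0 -> Y t = x t) ->
    (forall t : R, 0 < t -> is_derive t 1 Y (A y t)) -> Q Y) ->
  (forall (u : nat -> R -> E) y, (forall k, Q (u k)) ->
    (forall t, u k t @[k --> \oo] --> y t) -> Q y) ->
  (forall y z (t B : R), Q y -> Q z -> 0 <= t -> 0 <= B ->
    (forall s : R, s <= t -> `|y s - z s| <= B) -> `|A y t - A z t| <= L * B) ->
  (forall t : R, 0 <= t -> `|A x t| <= M) ->
  exists y, [/\ Q y, forall t : R, t <= 0 -> y t = x t
    & forall t : R, 0 < t -> is_derive t 1 y (A y t)].
Proof.
move=> L0 M0 x0 Qc QAc Qx QS Qcl AL AM.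
have ex_step y : exists Y, Q y -> [/\ Q Y, forall t : R, t <= 0 -> Y t = x t
    & forall t : R, 0 < t -> is_derive t 1 Y (A y t)].
  have [Qy|nQy] := pselect (Q y); last by exists x => /nQy.
  have [P [Pc P0 dP]] := antiderivative (QAc _ Qy).
  exists (fun t => x t + P t) => _.
  have dY (t : R) : 0 < t -> is_derive t 1 (fun t => x t + P t) (A y t).
    move=> t0; have dY0 : is_derive t 1 (fun t => x 0 + P t) (A y t).
      rewrite -[A y t]add0r; apply: is_deriveD; exact: dP.
    apply: (near_eq_is_derive _ dY0); near=> u; rewrite x0// ltW//.
    near: u; exact: lt_nbhsr.
  have Y0 (t : R) : t <= 0 -> x t + P t = x t by move=> t0; rewrite P0// addr0.
  split => //; apply: (QS y) => // t; apply: cvgD; [exact: Qc|exact: Pc].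
have [S SP] := choice ex_step.
pose u k := iter k S x.
have Qu k : Q (u k) by elim: k => //= k Qk; have [] := SP _ Qk.
have u_le0 k (t : R) : t <= 0 -> u k t = x t.
  by case: k => //= k t0; have [_ H _] := SP _ (Qu k); exact: H.
have du k (t : R) : 0 < t -> is_derive t 1 (u k.+1) (A (u k) t).
  by move=> t0; have [_ _ H] := SP _ (Qu k); exact: H.
(* The first increment is at most [M t], and [2 L t <= e^(2 L t)] turns this into [a e^(2 L t)]. *)
pose a : R := M / (2 * L).
have a0 : 0 <= a by rewrite divr_ge0// mulr_ge0// ltW.
pose ex (t : R) : R := expR (2 * L * t).
have dexp (s : R) : is_derive s 1 ex (2 * L * ex s).
  rewrite mulrC; exact: (is_derive1_comp (is_derive_expR _) (is_derive_mull (2 * L) s)).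
have exc : continuous ex.
  by move=> t; apply/differentiable_continuous/derivable1_diffP; case: (dexp t).
have ex_le (s t : R) : s <= t -> ex s <= ex t.
  by move=> st; rewrite ler_expR ler_wpM2l// mulr_ge0// ltW.
have ex_ge0 t : 0 <= ex t by exact: expR_ge0.
have dcex (c s : R) : is_derive s 1 (fun s => c * ex s) (c * (2 * L * ex s)).
  exact: (@is_deriveZ _ _ _ ex c s 1 _ (dexp s)).
(* The primitive of [L B e^(2 L s)] is [B / 2 e^(2 L s)]: this is the halving. *)
have step (y z Y Z : R -> E) (B t : R) : Q y -> Q z -> continuous Y -> continuous Z ->
    0 <= B -> 0 <= t ->
    (forall s : R, s <= 0 -> y s = z s) -> Y 0 = Z 0 ->
    (forall t : R, 0 < t -> is_derive t 1 Y (A y t)) ->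
    (forall t : R, 0 < t -> is_derive t 1 Z (A z t)) ->
    (forall s : R, 0 <= s <= t -> `|y s - z s| <= B * ex s) ->
    `|Y t - Z t| <= B / 2 * ex t.
  move=> Qy Qz Yc Zc B0 t0 yz0 YZ0 dY dZ yzB.
  have YZc : continuous (fun s => Y s - Z s) by move=> s; apply: cvgB; [exact: Yc|exact: Zc].
  have := @derive_le_comparison R n (fun s => Y s - Z s) (fun s => A y s - A z s)
    (fun s => B / 2 * ex s) (fun s => B / 2 * (2 * L * ex s)) 0 t t0 YZc _ _ _ _.
  rewrite YZ0 subrr subr0 => /(_ _ _ _ _)/le_trans; apply.
  - move=> s; apply: cvgM; [exact: cvg_cst|exact: exc].
  - move=> s /andP[s0 _]; apply: is_deriveB; [exact: dY|exact: dZ].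
  - move=> s /andP[s0 st]; apply: le_trans (AL y z s (B * ex s) Qy Qz (ltW s0) _ _) _.
    + by rewrite mulr_ge0.
    + move=> v vs; have [v0|v0] := leP v 0; first by rewrite yz0// subrr normr0 mulr_ge0.
      apply: le_trans (yzB v _) _; first by rewrite ltW// (le_trans vs)// ltW.
      by rewrite ler_wpM2l// ex_le.
    + by rewrite le_eqVlt; apply/orP; left; apply/eqP; field.
  - by rewrite gerBl mulr_ge0// divr_ge0.
have half_ge0 k : 0 <= 2^-1 ^+ k :> R by rewrite exprn_ge0// invr_ge0.
have udiff k (t : R) : 0 <= t -> `|u k.+1 t - u k t| <= a * 2^-1 ^+ k * ex t.
  elim: k t => [|k IH] t t0.
    rewrite expr0 mulr1; have -> : u 0%N t = u 1%N 0.
      by rewrite (u_le0 1%N 0)//; exact: x0.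
    have u1 := @derive_le_lipschitz R n (u 1%N) (A x) M 0 t t0 (Qc _ (Qu 1%N)).
    apply: le_trans (u1 _ _) _.
    + by move=> s /andP[s0 _]; exact: (du 0%N).
    + by move=> s /andP[s0 _]; exact: AM (ltW s0).
    rewrite subr0.
    rewrite /a -mulrA ler_wpM2l// mulrC ler_pdivlMr ?mulr_gt0//.
    by rewrite mulrC (le_trans _ (expR_ge1Dx _))// lerDr.
  rewrite exprSr mulrA.
  have := @step (u k.+1) (u k) (u k.+2) (u k.+1) (a * 2^-1 ^+ k) t.
  apply => //; do ?exact: Qu; do ?exact: Qc (Qu _).
  - by rewrite mulr_ge0.
  - by move=> s s0; rewrite !u_le0.
  - by rewrite !u_le0.
  - by move=> s /andP[s0 _]; exact: IH.
have bnd_ge0 k t : 0 <= 2 * (a * ex t) * 2^-1 ^+ k.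
  exact: mulr_ge0 (mulr_ge0 (ler0n _ 2) (mulr_ge0 a0 (ex_ge0 t))) (half_ge0 k).
have bnd'_ge0 k : 0 <= 2 * a * 2^-1 ^+ k.
  exact: mulr_ge0 (mulr_ge0 (ler0n _ 2) a0) (half_ge0 k).
have [y yP] : exists y : R -> E, forall t, u k t @[k --> \oo] --> y t /\
    (0 <= t -> forall k, `|u k t - y t| <= 2 * (a * ex t) * 2^-1 ^+ k).
  suff : forall t, exists l : E, u k t @[k --> \oo] --> l /\
    (0 <= t -> forall k, `|u k t - l| <= 2 * (a * ex t) * 2^-1 ^+ k).
    by move=> /choice[y yP]; exists y.
  move=> t; have [t0|t0] := leP t 0.
    exists (x t); split=> [|t0' k].
      have -> : u ^~ t = fun=> x t by apply/funext => k; rewrite u_le0.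
      exact: cvg_cst.
    by rewrite u_le0// subrr normr0 bnd_ge0.
  have aet : 0 <= a * ex t by rewrite mulr_ge0.
  have [k|l ul lk] := @geometric_half_cvg (u ^~ t) (a * ex t) aet.
    by rewrite mulrAC; exact: udiff (ltW t0).
  by exists l.
have Qy : Q y by apply: (Qcl u) => // t; have [] := yP t.
have y_le0 (t : R) : t <= 0 -> y t = x t.
  move=> t0; have [yt _] := yP t; apply: (@cvg_unique _ (@norm_hausdorff _ _) _ _ _ _ yt).
  have -> : u ^~ t = fun=> x t by apply/funext => k; rewrite u_le0.
  exact: cvg_cst.
have [QY Y_le0 dY] := SP _ Qy.
(* One more step halves the weighted distance from [u k] to [y], so [u k.+1] converges to [S y] as
   well as to [y]. *)
have YE : S y = y.
  apply/funext => t; have [t0|t0] := leP t 0; first by rewrite Y_le0// y_le0.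
  have [yt yk] := yP t.
  suff Yt : u k.+1 t @[k --> \oo] --> S y t.
    apply: (@cvg_unique _ (@norm_hausdorff _ _) _ _ _ _ Yt).
    by rewrite /= (cvg_shiftS (u ^~ t)).
  apply/cvgrPdist_le => e e0.
  have small : 2 * (a * ex t) * 2^-1 ^+ k @[k --> \oo] --> (0 : R).
    apply: (@cvg_geometric _ (2 * (a * ex t)) 2^-1).
    by rewrite ger0_norm ?invr_ge0// invf_lt1// ltr1n.
  have /cvgrPdist_le/(_ _ e0) := small; apply: filterS => k.
  rewrite sub0r normrN ger0_norm ?bnd_ge0//.
  apply: le_trans; rewrite distrC.
  have := @step (u k) y (u k.+1) (S y) (2 * a * 2^-1 ^+ k) t.
  move=> /(_ (Qu k) Qy (Qc _ (Qu _)) (Qc _ QY) (bnd'_ge0 k) (ltW t0)) H.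
  apply: le_trans (H _ _ (du k) dY _) _.
  - by move=> s s0; rewrite u_le0// y_le0.
  - by rewrite u_le0// Y_le0.
  - move=> s /andP[s0 _]; have [_ /(_ s0 k)] := yP s.
    suff -> : 2 * (a * ex s) * 2^-1 ^+ k = 2 * a * 2^-1 ^+ k * ex s by [].
    by rewrite mulrA mulrAC.
  - have := mulr_ge0 (mulr_ge0 a0 (ex_ge0 t)) (half_ge0 k).
    move: (a) (ex t) (2^-1 ^+ k) => a' e' h'; clear -a' e' h'; lra.
by exists y; split=> // t t0; rewrite -{1}YE; exact: dY.
Unshelve. all: by end_near. Qed.

End Picard.

(** * Histories along a curve *)

Section Derivatives.
Context {R : realType} {V : normedModType R}.
Implicit Types (f : R -> V) (A : set R).

Lemma is_derive_cvg f (t : R) l : is_derive t 1 f l <->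
  (fun h : R => h^-1 *: (f (h + t) - f t)) @ 0^' --> l.
Proof.
have E : (fun h : R => h^-1 *: (f (h + t) - f t)) = (fun h => h^-1 *: (f (h *: 1 + t) - f t)).
  by apply/funext => h; rewrite /GRing.scale/= mulr1.
rewrite E; split=> [[d <-]|dl]; first exact: d.
apply: DeriveDef; first by apply/cvg_ex; exists l.
exact: cvg_lim.
Qed.

Lemma within_dnbhs_interior A (t : R) : nbhs t A ->
  within [set h : R | A (h + t)] 0^' = 0^'.
Proof.
move=> At; have At' : \forall h \near (0 : R)^', A (h + t).
  have c : (h + t) @[h --> (0 : R)] --> t.
    by rewrite -[X in _ --> X]add0r; apply: cvgD; [exact: cvg_id|exact: cvg_cst].
  by apply: cvg_within; exact: (c A At).
apply/seteqP; split => B; rewrite /within/= => BP; near=> h.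
  by apply: (near BP h) => //; near: h.
by move=> _; near: h.
Unshelve. all: by end_near. Qed.

Lemma has_deriv_within_interior A f (t : R) l : nbhs t A ->
  has_deriv_within A f t l <-> is_derive t 1 f l.
Proof.
by move=> At; rewrite /has_deriv_within within_dnbhs_interior// is_derive_cvg.
Qed.

Lemma nbhs_itvco (b t : R) : 0 < t < b -> nbhs t `[0, b[%classic.
Proof.
move=> tb; have := near_in_itvoo (_ : t \in `]0, b[).
rewrite [in X in X -> _]in_itv/= => /(_ tb); apply: filterS => s.
by rewrite /= !in_itv/= => /andP[/ltW-> ->].
Qed.

Lemma nbhs_itvcy (t : R) : 0 < t -> nbhs t `[0, +oo[%classic.
Proof.
move=> t0; have := @nbhs_itvco (t + 1) t; rewrite t0 ltrDl ltr01 => /(_ isT).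
by apply: filterS => s; rewrite /= !in_itv/= => /andP[-> _].
Qed.

End Derivatives.

Section Segments.
Context {R : realType} {r : {posnum R}} {n : nat}.
Local Notation E := 'rV[R]_n.
Local Notation C := (histC r n).
Local Notation W := (histW r n).
Local Notation I := (`[- r%:num, 0]%classic : set R).
Implicit Types (y z : R -> E) (s t k rho kap : R).

(** Curves are built with derivatives at positive times only. The equation at time 0 follows from
    continuity of the right-hand side there, by the mean value inequality for [y s - s *: dy 0]. *)
Lemma right_derivative_at0 y dy (A : set R) (b : R) : 0 < b -> A `<=` [set s | 0 <= s] ->
  continuous y -> {for (0 : R), continuous dy} ->
  (forall t, 0 < t < b -> is_derive t 1 y (dy t)) ->
  has_deriv_within A y 0 (dy 0).
Proof.
move=> b0 A0 yc dyc ydy; apply/cvgrPdist_le => e e0.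
have /cvgrPdist_le/(_ _ e0)/nbhs_ballP[d /= d0 dyd] := dyc.
rewrite near_withinE; near=> h => Ah.
have h0 : 0 < h.
  rewrite lt_neqAle; apply/andP; split; last by have := A0 _ Ah; rewrite /= addr0.
  by rewrite eq_sym; near: h; exact: nbhs_dnbhs_neq.
have hd : h < d.
  apply: le_lt_trans (ler_norm _) _; near: h; exact: dnbhs0_lt.
have hb : h < b.
  apply: le_lt_trans (ler_norm _) _; near: h; exact: dnbhs0_lt.
rewrite addr0.
have dg s : 0 < s < h -> is_derive s 1 (fun s => y s - s *: dy 0) (dy s - dy 0).
  move=> /andP[s0 sh]; apply: is_deriveB; last exact: is_derive_scalel.
  by apply: ydy; rewrite s0 (lt_trans sh).
have gc : continuous (fun s => y s - s *: dy 0).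
  move=> s; apply: cvgB; first exact: yc.
  by apply: cvgZl; exact: cvg_id.
have := @derive_le_lipschitz R n _ _ e 0 h (ltW h0) gc dg.
rewrite scale0r subr0 subr0 => H.
have -> : dy 0 - h^-1 *: (y h - y 0) = - (h^-1 *: (y h - h *: dy 0 - y 0)).
  by rewrite [in RHS]addrAC [in RHS]scalerBr scalerA mulVf ?gt_eqF// scale1r opprB.
rewrite normrN normrZ normfV gtr0_norm// ler_pdivrMl// mulrC; apply: H.
move=> u /andP[u0 uh]; rewrite distrC; apply: dyd.
by rewrite /ball/= sub0r normrN gtr0_norm// (lt_trans uh).
Unshelve. all: by end_near. Qed.

Lemma segC_curve y t s : continuous y -> segC r y t s = y (t + clamp r s).
Proof.
move=> yc; rewrite hist_clamp segCE//; last exact: clamp_in.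
exact: continuous_subspaceT.
Qed.

Lemma segC_in y t s : continuous y -> I s -> segC r y t s = y (t + s).
Proof. by move=> yc Is; rewrite segC_curve// clamp_id. Qed.

Lemma clamp_window t s : t - r%:num <= t + clamp r s <= t.
Proof.
have := clamp_in r s; rewrite /= in_itv/= => /andP[a b].
by rewrite lerD2l gerDl a b.
Qed.

Lemma window_clamp t s : t - r%:num <= s <= t -> s = t + clamp r (s - t).
Proof.
move=> /andP[a b]; rewrite clamp_id; first by rewrite addrC subrK.
by rewrite /= in_itv/= lerBrDl a subr_le0 b.
Qed.

Lemma segC_continuous y : continuous y -> continuous (fun t => segC r y t : C).
Proof.
move=> yc t0; apply/cvgrPdist_le => e e0.
have : \forall t \near t0, I `<=` (fun s => `|y (t0 + s) - y (t + s)| <= e).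
  apply: ((compact_near_coveringP I).1 (@segment_compact _ _ _) R (nbhs t0)
    (fun t s => `|y (t0 + s) - y (t + s)| <= e) _) => s Is.
  have ysc : {for (s, t0), continuous (fun p : R * R => y (t0 + p.1) - y (p.2 + p.1))}.
    apply: cvgB.
      apply: (@continuous_comp _ _ _ (fun p : R * R => t0 + p.1) y); last exact: yc.
      by apply: cvgD; [exact: cvg_cst|exact: cvg_fst].
    apply: (@continuous_comp _ _ _ (fun p : R * R => p.2 + p.1) y); last exact: yc.
    by apply: cvgD; [exact: cvg_snd|exact: cvg_fst].
  move/cvgrPdist_le : ysc => /(_ _ e0).
  by apply: filterS => -[s' t'] /=; rewrite subrr sub0r normrN.
apply: filterS => t tI; apply: hist_norm_le => s Is.
rewrite [X in `|X|](_ : _ = segC r y t0 s - segC r y t s)// !segC_in//.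
exact: tI.
Qed.

Lemma segC_shift y t a : continuous y ->
  segC r (fun s => y (s + a)) t = segC r y (t + a).
Proof.
move=> yc; have yc' : continuous (fun s => y (s + a)).
  move=> u; apply: (@continuous_comp _ _ _ (fun s : R => s + a) y); last exact: yc.
  by apply: cvgD; [exact: cvg_id|exact: cvg_cst].
apply: histP => s; rewrite inE => Is.
by rewrite (segC_in _ yc' Is) (segC_in _ yc Is) addrAC.
Qed.

Lemma segC_ext y z t : continuous y -> continuous z ->
  (forall s, t - r%:num <= s <= t -> y s = z s) -> segC r y t = segC r z t.
Proof.
move=> yc zc yz; apply: histP => s _; rewrite !segC_curve//.
by apply: yz; exact: clamp_window.
Qed.

Definition lip_on (a b k : R) y : Prop :=
  forall s t, a <= s <= b -> a <= t <= b -> `|y s - y t| <= k * `|s - t|.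

Lemma lip_onW a b a' b' k k' y : a <= a' -> b' <= b -> k <= k' ->
  lip_on a b k y -> lip_on a' b' k' y.
Proof.
move=> aa bb kk yk s t /andP[a's sb'] /andP[a't tb'].
apply: (le_trans (yk s t _ _)); last by rewrite ler_wpM2r.
  by rewrite (le_trans aa)// (le_trans sb').
by rewrite (le_trans aa)// (le_trans tb').
Qed.

(** Glues the initial history, Lipschitz by assumption, to the solution, Lipschitz by the size of
    its derivative. *)
Lemma lip_on_cat a b c k y : a <= b -> b <= c -> lip_on a b k y -> lip_on b c k y ->
  lip_on a c k y.
Proof.
move=> ab bc y1 y2.
suff H s t : a <= s -> s <= t -> t <= c -> `|y t - y s| <= k * (t - s).
  move=> s t /andP[as_ sc] /andP[at_ tc]; have [st|/ltW ts] := leP s t.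
    by rewrite distrC (distrC s) (ger0_norm (_ : 0 <= t - s)) ?subr_ge0// H.
  by rewrite (ger0_norm (_ : 0 <= s - t)) ?subr_ge0// H.
move=> as_ st tc; have nts : `|t - s| = t - s by rewrite ger0_norm ?subr_ge0.
have [tb|bt] := leP t b.
  by rewrite -nts y1// ?(le_trans st) ?(le_trans as_)// as_ (le_trans st).
have [bs|sb] := leP b s.
  by rewrite -nts; apply: y2; rewrite ?bs ?tc ?(le_trans bs st) ?(le_trans st tc).
rewrite -[y t - y s](subrKA (y b)) (le_trans (ler_normD _ _))//.
have -> : k * (t - s) = k * `|t - b| + k * `|b - s|.
  by rewrite !ger0_norm ?subr_ge0 ?ltW// -mulrDr subrKA.
by apply: lerD; [apply: y2|apply: y1]; apply/andP; split=> //; exact: ltW.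
Qed.

Lemma lip_on_deriv a b k y dy : continuous y ->
  (forall u : R, a < u < b -> is_derive u 1 y (dy u)) ->
  (forall u, a < u < b -> `|dy u| <= k) -> lip_on a b k y.
Proof.
move=> yc ydy dyk.
suff H s t : a <= s -> s <= t -> t <= b -> `|y t - y s| <= k * (t - s).
  move=> s t /andP[as_ sc] /andP[at_ tc]; have [st|/ltW ts] := leP s t.
    by rewrite distrC (distrC s) (ger0_norm (_ : 0 <= t - s)) ?subr_ge0// H.
  by rewrite (ger0_norm (_ : 0 <= s - t)) ?subr_ge0// H.
move=> as_ st tb; apply: (@derive_le_lipschitz R n y dy) => //.
  by move=> u /andP[su ut]; apply: ydy; rewrite (le_lt_trans as_)//= (lt_le_trans ut).
by move=> u /andP[su ut]; apply: dyk; rewrite (le_lt_trans as_)//= (lt_le_trans ut).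
Qed.

Lemma segC_lip_ball y t rho kap : continuous y -> 0 <= kap ->
  (forall s, t - r%:num <= s <= t -> `|y s| <= rho) ->
  lip_on (t - r%:num) t kap y -> lip_ball rho kap (segC r y t).
Proof.
move=> yc k0 yr yk; split=> [s|s u].
  by rewrite segC_curve//; apply: yr; exact: clamp_window.
rewrite !segC_curve// (le_trans (yk _ _ (clamp_window _ _) (clamp_window _ _)))//.
by rewrite opprD addrACA subrr add0r ler_wpM2l// clamp_lip.
Qed.

Lemma segW_hist y t k : continuous y -> 0 <= k -> lip_on (t - r%:num) t k y ->
  (segW r y t : C) = segC r y t.
Proof.
move=> yc k0 yk; rewrite /segW val_insubd ifT//; apply/lip_predP; exists k => // s u.
rewrite !segC_curve// (le_trans (yk _ _ (clamp_window _ _) (clamp_window _ _)))//.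
by rewrite opprD addrACA subrr add0r ler_wpM2l// clamp_lip.
Qed.

Lemma segC_dist_leP y z t k : continuous y -> continuous z ->
  `|segC r y t - segC r z t| <= k <-> forall s, t - r%:num <= s <= t -> `|y s - z s| <= k.
Proof.
move=> yc zc; split=> [yzk s ts|yzk].
  rewrite [in y s](window_clamp ts) [in z s](window_clamp ts) -!segC_curve//.
  exact: le_trans (hist_norm_ub (segC r y t - segC r z t) (s - t)) yzk.
apply: hist_norm_le => s _.
rewrite [X in `|X|](_ : _ = segC r y t s - segC r z t s)// !segC_curve//.
by apply: yzk; exact: clamp_window.
Qed.

(** The Lipschitz bounds on [y] and [z] are there because [segW] returns 0 on a segment that is not
    Lipschitz. *)
Lemma segW_dist_leP y z t k kap : continuous y -> continuous z -> 0 <= k -> 0 <= kap ->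
  lip_on (t - r%:num) t kap y -> lip_on (t - r%:num) t kap z ->
  `|segW r y t - segW r z t| <= k <->
  (forall s, t - r%:num <= s <= t -> `|y s - z s| <= k) /\
  lip_on (t - r%:num) t k (fun s => y s - z s).
Proof.
move=> yc zc k0 kap0 yk zk.
have dE s : (segW r y t - segW r z t) s = y (t + clamp r s) - z (t + clamp r s).
  rewrite [LHS](_ : _ = (segW r y t : C) s - (segW r z t : C) s)//.
  by rewrite !(segW_hist _ kap0)// !segC_curve.
rewrite histW_norm_leP//; split=> [[d1 d2]|[d1 d2]]; split.
- move=> s ts; rewrite [in y s](window_clamp ts) [in z s](window_clamp ts) -dE.
  exact: d1.
- move=> s u ts tu.
  rewrite [in y s](window_clamp ts) [in z s](window_clamp ts).
  rewrite [in y u](window_clamp tu) [in z u](window_clamp tu) -!dE.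
  by rewrite (le_trans (d2 _ _))// opprB addrA subrK.
- by move=> s; rewrite dE; apply: d1; exact: clamp_window.
- move=> s u; rewrite !dE (le_trans (d2 _ _ (clamp_window _ _) (clamp_window _ _)))//.
  by rewrite opprD addrACA subrr add0r ler_wpM2l// clamp_lip.
Qed.

Lemma segW_init y (x : W) : continuous y -> (forall s, I s -> y s = x s) -> segW r y 0 = x.
Proof.
move=> yc yx; have [k k0 xk] := histW_lipP x.
apply/val_inj; rewrite /= (segW_hist yc k0).
  by apply: histP => s; rewrite inE => Is; rewrite segC_in// add0r yx.
move=> s t; rewrite sub0r => Is It; rewrite !yx ?xk// /= in_itv.
Qed.

End Segments.

Lemma continuous_pair {T U V : topologicalType} (f : T -> U) (g : T -> V) (q : T) :
  {for q, continuous f} -> {for q, continuous g} ->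
  {for q, continuous (fun p => (f p, g p))}.
Proof. by move=> fq gq; exact: (@cvg_pair _ _ _ _ (nbhs (f q)) (nbhs (g q)) _ _ _ f g fq gq). Qed.

(** * Contracting skew products over a minimal flow *)

(** Density of full orbits yields density of forward semiorbits: the orbit of an omega-limit point
    [v] of [w] meets [U], hence so do the orbits of points near [v], which the orbit of [w] reaches
    at arbitrarily late times. *)
Lemma minimal_flow_recurrent {R : realType} {Omega : metricType R} (sigma : R -> Omega -> Omega) :
  compact [set: Omega] -> is_flow sigma -> minimal_flow sigma ->
  forall w (T : R) (U : set Omega), open U -> U !=set0 -> exists2 t, T <= t & U (sigma t w).
Proof.
move=> cO [sc s0 sD] smin w T U oU U0.
have [v [_ vcl]] := cO (fmap (sigma^~ w) +oo%R) _ filterT.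
have [_ [/[swap] -[s _ <-] Us]] := smin v U U0 oU.
have Vs : nbhs v (sigma s @^-1` U).
  have sv : {for v, continuous (sigma s)}.
    apply: (@continuous_comp _ _ _ (fun w => (s, w)) (fun p => sigma p.1 p.2)); last exact: sc.
    by apply: continuous_pair; [exact: cvg_cst|exact: cvg_id].
  exact: (sv U (open_nbhs_nbhs (conj oU Us))).
have FT : fmap (sigma^~ w) +oo%R [set sigma t w | t in [set t | T - s <= t]].
  have : \forall t \near +oo%R, T - s <= t by apply: nbhs_pinfty_ge; rewrite num_real.
  by apply: filterS => t tT; exists t.
have [_ [[t tT <-] Ut]] := vcl _ _ FT Vs.
exists (s + t); last by rewrite sD.
by rewrite -lerBlDl.
Qed.

Lemma is_flow_opp {R : realType} {Omega : metricType R} (sigma : R -> Omega -> Omega) :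
  is_flow sigma -> is_flow (fun t => sigma (- t)).
Proof.
move=> [sc s0 sD]; split=> [p|w|s t w]; last 2 first.
- by rewrite oppr0 s0.
- by rewrite opprD sD.
apply: (@continuous_comp _ _ _ (fun p : R * Omega => (- p.1, p.2)) (fun p => sigma p.1 p.2)); last exact: sc.
by apply: continuous_pair; [apply: cvgN; exact: cvg_fst|exact: cvg_snd].
Qed.

Lemma minimal_flow_opp {R : realType} {Omega : metricType R} (sigma : R -> Omega -> Omega) :
  minimal_flow sigma -> minimal_flow (fun t => sigma (- t)).
Proof.
move=> smin w U U0 oU; have [_ [/[swap] -[s _ <-] Us]] := smin w U U0 oU.
by exists (sigma s w); split=> //; exists (- s) => //; rewrite opprK.
Qed.

Lemma pair_hausdorff {U V : topologicalType} : hausdorff_space U -> hausdorff_space V ->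
  hausdorff_space (U * V)%type.
Proof.
move=> hU hV [x y] [x' y'] xy; congr pair.
  apply: hU => A B xA xB; have [||p [[? _] [? _]]] := xy (A `*` setT) (B `*` setT); last by exists p.1.
    by exists (A, setT) => //; split=> //=; exact: filterT.
  by exists (B, setT) => //; split=> //=; exact: filterT.
apply: hV => A B yA yB; have [||p [[_ ?] [_ ?]]] := xy (setT `*` A) (setT `*` B); last by exists p.2.
  by exists (setT, A) => //; split=> //=; exact: filterT.
by exists (setT, B) => //; split=> //=; exact: filterT.
Qed.

Section SkewProduct.
Context {R : realType} {Omega : metricType R} {W : normedModType R}.
Variables (sigma : R -> Omega -> Omega) (P : R -> Omega * W -> Omega * W) (K : set (Omega * W)).
Variables (d c a : R).
Hypotheses (d_gt0 : 0 < d) (c_gt0 : 0 < c) (a_gt0 : 0 < a).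
Hypothesis Omega_compact : compact [set: Omega].
Hypothesis sigma_flow : is_flow sigma.
Hypothesis sigma_minimal : minimal_flow sigma.
Hypothesis K_compact : compact K.
Hypothesis K_projects : forall w, exists x, K (w, x).
Hypothesis P_fst : forall t p, (P t p).1 = sigma t p.1.
Hypothesis P_in : forall (t : R) p, 0 <= t -> K p -> K (P t p).
Hypothesis P0 : forall p, K p -> P 0 p = p.
Hypothesis PD : forall (s t : R) p, 0 <= s -> 0 <= t -> K p -> P (s + t) p = P s (P t p).
Hypothesis P_continuous : forall (t0 : R) p0, 0 <= t0 -> K p0 -> forall e : R, 0 < e ->
  \forall q \near (t0, p0), 0 <= q.1 -> K q.2 -> ball (P t0 p0) e (P q.1 q.2).
Hypothesis P_backward : forall p, K p -> exists theta : R -> Omega * W,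
  [/\ forall s, s <= 0 -> K (theta s), theta 0 = p
    & forall s t, 0 <= t -> s <= - t -> P t (theta s) = theta (t + s)].
Hypothesis P_contracts : forall w x y, K (w, x) -> K (w, y) -> `|x - y| < d ->
  forall t, 0 <= t -> `|(P t (w, x)).2 - (P t (w, y)).2| <= c * expR (- (a * t)) * `|x - y|.
Implicit Types (A N : set (Omega * W)) (m : nat).

(** * Separated points of fibers and the number of sheets *)

Definition separated A m : set Omega :=
  [set w | exists f : 'I_m -> W, (forall i, A (w, f i)) /\
    forall i j, i != j -> d <= `|f i - f j|].

(** Along an ultrafilter of base points converging to [w], compactness of [A] makes the [m] chosen
    points converge, and the lower bound [d] on distances survives in the limit. *)
Lemma separated_closed A m : compact A -> closed (separated A m).
Proof.
move=> cA w wS.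
have PF : ProperFilter (within (separated A m) (nbhs w)).
  apply: Build_ProperFilter_ex => B wB; have [v [Sv Bv]] := wS _ wB.
  by exists v; exact: Bv.
have [U [UU wU]] := ultraFilterLemma PF.
have US : U (separated A m) by apply: wU; exact: withinT.
have Uw : U --> w by move=> B wB; apply: wU; apply: filterS wB => v Bv _.
have [f fP] : exists f : Omega -> 'I_m -> W, forall v, separated A m v ->
    (forall i, A (v, f v i)) /\ forall i j, i != j -> d <= `|f v i - f v j|.
  have H v : exists f : 'I_m -> W, separated A m v ->
      (forall i, A (v, f i)) /\ forall i j, i != j -> d <= `|f i - f j|.
    by have [[f ?]|nS] := pselect (separated A m v); [exists f|exists (fun=> 0) => /nS].
  by have [f ?] := choice H; exists f.
have lim i : exists x, A (w, x) /\ f v i @[v --> U] --> x.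
  move: cA; rewrite compact_ultra => /(_ (fmap (fun v => (v, f v i)) U) (fmap_ultra _ UU)).
  have UA : U (fun v => A (v, f v i)) by apply: filterS US => v /fP[].
  move=> /(_ UA)[[w' x] [Ax Ux]].
  have Uw' : U --> w'.
    have : v @[v --> U] --> w'.
      exact: (@cvg_comp _ _ _ (fun v => (v, f v i)) fst U _ _ Ux (@cvg_fst _ _ _ _ _)).
    by [].
  have -> : w = w' by exact: (@cvg_unique _ (@metric_hausdorff _ _) _ _ _ _ Uw Uw').
  exists x; split=> //.
  exact: (@cvg_comp _ _ _ (fun v => (v, f v i)) snd U _ _ Ux (@cvg_snd _ _ _ _ _)).
have [g gP] := choice lim; exists g; split=> [i|i j ij]; first by have [] := gP i.
have cg : `|f v i - f v j| @[v --> U] --> `|g i - g j|.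
  by apply: cvg_norm; apply: cvgB; have [] := gP i; have [] := gP j.
apply: (@closed_cvg _ _ U _ (fun v => `|f v i - f v j|) [set b : R | d <= b]) cg.
  exact: closed_ge.
by apply: filterS US => v /fP[_]; exact.
Qed.

(** The projection of [K] to [W] is covered by finitely many balls of radius [d / 2], each of which
    contains at most one of the points; the bound is the same for all fibers. *)
Lemma separated_bounded : exists M, forall m w, separated K m w -> (m <= M)%N.
Proof.
have cK : compact (snd @` K) by apply: continuous_compact => //; apply: continuous_subspaceT => p; exact: cvg_snd.
have d20 : 0 < d / 2 by rewrite divr_gt0.
rewrite compact_cover in cK.
have [|y _|D _ KD] := cK W setT (fun x => ball x (d / 2)) _ _.
- by move=> x _; exact: ball_open.
- by exists y => //; exact: ballxx.
exists (size (finmap.enum_fset D)) => m w [f [fK fd]].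
have cov i : exists x, x \in finmap.enum_fset D /\ ball x (d / 2) (f i).
  have [|x xD xf] := KD (f i); last by exists x.
  by exists (w, f i).
have [g gP] := choice cov.
have g_inj : injective g.
  move=> i j gij; apply/eqP/negPn/negP => /fd; rewrite leNgt => /negP; apply.
  have [_] := gP i; have [_] := gP j; rewrite -!ball_normE /= gij => fj fi.
  rewrite -(subrKA (g j)) (le_lt_trans (ler_normD _ _))// (splitr d) ltrD//.
  by rewrite distrC.
rewrite -(card_ord m) cardE -(size_map g); apply: uniq_leq_size.
  by rewrite map_inj_uniq// enum_uniq.
by move=> _ /mapP[i _ ->]; have [] := gP i.
Qed.

Lemma flowK t w : sigma (- t) (sigma t w) = w.
Proof. by have [_ s0 sD] := sigma_flow; rewrite -sD addNr s0. Qed.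

Lemma flow_inj t w w' : sigma t w = sigma t w' -> w = w'.
Proof. by move=> E; rewrite -(flowK t w) E flowK. Qed.

Lemma backward_fst (theta : R -> Omega * W) (s : R) : s <= 0 ->
  (forall s t : R, 0 <= t -> s <= - t -> P t (theta s) = theta (t + s)) ->
  (theta s).1 = sigma s (theta 0).1.
Proof.
move=> s0 thetaE; have := thetaE s (- s); rewrite oppr_ge0 opprK addNr => <-//.
by rewrite P_fst -{2}[s]opprK flowK.
Qed.

Lemma fiber_contracts p q (t : R) : K p -> K q -> p.1 = q.1 -> `|p.2 - q.2| < d -> 0 <= t ->
  `|(P t p).2 - (P t q).2| <= c * expR (- (a * t)) * `|p.2 - q.2|.
Proof.
by case: p q => [w x] [w' y] /= Kp Kq E; move: Kp; rewrite E => Kp xy; exact: P_contracts.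
Qed.

(** If two pasts were [d]-close at time [s], contraction over the time [- s] would give
    [|g i - g j| <= c e^(a s) d], which fails for [s] very negative. *)
Lemma backward_separated m w (g : 'I_m -> W) : injective g -> (forall i, K (w, g i)) ->
  exists T : R, forall s, s <= T -> separated K m (sigma s w).
Proof.
move=> g_inj gK.
have [theta thetaP] := choice (fun i => P_backward (gK i)).
have fst_theta i (s : R) : s <= 0 -> (theta i s).1 = sigma s w.
  by move=> s0; have [_ E H] := thetaP i; rewrite (backward_fst s0 H) E.
have pair (ij : 'I_m * 'I_m) : exists T : R, ij.1 != ij.2 -> forall s : R, s <= T -> s <= 0 ->
    d <= `|(theta ij.1 s).2 - (theta ij.2 s).2|.
  case: ij => i j /=; have [->|ij] := eqVneq i j; first by exists 0.
  have D0 : 0 < `|g i - g j|.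
    by rewrite normr_gt0 subr_eq0; apply: contra ij => /eqP/g_inj->.
  (* Chosen so that [c q d] is half of [|g i - g j|]; [e^(a s) <= q] holds once [s <= ln q / a]. *)
  pose q := `|g i - g j| / (2 * (c * d)).
  have q0 : 0 < q by rewrite divr_gt0// !mulr_gt0.
  exists (ln q / a) => _ s sq s0; rewrite leNgt; apply/negP => close.
  have [Ki i0 iE] := thetaP i; have [Kj j0 jE] := thetaP j.
  have ns0 : 0 <= - s by rewrite oppr_ge0.
  have E : (theta i s).1 = (theta j s).1 by rewrite !fst_theta.
  have := fiber_contracts (Ki _ s0) (Kj _ s0) E close ns0.
  have ss : s <= - - s by rewrite opprK.
  rewrite (iE _ _ ns0 ss) (jE _ _ ns0 ss) addNr i0 j0 /= mulrN opprK leNgt => /negP; apply.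
  have eq : expR (a * s) <= q.
    by rewrite -[leRHS](@lnK R q)// ler_expR mulrC -ler_pdivlMr.
  apply: (@le_lt_trans _ _ (c * q * d)).
    by apply: ler_pM; rewrite ?mulr_ge0 ?expR_ge0 ?(ltW c_gt0)// ?(ltW close)// ler_wpM2l// ltW.
  rewrite (_ : c * q * d = `|g i - g j| / 2); last by rewrite /q; field; rewrite !gt_eqF.
  by rewrite ltr_pdivrMr// ltr_pMr// ltr1n.
have [T TP] := choice pair.
(* A nonpositive lower bound common to the finitely many thresholds. *)
exists (- \sum_p `|T p|) => s sT; exists (fun i => (theta i s).2).
have s0 : s <= 0 by rewrite (le_trans sT)// oppr_le0 sumr_ge0.
split=> [i|i j ij].
  by rewrite -(fst_theta i s s0); have [Ki _ _] := thetaP i; case: (theta i s) (Ki s s0).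
apply: (TP (i, j)) => //; apply: le_trans sT _.
rewrite lerNl (bigD1 (i, j))//= (@le_trans _ _ `|T (i, j)|)//.
  by rewrite -normrN ler_norm.
by rewrite lerDl sumr_ge0.
Qed.

Lemma separated_backward_all A m w (T : R) : compact A ->
  (forall s, s <= T -> separated A m (sigma s w)) -> forall w', separated A m w'.
Proof.
move=> cA wT w'; apply: contrapT => nw'.
have oU : open (~` separated A m) by apply: closed_openC; exact: separated_closed.
have [|t tT] := minimal_flow_recurrent Omega_compact (is_flow_opp sigma_flow)
  (minimal_flow_opp sigma_minimal) w (- T) oU; first by exists w'.
by apply; apply: wT; rewrite lerNl.
Qed.

Lemma separated_forward_all A m w : compact A ->
  (forall s : R, 0 <= s -> separated A m (sigma s w)) -> forall w', separated A m w'.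
Proof.
move=> cA wT w'; apply: contrapT => nw'.
have oU : open (~` separated A m) by apply: closed_openC; exact: separated_closed.
have [|t tT] := minimal_flow_recurrent Omega_compact sigma_flow sigma_minimal w 0 oU.
  by exists w'.
by apply; exact: wT.
Qed.

Lemma inj_add_point m (f : 'I_m -> W) (x : W) : injective f -> (forall i, x <> f i) ->
  exists g : 'I_m.+1 -> W, injective g /\ forall i, g i = x \/ exists j, g i = f j.
Proof.
move=> f_inj xf; exists (fun i => if unlift ord0 i is Some j then f j else x); split.
  move=> i j; case: unliftP => [i' ->|->]; case: unliftP => [j' ->|->] //.
  - by move=> /f_inj->.
  - by move=> /esym/xf.
  - by move=> /xf.
by move=> i; case: unliftP => [j _|_]; [right; exists j|left].
Qed.

Lemma separated_injective m (f : 'I_m -> W) :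
  (forall i j, i != j -> d <= `|f i - f j|) -> injective f.
Proof.
move=> fd i j fij; apply/eqP/negPn/negP => /fd; rewrite fij subrr normr0 leNgt.
by rewrite d_gt0.
Qed.

Lemma cover_number : exists k, [/\ (0 < k)%N, forall w, separated K k w &
  forall m w (g : 'I_m -> W), injective g -> (forall i, K (w, g i)) -> (m <= k)%N].
Proof.
have [M bM] := separated_bounded.
have all_sep m w (g : 'I_m -> W) : injective g -> (forall i, K (w, g i)) ->
    forall w', separated K m w'.
  move=> g_inj gK; have [T HT] := backward_separated g_inj gK.
  exact: separated_backward_all HT.
(* Over an empty base everything is vacuous and any positive number will do. *)
have [[w0 _]|noO] := pselect (exists w : Omega, True); last first.
  exists 1%N; split=> // [w|m w]; by case: noO; exists w.
pose S m := `[< separated K m w0 >].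
have S1 : S 1%N.
  apply/asboolP; have [x Kx] := K_projects w0; exists (fun=> x); split=> // i j.
  by rewrite !ord1.
have SM m : S m -> (m <= M)%N by move=> /asboolP; exact: bM.
have [k /asboolP[f [fK fd]] kmax] := @ex_maxnP S M (ex_intro (fun m => S m) 1%N S1) SM.
exists k; split.
- exact: kmax.
- exact: all_sep (separated_injective fd) fK.
- move=> m w g g_inj gK; apply: kmax; apply/asboolP; exact: all_sep g_inj gK w0.
Qed.

Lemma skew_hausdorff : hausdorff_space (Omega * W)%type.
Proof.
by apply: pair_hausdorff; [exact: metric_hausdorff|exact: norm_hausdorff].
Qed.

Section Cover.
Variable k : nat.
Hypothesis K_k : forall w, separated K k w.
Hypothesis k_max : forall m w (g : 'I_m -> W), injective g -> (forall i, K (w, g i)) -> (m <= k)%N.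

Lemma fiber_exhausted w (f : 'I_k -> W) : injective f -> (forall i, K (w, f i)) ->
  forall x, K (w, x) -> exists i, x = f i.
Proof.
move=> f_inj fK x Kx; apply: contrapT => nx.
have [|g [g_inj gE]] := inj_add_point f_inj (x := x).
  by move=> i xf; apply: nx; exists i.
have : (k.+1 <= k)%N; last by rewrite ltnn.
by apply: (@k_max _ w g g_inj) => i; have [->|[j ->]] := gE i.
Qed.

Lemma fiber_separated w x y : K (w, x) -> K (w, y) -> x <> y -> d <= `|x - y|.
Proof.
have [f [fK fd]] := K_k w; have f_inj := separated_injective fd.
move=> /(fiber_exhausted f_inj fK)[i ->] /(fiber_exhausted f_inj fK)[j ->] ij.
by apply: fd; apply: contra_notN ij => /eqP->.
Qed.

Lemma P_surjective p (t : R) : K p -> 0 <= t -> exists q, [/\ K q, P t q = p & p.1 = sigma t q.1].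
Proof.
move=> Kp t0; have [theta [Kt p0 thetaE]] := P_backward Kp.
have nt0 : - t <= 0 by rewrite oppr_le0.
have E : P t (theta (- t)) = p by rewrite thetaE// subrr.
exists (theta (- t)); split; [exact: Kt|exact: E|].
by rewrite -P_fst E.
Qed.

(** Backward extensions make [P t] map the fiber over [w] onto the fiber over [sigma t w]; both have
    [k] points, so the map is injective. *)
Lemma P_injective p q (t : R) : 0 <= t -> K p -> K q -> P t p = P t q -> p = q.
Proof.
move=> t0 Kp Kq E; have E1 : p.1 = q.1.
  by apply: (@flow_inj t); rewrite -!P_fst E.
case: p q Kp Kq E E1 => [w x] [w' y] /= Kp Kq E E1; rewrite -{w'}E1 in Kq E *.
have [f [fK fd]] := K_k (sigma t w); have f_inj := separated_injective fd.
have pre i : exists z, K (w, z) /\ P t (w, z) = (sigma t w, f i).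
  have [[w' z] [Kz zE /flow_inj /= wE]] := P_surjective (fK i) t0.
  by rewrite -wE in Kz zE; exists z.
have [g gP] := choice pre.
have g_inj : injective g.
  move=> i j gij; have [_ iE] := gP i; have [_ jE] := gP j.
  by apply: f_inj; move: iE; rewrite gij jE => -[].
have gK i : K (w, g i) by have [] := gP i.
move: Kp Kq E => /(fiber_exhausted g_inj gK)[i ->] /(fiber_exhausted g_inj gK)[j ->].
have [_ ->] := gP i; have [_ ->] := gP j.
by move=> [/f_inj->].
Qed.

(** * Invariant compact subsets and minimal sets *)

Definition fiber N w m := exists f : 'I_m -> W, injective f /\ forall x, N (w, x) <-> exists i, x = f i.

Definition invariant_compact N := [/\ N `<=` K, compact N
  & forall (t : R) p, 0 <= t -> N p -> N (P t p)].

Lemma injective_separated N w m (f : 'I_m -> W) : N `<=` K -> injective f ->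
  (forall i, N (w, f i)) -> separated N m w.
Proof.
move=> NK f_inj fN; exists f; split=> // i j ij; apply: (@fiber_separated w); do ?exact: NK (fN _).
by move=> /f_inj ijE; rewrite ijE eqxx in ij.
Qed.

Lemma separated_forward N w m (t : R) : invariant_compact N -> 0 <= t ->
  separated N m w -> separated N m (sigma t w).
Proof.
move=> [NK cN Nt] t0 [f [fN /separated_injective f_inj]].
have PE i : P t (w, f i) = (sigma t w, (P t (w, f i)).2).
  by rewrite -(P_fst t (w, f i)); case: (P t _).
apply: (@injective_separated _ _ _ (fun i => (P t (w, f i)).2) NK) => [i j E|i].
  have ij : P t (w, f i) = P t (w, f j) by rewrite (PE i) E -PE.
  by have [/f_inj] := P_injective t0 (NK _ (fN i)) (NK _ (fN j)) ij.
by rewrite -PE; apply: Nt.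
Qed.

(** The hypotheses do not place the past of a point of [N] in [N], so the count spreads forward
    instead: injectivity of [P t] carries a maximal family of [m] points along the forward orbit of
    its base point, and this orbit is dense. *)
Lemma invariant_compact_cover N : invariant_compact N -> N !=set0 ->
  exists m, [/\ (0 < m)%N, forall w, separated N m w & forall w, ~ separated N m.+1 w].
Proof.
move=> iN [[w1 x1] Nx1]; have [NK cN _] := iN; have [M bM] := separated_bounded.
pose S m := `[< exists w, separated N m w >].
have S1 : S 1%N.
  by apply/asboolP; exists w1, (fun=> x1); split=> // i j; rewrite !ord1.
have SM m : S m -> (m <= M)%N.
  move=> /asboolP[w [f [fN fd]]]; apply: (bM m w); exists f; split=> // i; exact: NK.
have [m /asboolP[w wS] mmax] := @ex_maxnP S M (ex_intro (fun m => S m) 1%N S1) SM.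
exists m; split; first exact: mmax.
- by apply: (separated_forward_all cN (w := w)) => s s0; exact: separated_forward.
- move=> v vS; have : (m.+1 <= m)%N; last by rewrite ltnn.
  by apply: mmax; apply/asboolP; exists v.
Qed.

Lemma separated_fiber N w m (f : 'I_m -> W) : N `<=` K -> ~ separated N m.+1 w ->
  injective f -> (forall i, N (w, f i)) -> forall x, N (w, x) <-> exists i, x = f i.
Proof.
move=> NK nS f_inj fN x; split=> [Nx|[i ->]//]; apply: contrapT => nx; apply: nS.
have [|g [g_inj gE]] := inj_add_point f_inj (x := x).
  by move=> i xf; apply: nx; exists i.
by apply: (@injective_separated _ _ _ g NK) => // i; have [->|[j ->]] := gE i.
Qed.

(* If the fibers over points near [w] avoided
   a ball around [x], then [N] minus that ball would still have [m] points over [w],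
   since [separated] is a closed condition. *)
Lemma fiber_lower_semicontinuous N m : N `<=` K -> compact N -> (forall w, separated N m w) ->
  (forall w, ~ separated N m.+1 w) -> forall w x (e : R), N (w, x) -> 0 < e ->
  \forall v \near w, exists2 y, N (v, y) & `|y - x| < e.
Proof.
move=> NK cN Nm nm w x e Nx e0.
pose A := N `&` [set p | e <= `|p.2 - x|].
have cA : compact A.
  apply: (subclosed_compact _ cN); last by move=> p [].
  apply: closedI; first by apply: compact_closed cN; exact: skew_hausdorff.
  apply: (@closed_comp _ _ (fun p : Omega * W => `|p.2 - x|) [set b : R | e <= b]); last exact: closed_ge.
  move=> p _; apply: cvg_norm; apply: cvgB; last exact: cvg_cst.
  exact: cvg_snd.
have wA : (~` separated A m) w.
  move=> [f [fA /separated_injective f_inj]].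
  have fN i : N (w, f i) by have [] := fA i.
  have [i xE] := (separated_fiber NK (nm w) f_inj fN x).1 Nx.
  by have [_] := fA i; rewrite -xE /= subrr normr0 leNgt e0.
have : open (~` separated A m) by apply: closed_openC; exact: separated_closed.
rewrite openE => /(_ w wA); apply: filterS => v nA.
have [f [fN fd]] := Nm v; apply: contrapT => nf; apply: nA; exists f; split=> // i.
split=> //=; rewrite leNgt; apply/negP => lt; apply: nf.
by exists (f i).
Qed.

Lemma K_invariant_compact : invariant_compact K.
Proof. by split=> // t p t0 Kp; exact: P_in. Qed.

(** Closed: near a limit point lying in [N], the fibers of [N] contain points less than [d] away
    from the approximating points of [K], which forces equality. Invariant: [P t] is a bijection
    between fibers of [N] with [m] points, so a point of [K] whose image is in [N] was already in
    [N]. *)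
Lemma invariant_compact_setD N : invariant_compact N -> N !=set0 -> invariant_compact (K `\` N).
Proof.
move=> iN N0; have [m [m0 Nm nm]] := invariant_compact_cover iN N0.
have [NK cN Nt] := iN; split; first by move=> p [].
- apply: (subclosed_compact _ K_compact); last by move=> p [].
  move=> p pcl; have Kp : K p.
    apply: (compact_closed skew_hausdorff K_compact) => B pB.
    by have [q [[Kq _] Bq]] := pcl B pB; exists q.
  split=> // Np; case: p pcl Kp Np => w x pcl Kp Np.
  have d20 : 0 < d / 2 by rewrite divr_gt0.
  have N1 := fiber_lower_semicontinuous NK cN Nm nm Np d20.
  have N2 : \forall q \near (w, x), exists2 y, N (q.1, y) & `|y - x| < d / 2.
    exact: (@cvg_fst _ _ (nbhs w) (nbhs x) _ _ N1).
  have N3 : \forall q \near (w, x), `|x - q.2| < d / 2.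
    have /cvgrPdist_lt/(_ _ d20) : (q : Omega * W).2 @[q --> (w, x)] --> x by exact: cvg_snd.
    exact.
  have [q [[Kq nNq] [[y Ny yx] xq]]] := pcl _ (filterI N2 N3).
  have qE : q = (q.1, q.2) by case: (q).
  have yq : y = q.2.
    apply: contrapT => yq; rewrite qE in Kq.
    have := fiber_separated (NK _ Ny) Kq yq; rewrite leNgt => /negP; apply.
    by rewrite -(subrKA x) (le_lt_trans (ler_normD _ _))// (splitr d) ltrD.
  by apply: nNq; rewrite qE -yq.
- move=> t p t0 [Kp nNp]; split; first exact: P_in.
  move=> NPp; apply: nNp.
  have [f [fN /separated_injective f_inj]] := Nm p.1.
  have PE i : P t (p.1, f i) = (sigma t p.1, (P t (p.1, f i)).2).
    by rewrite -(P_fst t (p.1, f i)); case: (P t _).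
  have PpE : P t p = (sigma t p.1, (P t p).2) by rewrite -P_fst; case: (P t p).
  have g_inj : injective (fun i => (P t (p.1, f i)).2).
    move=> i j E; have ij : P t (p.1, f i) = P t (p.1, f j) by rewrite (PE i) E -PE.
    by have [/f_inj] := P_injective t0 (NK _ (fN i)) (NK _ (fN j)) ij.
  have gN i : N (sigma t p.1, (P t (p.1, f i)).2) by rewrite -PE; exact: Nt.
  have [i iE] := (separated_fiber NK (nm _) g_inj gN (P t p).2).1 (eq_ind _ N NPp _ PpE).
  have pi : P t p = P t (p.1, f i) by rewrite PpE iE -PE.
  by rewrite (P_injective t0 Kp (NK _ (fN i)) pi); exact: fN.
Qed.

(** For [p] in [K] this is the closure of its forward orbit, encoded as an intersection. *)
Definition minimal_hull p : set (Omega * W) := [set q | forall N, invariant_compact N -> N p -> N q].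

Lemma minimal_hull_self p : minimal_hull p p.
Proof. by move=> N. Qed.

Lemma minimal_hull_invariant p : K p -> invariant_compact (minimal_hull p).
Proof.
move=> Kp; split.
- by move=> q /(_ K K_invariant_compact Kp).
- apply: (subclosed_compact _ K_compact); last by move=> q /(_ K K_invariant_compact Kp).
  move=> q qcl N iN Np; have [_ cN _] := iN.
  apply: (compact_closed skew_hausdorff cN) => B qB.
  by have [u [uM Bu]] := qcl B qB; exists u; split=> //; exact: uM.
- by move=> t q t0 qM N iN Np; have [_ _ Nt] := iN; apply: Nt => //; exact: qM.
Qed.

(** If [N] missed [p], the complement of [N] in [K] would be an invariant compact set containing
    [p], hence the whole hull, and [N] would be empty. *)
Lemma minimal_hull_minimal p N : K p -> invariant_compact N -> N !=set0 ->
  N `<=` minimal_hull p -> N = minimal_hull p.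
Proof.
move=> Kp iN N0 Np; apply/seteqP; split=> // q; apply => //.
apply: contrapT => nNp; have [u Nu] := N0.
by have [] := Np u Nu _ (invariant_compact_setD iN N0) (conj Kp nNp).
Qed.

Lemma minimal_hull_eq p q u : K p -> K q -> minimal_hull p u -> minimal_hull q u ->
  minimal_hull p = minimal_hull q.
Proof.
move=> Kp Kq pu qu.
have Ku : K u by have [H _ _] := minimal_hull_invariant Kp; exact: H.
have hull v : K v -> minimal_hull v u -> minimal_hull u = minimal_hull v.
  move=> Kv vu; apply: (minimal_hull_minimal Kv (minimal_hull_invariant Ku)).
    by exists u; exact: minimal_hull_self.
  by move=> y; apply => //; exact: minimal_hull_invariant.
by rewrite -(hull _ Kp pu) (hull _ Kq qu).
Qed.

Lemma minimal_decomposition : exists l (M : 'I_l -> set (Omega * W)),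
  [/\ trivIset [set: 'I_l] M, K = \bigcup_j M j
    & forall j, [/\ M j !=set0, invariant_compact (M j)
      & forall N, invariant_compact N -> N !=set0 -> N `<=` M j -> N = M j]].
Proof.
have [[w0 _]|noO] := pselect (exists w : Omega, True); last first.
  exists 0%N, (fun=> set0); split=> [[]//||[]//].
  by apply/seteqP; split=> [[w x]|p [[]]//]; case: noO; exists w.
have [f [fK fd]] := K_k w0; have f_inj := separated_injective fd.
pose H i := minimal_hull (w0, f i).
(* One index, the smallest, for each distinct hull among those of the [k] points over [w0]. *)
pose S := [pred i : 'I_k | `[< forall j, H j = H i -> (i <= j)%N >]].
have SP i : reflect (forall j, H j = H i -> (i <= j)%N) (i \in S) by exact: asboolP.
exists #|S|, (fun l => H (enum_val l)); split.
- move=> i j _ _ [u [iu ju]]; apply: enum_val_inj; apply/val_inj/eqP.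
  have E := minimal_hull_eq (fK _) (fK _) iu ju.
  by rewrite eqn_leq (SP _ (enum_valP i))// (SP _ (enum_valP j)).
- apply/seteqP; split=> [p Kp|p [l _]]; last first.
    by have [HK _ _] := minimal_hull_invariant (fK (enum_val l)); exact: HK.
  (* The hull of [p] has points over every base point, in particular over [w0], so it is one of the
     hulls [H i]. *)
  have [m [m0 Hm _]] := invariant_compact_cover (minimal_hull_invariant Kp) (ex_intro _ p (@minimal_hull_self p)).
  have [g [gH _]] := Hm w0; pose y := g (Ordinal m0); have Hy : minimal_hull p (w0, y) by exact: gH.
  have Ky : K (w0, y) by have [HK _ _] := minimal_hull_invariant Kp; exact: HK.
  have [i iE] := fiber_exhausted f_inj fK Ky; rewrite iE in Hy.
  have pi : minimal_hull p = H i by exact: minimal_hull_eq Kp (fK i) Hy (@minimal_hull_self _).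
  have i0 : `[< H i = H i >] by exact/asboolP.
  case: (@arg_minnP _ i (fun j => `[< H j = H i >]) (fun j : 'I_k => j : nat) i0) => j /asboolP ji jmin.
  have jS : j \in S by apply/SP => j' j'j; apply: jmin; apply/asboolP; rewrite j'j.
  exists (enum_rank_in jS j) => //; rewrite enum_rankK_in// ji -pi.
  exact: minimal_hull_self.
- move=> l; split; first by exists (w0, f (enum_val l)); exact: minimal_hull_self.
    exact: minimal_hull_invariant.
  by move=> N iN N0 NH; exact: minimal_hull_minimal.
Qed.

(** Near [w0], each of the [k] points over [w0] has exactly one point of the nearby fiber within
    [d / 2]: it exists by lower semicontinuity and is unique by separation. *)
Lemma local_sections (w0 : Omega) : exists (U : set Omega) (x : 'I_k -> Omega -> W),
  [/\ nbhs w0 U, forall j, {within U, continuous (x j)}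
    & forall w y, U w -> K (w, y) <-> exists j, y = x j w].
Proof.
have [f [fK fd]] := K_k w0; have d20 : 0 < d / 2 by rewrite divr_gt0.
have K_no w : ~ separated K k.+1 w.
  move=> [g [gK /separated_injective g_inj]].
  by have := k_max g_inj gK; rewrite ltnn.
have lsc := fiber_lower_semicontinuous (@subset_refl _ K) K_compact K_k K_no.
pose U := [set w | forall i, exists2 y, K (w, y) & `|y - f i| < d / 2].
have Uw0 : nbhs w0 U.
  by apply: filter_forall => i; exact: lsc (fK i) d20.
have ex_x (p : 'I_k * Omega) : exists y, U p.2 -> K (p.2, y) /\ `|y - f p.1| < d / 2.
  have [Up|nU] := pselect (U p.2); last by exists 0.
  by have [y Ky yf] := Up p.1; exists y.
have [x xP] := choice ex_x.
have x_unique i w y : U w -> K (w, y) -> `|y - f i| < d / 2 -> y = x (i, w).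
  move=> Uw Ky yf; have [Kx xf] := xP (i, w) Uw; apply: contrapT => yx.
  have := fiber_separated Ky Kx yx; rewrite leNgt => /negP; apply.
  by rewrite -(subrKA (f i)) (le_lt_trans (ler_normD _ _))// (splitr d) ltrD// distrC.
exists U, (fun i w => x (i, w)); split=> // [i|w y Uw]; last first.
  have x_inj : injective (fun i => x (i, w)).
    move=> i j xij; apply/eqP/negPn/negP => /fd; rewrite leNgt => /negP; apply.
    have [_ /= xi] := xP (i, w) Uw; have [_ /= xj] := xP (j, w) Uw; rewrite xij in xi.
    by rewrite -(subrKA (x (j, w))) (le_lt_trans (ler_normD _ _))// (splitr d) ltrD// distrC.
  have xK i : K (w, x (i, w)) by have [] := xP (i, w) Uw.
  by split=> [/(fiber_exhausted x_inj xK)//|[i ->]].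
apply/subspace_continuousP => w1 Uw1; have [Kx /= xf] := xP (i, w1) Uw1.
apply/cvgrPdist_lt => e e0.
(* The second bound keeps the point found over [w] within [d / 2] of [f i], so that uniqueness
   identifies it with [x (i, w)]. *)
pose b := Num.min e (d / 2 - `|x (i, w1) - f i|).
have b0 : 0 < b by rewrite lt_min e0 subr_gt0.
rewrite near_withinE; have := lsc _ _ _ Kx b0; apply: filterS => w [y Ky yx] Uw.
have yf : `|y - f i| < d / 2.
  rewrite -(subrKA (x (i, w1))) (le_lt_trans (ler_normD _ _))// -ltrBrDr.
  by rewrite (lt_le_trans yx)// ge_min lexx orbT.
rewrite -[from_subspace _ _ w]/(x (i, w)) -(x_unique _ _ _ Uw Ky yf).
by rewrite distrC (lt_le_trans yx)// ge_min lexx.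
Qed.

(* The graph of the extended flow, determined for negative [t] too because each
   [P u] is injective on [K]. *)
Definition flow_rel (t : R) p q := K q /\ exists u : R, [/\ 0 <= u, 0 <= u + t & P u q = P (u + t) p].

Lemma flow_rel_later t p q (u v : R) : K p -> K q -> 0 <= u -> 0 <= u + t -> u <= v ->
  P u q = P (u + t) p -> P v q = P (v + t) p.
Proof.
move=> Kp Kq u0 ut0 uv E; have vu : 0 <= v - u by rewrite subr_ge0.
by rewrite -[v in LHS](subrK u) (PD vu u0 Kq) E -(PD vu ut0 Kp) addrA subrK.
Qed.

(** The auxiliary time [u] is immaterial: a later one is reached by the semigroup law, an earlier
    one by injectivity. *)
Lemma flow_rel_at t p q (v : R) : K p -> flow_rel t p q -> 0 <= v -> 0 <= v + t ->
  P v q = P (v + t) p.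
Proof.
move=> Kp [Kq [u [u0 ut E]]] v0 vt; have [uv|/ltW vu] := leP u v.
  exact: flow_rel_later E.
have uv0 : 0 <= u - v by rewrite subr_ge0.
apply: (P_injective uv0); [exact: P_in|exact: P_in|].
by rewrite -(PD uv0 v0 Kq) -(PD uv0 vt Kp) addrA subrK.
Qed.

Lemma flow_rel_unique t p q q' : K p -> flow_rel t p q -> flow_rel t p q' -> q = q'.
Proof.
move=> Kp tq tq'; have Kq := tq.1; have Kq' := tq'.1.
have v0 : 0 <= `|t| by []; have vt : 0 <= `|t| + t by rewrite -lerBlDr sub0r -normrN ler_norm.
by apply: (P_injective v0 Kq Kq'); rewrite (flow_rel_at Kp tq v0 vt) (flow_rel_at Kp tq' v0 vt).
Qed.

Lemma flow_rel_nonneg (t : R) p : K p -> 0 <= t -> flow_rel t p (P t p).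
Proof.
move=> Kp t0; split; first exact: P_in.
by exists 0; split; rewrite ?add0r// P0//; exact: P_in.
Qed.

Lemma flow_rel_exists (t : R) p : K p -> exists q, flow_rel t p q.
Proof.
move=> Kp; have [t0|/ltW t0] := leP 0 t; first by exists (P t p); exact: flow_rel_nonneg.
have nt0 : 0 <= - t by rewrite oppr_ge0.
have [q [Kq E _]] := P_surjective Kp nt0.
by exists q; split=> //; exists (- t); rewrite addNr lexx E P0.
Qed.

Lemma flow_rel_comp (s t : R) p q u : K p -> flow_rel t p q -> flow_rel s q u -> flow_rel (s + t) p u.
Proof.
move=> Kp tq su; have Kq := tq.1; split; first exact: su.1.
have abs_ge (b : R) : 0 <= `|b| + b by rewrite -lerBlDr sub0r -normrN ler_norm.
have v0 : 0 <= `|s| + `|t| by rewrite addr_ge0.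
have vs : 0 <= `|s| + `|t| + s by rewrite addrAC addr_ge0.
have vst : 0 <= `|s| + `|t| + s + t by rewrite -addrA addrACA addr_ge0.
exists (`|s| + `|t|); rewrite addrA; split=> //.
by rewrite (flow_rel_at Kq su v0 vs) (flow_rel_at Kp tq vs vst).
Qed.

(** A closed graph argument: a value [q1] other than [q0] satisfies [P u q1 <> P (u + t0) p0], so
    Hausdorff separation excludes a neighborhood of [q1]. Compactness of [K] makes this uniform. *)
Lemma flow_rel_near (t0 : R) p0 q0 (e : R) : K p0 -> flow_rel t0 p0 q0 -> 0 < e ->
  \forall tp \near (t0, p0), K tp.2 -> forall q, flow_rel tp.1 tp.2 q -> ball q0 e q.
Proof.
(* The extra 1 makes [u + t0] positive, so that [u + t] is still nonnegative for [t] near [t0]. *)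
move=> Kp0 tq0 e0; pose u : R := `|t0| + 1; have u0 : 0 <= u by rewrite addr_ge0.
have ut0 : 0 < u + t0.
  by rewrite /u addrAC ltr_wpDl// -lerBlDr sub0r -normrN ler_norm.
have /compact_near_coveringP/near_covering_withinP := K_compact.
move=> /(_ (R * (Omega * W))%type (nbhs (t0, p0)) (fun tp q => K tp.2 -> flow_rel tp.1 tp.2 q -> ball q0 e q) _) H.
have {H} : \forall tp \near (t0, p0), K `<=` (fun q => K q -> K tp.2 -> flow_rel tp.1 tp.2 q -> ball q0 e q).
  apply: filterS (H _) => [tp Htp q Kq _ Kp tq|q1 Kq1]; first exact: Htp.
  have [<-|q01] := pselect (q0 = q1).
    near=> q tp => _ _ _; near: q; exact: nbhsx_ballx.
  have ne : P u q1 <> P (u + t0) p0.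
    move=> E; apply: q01; apply: (flow_rel_unique Kp0 tq0).
    by split=> //; exists u; split=> //; exact: ltW.
  have [b b0 disj] : exists2 b : R, 0 < b & forall x, ball (P u q1) b x -> ~ ball (P (u + t0) p0) b x.
    have := skew_hausdorff; rewrite ball_hausdorff => /(_ (P u q1) (P (u + t0) p0)).
    move=> /(_ (introN eqP ne))[[b1 b2] /= /eqP disj].
    exists (Num.min b1%:num b2%:num); first by rewrite lt_min !gt0.
    move=> x x1 x2; rewrite -[False]/((set0 : set (Omega * W)) x) -disj; split.
      by apply: le_ball x1; rewrite ge_min lexx.
    by apply: le_ball x2; rewrite ge_min lexx orbT.
  have N1 : \forall q \near q1, K q -> ball (P u q1) b (P u q).
    have := P_continuous u0 Kq1 b0 => N.
    have cc : {for q1, continuous (fun q : Omega * W => (u, q))}.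
      by apply: continuous_pair; [exact: cvg_cst|exact: cvg_id].
    have N' : \forall q \near q1, 0 <= u -> K q -> ball (P u q1) b (P u q) by exact: (cc _ N).
    by apply: filterS N' => q; apply.
  have N2 : \forall tp \near (t0, p0), 0 <= u + tp.1 -> K tp.2 -> ball (P (u + t0) p0) b (P (u + tp.1) tp.2).
    have N := P_continuous (ltW ut0) Kp0 b0.
    have cc : {for (t0, p0), continuous (fun tp : R * (Omega * W) => (u + tp.1, tp.2))}.
      by apply: continuous_pair; [apply: cvgD; [exact: cvg_cst|exact: cvg_fst]|exact: cvg_snd].
    exact: (cc _ N).
  have N3 : \forall tp \near (t0, p0), 0 <= u + (tp : R * (Omega * W)).1.
    have cc : {for (t0, p0), continuous (fun tp : R * (Omega * W) => u + tp.1)}.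
      by apply: cvgD; [exact: cvg_cst|exact: cvg_fst].
    apply: (cc [set b : R | 0 <= b]); near=> z; apply: ltW; near: z; exact: lt_nbhsr.
  near=> q tp => Kq Kp tq /=.
  have Kp' : K tp.2 by []; have Kq' : K q by [].
  have M3 : 0 <= u + tp.1 by near: tp.
  have M2 : ball (P (u + t0) p0) b (P (u + tp.1) tp.2) by move: M3 Kp'; near: tp.
  have M1 : ball (P u q1) b (P u q) by move: Kq'; near: q.
  by exfalso; apply: (disj _ M1); rewrite (flow_rel_at Kp tq u0 M3).
apply: filterS => tp H Kp q tq; exact: (H q tq.1 tq.1 Kp tq).
Unshelve. all: by end_near. Qed.

Lemma semiflow_extends : exists Phi : R -> Omega * W -> Omega * W,
  [/\ forall t p, K p -> K (Phi t p),
      {within [set: R] `*` K, continuous (fun q : R * (Omega * W) => Phi q.1 q.2)},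
      forall p, K p -> Phi 0 p = p,
      forall s t p, K p -> Phi (s + t) p = Phi s (Phi t p)
    & forall t p, 0 <= t -> K p -> Phi t p = P t p].
Proof.
have H (tp : R * (Omega * W)) : exists q, K tp.2 -> flow_rel tp.1 tp.2 q.
  have [Kp|] := pselect (K tp.2); last by exists tp.2.
  by have [q] := flow_rel_exists tp.1 Kp; exists q.
have [Phi PhiP] := choice H.
have PhiE (t : R) p q : K p -> flow_rel t p q -> Phi (t, p) = q.
  by move=> Kp; apply: flow_rel_unique => //; exact: (PhiP (t, p)).
exists (fun t p => Phi (t, p)); split.
- by move=> t p Kp; have [] := PhiP (t, p) Kp.
- apply/subspace_continuousP => -[t0 p0] [_ /= Kp0].
  apply/cvg_ballP => e e0; rewrite near_withinE.
  have := flow_rel_near Kp0 (PhiP (t0, p0) Kp0) e0; apply: filterS => -[t p] /= N [_ Kp].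
  exact: N Kp _ (PhiP (t, p) Kp).
- by move=> p Kp; rewrite (PhiE _ _ _ Kp (flow_rel_nonneg Kp (lexx 0))) P0.
- move=> s t p Kp; apply: PhiE => //; have tq := PhiP (t, p) Kp.
  exact: flow_rel_comp Kp tq (PhiP (s, Phi (t, p)) tq.1).
- by move=> t p t0 Kp; apply: PhiE => //; exact: flow_rel_nonneg.
Qed.

End Cover.

Lemma skew_product_cover : exists k, [/\ (0 < k)%N, forall w, fiber K w k,
  exists Phi : R -> Omega * W -> Omega * W,
  [/\ forall t p, K p -> K (Phi t p),
      {within [set: R] `*` K, continuous (fun q : R * (Omega * W) => Phi q.1 q.2)},
      forall p, K p -> Phi 0 p = p,
      forall s t p, K p -> Phi (s + t) p = Phi s (Phi t p)
    & forall t p, 0 <= t -> K p -> Phi t p = P t p],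
  forall w0 : Omega, exists (U : set Omega) (x : 'I_k -> Omega -> W),
  [/\ nbhs w0 U, forall j, {within U, continuous (x j)}
    & forall w y, U w -> K (w, y) <-> exists j, y = x j w] &
  exists l (M : 'I_l -> set (Omega * W)) (m : 'I_l -> nat),
  [/\ trivIset [set: 'I_l] M, K = \bigcup_j M j
    & forall j, [/\ M j !=set0, invariant_compact (M j),
        forall N, invariant_compact N -> N !=set0 -> N `<=` M j -> N = M j,
        (0 < m j)%N & forall w, fiber (M j) w (m j)]]].
Proof.
have [k [k0 Kk k_max]] := cover_number; exists k.
have N_fiber N : invariant_compact N -> N !=set0 ->
    exists m, (0 < m)%N /\ forall w, fiber N w m.
  move=> iN N0; have [m [m0 Nm nm]] := invariant_compact_cover Kk k_max iN N0.
  exists m; split=> // w; have [f [fN /separated_injective f_inj]] := Nm w.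
  have [NK _ _] := iN; exists f; split=> //.
  exact: (separated_fiber Kk k_max NK (nm w) f_inj fN).
split=> // [w|||].
- have [f [fK /separated_injective f_inj]] := Kk w; exists f; split=> // x.
  by split=> [/(fiber_exhausted k_max f_inj fK)//|[i ->]].
- exact: semiflow_extends.
- exact: local_sections.
- have [l [M [tM KM MP]]] := minimal_decomposition Kk k_max.
  have [m mP] := choice (fun j => let: And3 a b _ := MP j in N_fiber _ b a).
  exists l, M, m; split=> // j; have [M0 iM minM] := MP j; have [m0 Mm] := mP j.
  by split.
Qed.

End SkewProduct.

(** * The delayed vector field *)

Section OperatorContinuity.
Context {R : realType} {T : topologicalType} {X Y : normedModType R}.

Lemma op_compact_bound (D : T -> X -> Y) (A : set T) :
  (forall q (e : R), 0 < e -> \forall p \near q, forall v, `|D p v - D q v| <= e * `|v|) ->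
  (forall q, exists k : R, forall v, `|D q v| <= k * `|v|) -> compact A ->
  exists2 k : R, 0 <= k & forall q, A q -> forall v, `|D q v| <= k * `|v|.
Proof.
move=> Dc Db /compact_near_coveringP cA.
have : \forall k \near +oo%R, A `<=` (fun q => forall v, `|D q v| <= k * `|v|).
  apply: cA => q Aq; have [k Dk] := Db q.
  near=> p k'.
  have kk' : 1 + k <= k' by near: k'; apply: nbhs_pinfty_ge; rewrite num_real.
  move=> v; rewrite -[D p v](subrK (D q v)).
  rewrite (le_trans (ler_normD _ _))//.
  have H1 : `|D p v - D q v| <= 1 * `|v| by move: v; near: p; apply: Dc.
  apply: (le_trans (lerD H1 (Dk v))); by rewrite -mulrDl ler_wpM2r.
move=> [M [_ MD]]; exists (`|M| + 1); first by rewrite addr_ge0.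
by apply: MD; rewrite (le_lt_trans (ler_norm _))// ltrDl.
Unshelve. all: by end_near. Qed.

End OperatorContinuity.

Section DelayedField.
Context {R : realType} {Omega : metricType R} {r : {posnum R}} {n : nat}.
Local Notation E := 'rV[R]_n.
Local Notation C := (histC r n).
Local Notation W := (histW r n).
Local Notation I := (`[- r%:num, 0]%classic : set R).
Variables (F : Omega -> E -> E -> E) (tau : Omega -> C -> R).
Hypothesis Omega_compact : compact [set: Omega].
Hypothesis tau_range : forall w x, 0 <= tau w x <= r%:num.
Hypothesis F_H1 : H1 F.
Hypothesis tau_H2 : H2 tau.

Definition delayed_field (w : Omega) (x : C) : E := F w (x 0) (x (- tau w x)).

Lemma op_continuous_diff {T : topologicalType} {X Y : normedModType R}
    (f : T -> X -> Y) (a : T -> X) : (forall q, differentiable (f q) (a q)) ->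
  op_continuous (fun q => 'd (f q) (a q)) ->
  forall q (e : R), 0 < e -> \forall p \near q, forall v,
    `|'d (f p) (a p) v - 'd (f q) (a q) v| <= e * `|v|.
Proof.
move=> df Dc q e e0; have /cvgrPdist_le/(_ _ e0) := Dc q.
apply: filterS => p; rewrite sub0r normrN => pe v.
apply: le_trans (opnorm_diff_ub (df p) (df q) v) _.
by rewrite ler_wpM2r// (le_trans (ler_norm _)).
Qed.

Lemma D2F_near (q : Omega * E * E) (e : R) : 0 < e -> \forall p \near q, forall v,
  `|D2F F p.1.1 p.1.2 p.2 v - D2F F q.1.1 q.1.2 q.2 v| <= e * `|v|.
Proof.
have [_ dF _ cF _] := F_H1.
exact: (@op_continuous_diff _ _ _ (fun q : Omega * E * E => fun u' => F q.1.1 u' q.2)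
  (fun q => q.1.2)).
Qed.

Lemma D3F_near (q : Omega * E * E) (e : R) : 0 < e -> \forall p \near q, forall v,
  `|D3F F p.1.1 p.1.2 p.2 v - D3F F q.1.1 q.1.2 q.2 v| <= e * `|v|.
Proof.
have [_ _ dF _ cF] := F_H1.
exact: (@op_continuous_diff _ _ _ (fun q : Omega * E * E => F q.1.1 q.1.2)
  (fun q => q.2)).
Qed.

Lemma D2tau_near (q : Omega * C) (e : R) : 0 < e -> \forall p \near q, forall v,
  `|D2tau tau p.1 p.2 v - D2tau tau q.1 q.2 v| <= e * `|v|.
Proof.
have [_ dtau ctau _] := tau_H2.
exact: (@op_continuous_diff _ _ _ (fun q : Omega * C => tau q.1) (fun q => q.2)).
Qed.

Local Notation ball_E rho := [set v : E | `|v| <= rho].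

Lemma dF_bounded (rho : R) : exists2 k : R, 0 <= k & forall w (u v : E),
  `|u| <= rho -> `|v| <= rho -> forall h,
  `|D2F F w u v h| <= k * `|h| /\ `|D3F F w u v h| <= k * `|h|.
Proof.
have cA : compact (([set: Omega] `*` ball_E rho) `*` ball_E rho).
  by do !apply: compact_setX => //; exact: compact_rV_ball.
have [_ dF2 dF3 _ _] := F_H1.
have [k k0 Hk] := op_compact_bound D2F_near (fun q => diff_bounded (dF2 q.1.1 q.1.2 q.2)) cA.
have [l l0 Hl] := op_compact_bound D3F_near (fun q => diff_bounded (dF3 q.1.1 q.1.2 q.2)) cA.
exists (k + l) => [|w u v ur vr h]; first exact: addr_ge0.
split; rewrite mulrDl.
  by rewrite (le_trans (Hk (w, u, v) _ h)) ?lerDl ?mulr_ge0.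
by rewrite (le_trans (Hl (w, u, v) _ h)) ?lerDr ?mulr_ge0.
Qed.

(** Only partial derivatives are given, so the increment is split by changing one argument at a
    time. *)
Lemma F_mean_value w (u u' v v' : E) (A B : E -> E) (e : R) :
  (forall t, 0 <= t <= 1 ->
    `|D2F F w (u' + t *: (u - u')) v (u - u') - A (u - u')| <= e * `|u - u'|) ->
  (forall t, 0 <= t <= 1 ->
    `|D3F F w u' (v' + t *: (v - v')) (v - v') - B (v - v')| <= e * `|v - v'|) ->
  `|F w u v - F w u' v' - (A (u - u') + B (v - v'))| <= e * (`|u - u'| + `|v - v'|).
Proof.
have [_ dF2 dF3 _ _] := F_H1 => Ae Be.
have e2 := mean_value_ineq (fun z => dF2 w z v) Ae.
have e3 := mean_value_ineq (dF3 w u') Be.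
rewrite mulrDr (le_trans _ (lerD e2 e3))// (le_trans _ (ler_normD _ _))//.
by rewrite addrACA -opprD subrKA.
Qed.

Lemma segment_ball {V : normedModType R} (rho : R) (u v : V) (t : R) : 0 <= t <= 1 ->
  `|u| <= rho -> `|v| <= rho -> `|v + t *: (u - v)| <= rho.
Proof.
move=> /andP[t0 t1] ur vr.
have -> : v + t *: (u - v) = t *: u + (1 - t) *: v.
  by rewrite scalerBr scalerBl scale1r addrC -addrA (addrC _ v).
rewrite (le_trans (ler_normD _ _))// !normrZ ger0_norm//.
rewrite (@ger0_norm _ (1 - t)) ?subr_ge0//.
have : t * `|u| <= t * rho by rewrite ler_wpM2l.
have : (1 - t) * `|v| <= (1 - t) * rho by rewrite ler_wpM2l ?subr_ge0.
lra.
Qed.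

Lemma F_lipschitz (rho : R) : exists2 k : R, 0 <= k & forall w (u u' v v' : E),
  `|u| <= rho -> `|u'| <= rho -> `|v| <= rho -> `|v'| <= rho ->
  `|F w u v - F w u' v'| <= k * (`|u - u'| + `|v - v'|).
Proof.
have [k k0 dk] := dF_bounded rho; exists k => // w u u' v v' ur u'r vr v'r.
have d2 t : 0 <= t <= 1 ->
    `|D2F F w (u' + t *: (u - u')) v (u - u') - 0| <= k * `|u - u'|.
  move=> t01; rewrite subr0.
  by case: (dk w (u' + t *: (u - u')) v (segment_ball t01 ur u'r) vr (u - u')).
have d3 t : 0 <= t <= 1 ->
    `|D3F F w u' (v' + t *: (v - v')) (v - v') - 0| <= k * `|v - v'|.
  move=> t01; rewrite subr0.
  by case: (dk w u' (v' + t *: (v - v')) u'r (segment_ball t01 vr v'r) (v - v')).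
have := @F_mean_value w u u' v v' (fun=> 0) (fun=> 0) k d2 d3.
by rewrite addr0 subr0.
Qed.

Lemma F_bounded (rho : R) : exists2 M : R, 0 <= M & forall w (u v : E),
  `|u| <= rho -> `|v| <= rho -> `|F w u v| <= M.
Proof.
have cA : compact (([set: Omega] `*` ball_E rho) `*` ball_E rho).
  by do !apply: compact_setX => //; exact: compact_rV_ball.
have [cF _ _ _ _] := F_H1.
have /(@compact_near_coveringP _ _) := cA.
move=> /(_ R +oo%R (fun M q => `|F q.1.1 q.1.2 q.2| <= M) _) [].
  move=> q _; near=> p M.
  have Fp : `|F q.1.1 q.1.2 q.2 - F p.1.1 p.1.2 p.2| <= 1.
    by near: p; have /cvgrPdist_le := cF q; apply.
  have FM : `|F q.1.1 q.1.2 q.2| + 1 <= M.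
    by near: M; apply: nbhs_pinfty_ge; rewrite num_real.
  apply: le_trans FM; rewrite -lerBlDl (le_trans (lerB_dist _ _))// distrC//.
move=> M [_ MF]; exists (`|M| + 1); first by rewrite addr_ge0.
move=> w u v ur vr; apply: (MF (`|M| + 1) _ (w, u, v)) => //.
by rewrite (le_lt_trans (ler_norm _))// ltrDl.
Unshelve. all: by end_near. Qed.

(** Bounded sets of [C] need not be precompact, and a uniform bound on [D2tau] is obtained from
    compactness; Lipschitz balls are compact and convex. *)
Lemma tau_lipschitz (rho kap : R) : 0 <= kap -> exists2 k : R, 0 <= k &
  forall w x y, lip_ball rho kap x -> lip_ball rho kap y ->
  `|tau w x - tau w y| <= k * `|x - y|.
Proof.
move=> kap0; have [_ dtau _ _] := tau_H2.
have cA : compact ([set: Omega] `*` @lip_ball R r n rho kap).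
  by apply: compact_setX => //; exact: lip_ball_compact.
have [k k0 Hk] := op_compact_bound D2tau_near (fun q => diff_bounded (dtau q.1 q.2)) cA.
exists k => // w x y xb yb.
have := @real_mean_value_ineq _ _ (tau w) x y 0 (k * `|x - y|) (dtau w).
rewrite !subr0; apply=> t t01; rewrite subr0.
apply: (Hk (w, _)); split=> //; exact: lip_ball_convex.
Qed.

Lemma tauI w x : I (- tau w x).
Proof. by rewrite /= in_itv/= lerN2 oppr_le0; have /andP[-> ->] := tau_range w x. Qed.

(** Shifting the delay changes [y (- tau w x)] by at most [kap] times the change of [tau]; this is
    where the common Lipschitz constant of the histories enters. *)
Lemma field_lipschitz (rho kap : R) : 0 <= kap -> exists2 k : R, 0 <= k &
  forall w x y, lip_ball rho kap x -> lip_ball rho kap y ->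
  `|delayed_field w x - delayed_field w y| <= k * `|x - y|.
Proof.
move=> kap0; have [k k0 Fk] := F_lipschitz rho.
have [l l0 taul] := tau_lipschitz rho kap0.
exists (k * (1 + (1 + kap * l))); first by rewrite mulr_ge0// !addr_ge0// mulr_ge0.
move=> w x y xb yb; have [xr xk] := xb; have [yr yk] := yb.
apply: (le_trans (Fk _ _ _ _ _ (xr _) (yr _) (xr _) (yr _))).
rewrite -mulrA ler_wpM2l// !mulrDl !mul1r lerD//; first exact: (hist_norm_ub (x - y)).
rewrite -[x (- tau w x) - _](subrKA (y (- tau w x))).
rewrite (le_trans (ler_normD _ _))// lerD//; first exact: (hist_norm_ub (x - y)).
rewrite (le_trans (yk _ _))// -mulrA ler_wpM2l// -opprD normrN.
exact: taul.
Qed.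

Lemma field_bounded (rho : R) : exists2 M : R, 0 <= M & forall w (x : C),
  (forall s, `|x s| <= rho) -> `|delayed_field w x| <= M.
Proof.
by have [M M0 FM] := F_bounded rho; exists M => // w x xr; exact: FM.
Qed.

Lemma field_continuous : continuous (fun q : Omega * C => delayed_field q.1 q.2).
Proof.
have [cF _ _ _ _] := F_H1; have [ctau _ _ _] := tau_H2.
have ev (s : Omega * C -> R) : continuous s -> continuous (fun q : Omega * C => (q.2 : C) (s q) : E).
  move=> cs q; apply: (@continuous_comp _ _ _ (fun q : Omega * C => (q.2, s q))
    (fun q : C * R => q.1 q.2)); last exact: hist_eval_continuous.
  by apply: continuous_pair; [exact: cvg_snd|exact: cs].
move=> q; apply: (@continuous_comp _ _ _
  (fun q : Omega * C => (q.1, q.2 0, q.2 (- tau q.1 q.2)))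
  (fun p : Omega * E * E => F p.1.1 p.1.2 p.2)); last exact: cF.
apply: continuous_pair; first (apply: continuous_pair; first exact: cvg_fst).
  by apply: (ev (fun=> 0)) => ?; exact: cvg_cst.
by apply: (ev (fun q => - tau q.1 q.2)) => p; apply: cvgN; exact: ctau.
Qed.

Local Notation lin := (linearization F tau).

Lemma D2FP w (u v : E) (a : R) h k :
  D2F F w u v (a *: h + k) = a *: D2F F w u v h + D2F F w u v k.
Proof. exact: linearP. Qed.

Lemma D3FP w (u v : E) (a : R) h k :
  D3F F w u v (a *: h + k) = a *: D3F F w u v h + D3F F w u v k.
Proof. exact: linearP. Qed.

Lemma D3FB w (u v h k : E) : D3F F w u v (h - k) = D3F F w u v h - D3F F w u v k.
Proof. exact: linearB. Qed.

Lemma D3FZ w (u v : E) (a : R) h : D3F F w u v (a *: h) = a *: D3F F w u v h.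
Proof. exact: linearZZ. Qed.

Lemma D2tauP w (x : C) (a : R) (h k : C) :
  D2tau tau w x (a *: h + k) = a * D2tau tau w x h + D2tau tau w x k.
Proof. exact: linearP. Qed.

Lemma linearizationE w (x : W) (u : C) :
  lin (w, x) u = D2F F w (x 0) (x (- tau w x)) (u 0)
    + D3F F w (x 0) (x (- tau w x))
        (u (- tau w x) - D2tau tau w x u *: deriv_within I x (- tau w x)).
Proof.
by rewrite /linearization D3FB D3FZ addrA.
Qed.

Lemma linearization_linear q (a : R) (u v : C) : lin q (a *: u + v) = a *: lin q u + lin q v.
Proof.
case: q => w x; rewrite !linearizationE.
rewrite [(a *: u + v) 0](_ : _ = a *: u 0 + v 0)//.
rewrite [(a *: u + v) (- tau w x)](_ : _ = a *: u (- tau w x) + v (- tau w x))//.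
rewrite D2FP D2tauP scalerDl opprD addrACA -scalerA -scalerBr.
by rewrite D3FP scalerDr addrACA.
Qed.

Lemma linearizationB q (u v : C) : lin q (u - v) = lin q u - lin q v.
Proof.
by rewrite -[u - v]addrC -scaleN1r linearization_linear scaleN1r addrC.
Qed.

Lemma linearization0 q : lin q 0 = 0.
Proof. by rewrite -[X in lin q X](subrr (0 : C)) linearizationB subrr. Qed.

Lemma linearizationZ q (a : R) (u : C) : lin q (a *: u) = a *: lin q u.
Proof. by rewrite -[a *: u]addr0 linearization_linear linearization0 addr0. Qed.

Lemma segment_close {V : normedModType R} (z u v : V) (d t : R) : 0 <= t <= 1 ->
  `|u - z| < d -> `|v - z| < d -> `|v + t *: (u - v) - z| < d.
Proof.
move=> t01 uz vz.
have -> : v + t *: (u - v) - z = (v - z) + t *: ((u - z) - (v - z)).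
  by rewrite opprB subrKA addrAC.
apply: le_lt_trans (_ : Num.max `|u - z| `|v - z| < _).
  by apply: segment_ball => //; rewrite le_max lexx ?orbT.
by rewrite gt_max uz.
Qed.

(** In its application the four groups are an increment of [x - y], an increment of [y - x0], the
    deviation of [x0] from its tangent with slope [c], and the linearization error of [tau] times
    [c]. *)
Lemma delayed_difference_split {m : nat} (x1 y1 y2 z1 z2 v c : 'rV[R]_m) (s t T : R) :
  x1 - y2 - (v - T *: c) =
  (x1 - y1 - v) + ((y1 - z1) - (y2 - z2)) + (z1 - z2 - (- s - - t) *: c)
  - (s - t - T) *: c.
Proof.
apply/rowP => j; rewrite !mxE; ring.
Qed.

Lemma subr_split {V : zmodType} (x a p q : V) : x - (a + p) = x - (a + q) + (q - p).
Proof. by rewrite !opprD !addrA subrK. Qed.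

(** Both points vary, and the remainder is measured in the norm of [W]: evaluating [x - y] at a
    delay other than that of [q] costs its Lipschitz constant. *)
Definition strict_linear_approx (q : Omega * W) (e d : R) : Prop :=
  forall w (x y : W), ball q d (w, x) -> ball q d (w, y) ->
  `|delayed_field w x - delayed_field w y - lin q (x - y : W)| <= e * `|x - y|.

Lemma field_strict_diff (w0 : Omega) (x0 : W) :
  (forall e : R, 0 < e -> exists2 d : R, 0 < d & forall s t : R, I s -> I t ->
    `|s + tau w0 x0| < d -> `|t + tau w0 x0| < d ->
    `|x0 s - x0 t - (s - t) *: deriv_within I x0 (- tau w0 x0)| <= e * `|s - t|) ->
  forall e : R, 0 < e -> exists2 d : R, 0 < d & strict_linear_approx (w0, x0) e d.
Proof.
move=> x0C1 e e0.
have [_ dF2 dF3 _ _] := F_H1; have [ctau dtau _ _] := tau_H2.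
set t0 := tau w0 x0 in x0C1 *; set c := deriv_within _ _ _ in x0C1.
set a0 := x0 0; set b0 := x0 (- t0).
have [m' Bm'] := diff_bounded (dF3 w0 a0 b0).
have [l' Tl'] := diff_bounded (dtau w0 x0).
pose m : R := `|m'|; pose l : R := `|l'|.
have Bm h : `|D3F F w0 a0 b0 h| <= m * `|h|.
  by rewrite (le_trans (Bm' h))// ler_wpM2r// ler_norm.
have Tl h : `|D2tau tau w0 x0 h| <= l * `|h|.
  by rewrite (le_trans (Tl' h))// ler_wpM2r// ler_norm.
have [m0 l0] : 0 <= m /\ 0 <= l by split; exact: normr_ge0.
(* [Kb |v|] bounds the difference of the delayed values, and [Kc] collects all coefficients of
   [eta |v|] in the final error, so that [eta Kc <= e] suffices. *)
pose Kb : R := 1 + (`|x0| + 1) * (l + 1).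
pose Kc : R := (1 + Kb) + m * (1 + (l + 1) + (l + 1) + `|c|).
have Kb0 : 0 <= Kb by rewrite addr_ge0// mulr_ge0// addr_ge0.
have Kc0 : 0 < Kc.
  by rewrite ltr_pwDl// ?mulr_ge0// ?addr_ge0// ltr_pwDl.
pose eta : R := Num.min 1 (e / Kc).
have eta0 : 0 < eta by rewrite lt_min ltr01 divr_gt0.
have eta1 : eta <= 1 by rewrite ge_min lexx.
have etaK : eta * Kc <= e by rewrite -ler_pdivlMr// ge_min lexx orbT.
move: eta eta0 eta1 etaK => eta eta0 eta1 etaK.
have /nbhs_ballP[d2 /= d20 near2] := D2F_near (w0, a0, b0) eta0.
have /nbhs_ballP[d3 /= d30 near3] := D3F_near (w0, a0, b0) eta0.
have /nbhs_ballP[d4 /= d40 near4] := D2tau_near (w0, x0 : C) eta0.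
have [d5 d50 near5] := x0C1 _ eta0.
pose dd : R := Num.min d2 d3.
have dd0 : 0 < dd by rewrite lt_min d20.
have [dde ddd] : dd <= d2 /\ dd <= d3 by rewrite !ge_min !lexx orbT.
move: dd dd0 dde ddd => dd dd0 dde ddd.
(* Three nested radii: [dd] for the arguments of [F], [ee] for the delays, and [d] below for the
   histories; [ee (|x0| + 1) <= dd / 2] keeps the delayed values within [dd]. *)
pose ee : R := Num.min (Num.min eta d5) (dd / 2 / (`|x0| + 1)).
have x01 : 0 < `|x0| + 1 by rewrite ltr_wpDl.
have ee0 : 0 < ee by rewrite !lt_min eta0 d50 !divr_gt0.
have [ee_eta ee5 ee_dd] : [/\ ee <= eta, ee <= d5 & ee <= dd / 2 / (`|x0| + 1)].
  by rewrite !ge_min !lexx !orbT.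
move: ee ee0 ee_eta ee5 ee_dd => ee ee0 ee_eta ee5 ee_dd.
have /cvgrPdist_lt/(_ _ ee0)/nbhs_ballP[d6 /= d60 near6] := ctau (w0, x0 : C).
pose d : R := Num.min (Num.min eta d4) (Num.min d6 (dd / 2)).
have d0 : 0 < d by rewrite !lt_min eta0 d40 d60 divr_gt0.
have [deta dd4 dd6 ddd2] : [/\ d <= eta, d <= d4, d <= d6 & d <= dd / 2].
  by rewrite !ge_min !lexx !orbT.
move: d d0 deta dd4 dd6 ddd2 => d d0 deta dd4 dd6 ddd2.
exists d => // w.
have close (x : W) : ball (w0, x0) d (w, x) ->
    [/\ ball w0 d w, `|x - x0| < d, `|tau w x - t0| < ee & `|x (- tau w x) - b0| < dd].
  move=> [/= ww0]; rewrite -ball_normE /= distrC => xx0.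
  have tx : `|tau w x - t0| < ee.
    rewrite distrC; apply: (near6 (w, x : C)); split => /=.
      exact: le_ball ww0.
    rewrite -ball_normE /= distrC.
    by rewrite (le_lt_trans _ (lt_le_trans xx0 dd6))// (lip_hist_norm_le (x - x0)).
  split=> //.
  rewrite -(subrKA (x0 (- tau w x))) (le_lt_trans (ler_normD _ _))//.
  rewrite (splitr dd) ltr_leD//.
    rewrite (le_lt_trans (histW_norm_ub (x - x0) _))//; exact: lt_le_trans ddd2.
  rewrite (le_trans (histW_norm_lip _ _ _))// -opprD normrN.
  rewrite (@le_trans _ _ (ee * (`|x0| + 1)))//.
    by rewrite mulrC ler_pM ?lerDl// ltW.
  by rewrite -ler_pdivlMr.
move=> x y /close[ww0 xx0 tx bx] /close[_ yx0 ty by_].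
set v := (x - y : W).
have v_s s : v s = x s - y s by [].
have vC : `|x - y : C| <= `|v| by exact: (lip_hist_norm_le v).
have v0 : 0 <= `|v| by [].
have toC (z : W) : `|z - x0| < d -> `|(z : C) - x0| < d.
  by apply: le_lt_trans; exact: (lip_hist_norm_le (z - x0)).
have tauT : `|tau w x - tau w y - D2tau tau w0 x0 v| <= eta * `|v|.
  apply: (real_mean_value_ineq (dtau w)) => t t01.
  have : ball (w0, x0 : C) d4 (w, (y : C) + t *: ((x : C) - y)).
    split => /=; first exact: le_ball ww0.
    rewrite -ball_normE /= distrC.
    exact: (@segment_close C x0 x y d4 t t01 (lt_le_trans (toC _ xx0) dd4) (lt_le_trans (toC _ yx0) dd4)).
  move=> /near4 /(_ ((x : C) - y)) /le_trans; apply.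
  by rewrite ler_wpM2l// ltW.
have tauL : `|tau w x - tau w y| <= (l + 1) * `|v|.
  rewrite -[X in `|X|](subrK (D2tau tau w0 x0 v)) (le_trans (ler_normD _ _))//.
  rewrite addrC mulrDl mul1r lerD//.
    by rewrite (le_trans (Tl _))// ler_wpM2l// lip_hist_norm_le.
  by rewrite (le_trans tauT)// ler_piMl.
have yx : `|y| <= `|x0| + 1.
  rewrite -[y](subrK x0) (le_trans (ler_normD _ _))// addrC lerD2l.
  by rewrite (le_trans (ltW yx0))// (le_trans deta).
set a := x 0; set a' := y 0; set b := x (- tau w x); set b' := y (- tau w y).
have aa' : `|a - a'| <= `|v| by exact: (histW_norm_ub v).
have bb'E : b - b' = v (- tau w x) + (y (- tau w x) - y (- tau w y)).
  by rewrite v_s subrKA.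
have bb' : `|b - b'| <= Kb * `|v|.
  rewrite bb'E (le_trans (ler_normD _ _))// /Kb mulrDl mul1r lerD ?histW_norm_ub//.
  rewrite (le_trans (histW_norm_lip _ _ _))// -mulrA ler_pM//.
  by rewrite -opprD normrN.
have ddd' : d <= dd by rewrite (le_trans ddd2)// ler_pdivrMr// mulr_natr mulr2n lerDl ltW.
have a'0 : `|a' - a0| < dd.
  by rewrite (le_lt_trans (histW_norm_ub (y - x0) _))// (lt_le_trans yx0).
have aa0 : `|a - a0| < dd.
  by rewrite (le_lt_trans (histW_norm_ub (x - x0) _))// (lt_le_trans xx0).
have segE (u u' z : E) t : 0 <= t <= 1 -> `|u - z| < dd -> `|u' - z| < dd ->
    `|u' + t *: (u - u') - z| < dd.
  move=> t01 uz u'z.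
  exact: segment_close.
have FM := @F_mean_value w a a' b b' (D2F F w0 a0 b0) (D3F F w0 a0 b0) eta.
have {}FM : `|F w a b - F w a' b' - (D2F F w0 a0 b0 (a - a') + D3F F w0 a0 b0 (b - b'))|
    <= eta * (`|a - a'| + `|b - b'|).
  apply: FM => t t01.
    apply: (near2 (w, a' + t *: (a - a'), b)); split; first split => /=.
    - by apply: le_ball ww0; exact: le_trans dde.
    - by rewrite -ball_normE /= distrC (lt_le_trans (segE _ _ _ _ t01 aa0 a'0)).
    - by rewrite -ball_normE /= distrC (lt_le_trans bx).
  apply: (near3 (w, a', b' + t *: (b - b'))); split; first split => /=.
  - by apply: le_ball ww0; exact: le_trans ddd.
  - by rewrite -ball_normE /= distrC (lt_le_trans a'0).
  - by rewrite -ball_normE /= distrC (lt_le_trans (segE _ _ _ _ t01 bx by_)).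
rewrite linearizationE -/t0 -/a0 -/b0 -/c.
set Tv := D2tau tau w0 x0 v.
have rem : `|(b - b') - (v (- t0) - Tv *: c)| <= eta * (1 + (l + 1) + (l + 1) + `|c|) * `|v|.
  have -> : (b - b') - (v (- t0) - Tv *: c) =
      (v (- tau w x) - v (- t0))
      + ((y - x0) (- tau w x) - (y - x0) (- tau w y))
      + (x0 (- tau w x) - x0 (- tau w y) - (- tau w x - - tau w y) *: c)
      - (tau w x - tau w y - Tv) *: c.
    exact: delayed_difference_split.
  have h1 : `|v (- tau w x) - v (- t0)| <= eta * `|v|.
    rewrite (le_trans (histW_norm_lip _ _ _))// mulrC -opprD normrN ler_wpM2r//.
    by rewrite (le_trans (ltW tx)).
  have h2 : `|(y - x0) (- tau w x) - (y - x0) (- tau w y)| <= eta * (l + 1) * `|v|.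
    rewrite (le_trans (histW_norm_lip _ _ _))// -mulrA ler_pM//.
      by rewrite (le_trans (ltW yx0)).
    by rewrite -opprD normrN.
  have h3 : `|x0 (- tau w x) - x0 (- tau w y) - (- tau w x - - tau w y) *: c|
      <= eta * (l + 1) * `|v|.
    rewrite (le_trans (near5 _ _ (tauI _ _) (tauI _ _) _ _))//.
    - by rewrite addrC distrC (lt_le_trans tx).
    - by rewrite addrC distrC (lt_le_trans ty).
    - by rewrite -mulrA ler_wpM2l ?(ltW eta0)// -opprD normrN.
  have h4 : `|(tau w x - tau w y - Tv) *: c| <= eta * `|c| * `|v|.
    by rewrite normrZ mulrAC ler_wpM2r.
  rewrite (le_trans (ler_normB _ _))//.
  apply: (le_trans (lerD (le_trans (ler_normD _ _) (lerD (ler_normD _ _) (lexx _))) (lexx _))).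
  apply: (le_trans (lerD (lerD (lerD h1 h2) h3) h4)).
  by rewrite le_eqVlt; apply/orP; left; apply/eqP; ring.
rewrite /delayed_field -/a -/a' -/b -/b'.
have -> : F w a b - F w a' b' -
    (D2F F w0 a0 b0 (v 0) + D3F F w0 a0 b0 (v (- t0) - Tv *: c)) =
  (F w a b - F w a' b' - (D2F F w0 a0 b0 (a - a') + D3F F w0 a0 b0 (b - b')))
  + D3F F w0 a0 b0 ((b - b') - (v (- t0) - Tv *: c)).
  by rewrite [D3F F w0 a0 b0 (b - b' - _)]D3FB; exact: subr_split.
rewrite (le_trans (ler_normD _ _))//.
apply: le_trans (ler_wpM2r v0 etaK).
have h5 := le_trans (Bm _) (ler_wpM2l m0 rem).
have h6 : eta * (`|a - a'| + `|b - b'|) <= eta * (1 + Kb) * `|v|.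
  by rewrite -mulrA ler_wpM2l ?(ltW eta0)// mulrDl mul1r lerD.
apply: (le_trans (lerD (le_trans FM h6) h5)).
by rewrite le_eqVlt; apply/orP; left; apply/eqP; rewrite /Kc; ring.
Qed.

(** * Solutions *)

Variable sigma : R -> Omega -> Omega.
Hypothesis sigma_flow : is_flow sigma.

Lemma flow_continuous : continuous (fun p : R * Omega => sigma p.1 p.2).
Proof. by case: sigma_flow. Qed.

Lemma flow0 w : sigma 0 w = w.
Proof. by case: sigma_flow. Qed.

Lemma flowD s t w : sigma (s + t) w = sigma s (sigma t w).
Proof. by case: sigma_flow. Qed.

Lemma flow_orbit_continuous w : continuous (sigma^~ w).
Proof.
move=> t; apply: (@continuous_comp _ _ _ (fun t : R => (t, w)) (fun p => sigma p.1 p.2)).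
  by apply: continuous_pair; [exact: cvg_id|exact: cvg_cst].
exact: flow_continuous.
Qed.

(** * The vector field with clipped histories *)

Definition clip (rho : R) (v : E) : E := \row_j Num.max (- rho) (Num.min rho (v ord0 j)).

Lemma real_clip_lip (rho a b : R) : 0 <= rho ->
  `|Num.max (- rho) (Num.min rho a) - Num.max (- rho) (Num.min rho b)| <= `|a - b|.
Proof.
move=> rho0; have nrho : - rho <= rho by rewrite (le_trans _ rho0)// oppr_le0.
rewrite /Num.max /Num.min; move: rho nrho rho0 => rho nrho rho0.
case: (ltP rho a) => ra; case: (ltP rho b) => rb; case: (ltP (- rho) rho) => ?;
  case: (ltP (- rho) a) => ?; case: (ltP (- rho) b) => ?;
  case: (ger0P (a - b)) => ?; rewrite ?ler_norml; lra.
Qed.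

Lemma clip_lip (rho : R) (u v : E) : 0 <= rho -> `|clip rho u - clip rho v| <= `|u - v|.
Proof.
move=> rho0; apply/rV_norm_leP => // j; rewrite !mxE.
apply: le_trans (real_clip_lip _ _ rho0) _.
by have := rV_coord_le (u - v) j; rewrite !mxE.
Qed.

Lemma clip_le (rho : R) (v : E) : 0 <= rho -> `|clip rho v| <= rho.
Proof.
move=> rho0; apply/rV_norm_leP => // j; rewrite mxE ler_norml le_max lexx/=.
by rewrite ge_max ge_min lexx/= andbT (le_trans _ rho0)// oppr_le0.
Qed.

Lemma clip_id (rho : R) (v : E) : `|v| <= rho -> clip rho v = v.
Proof.
move=> vr; apply/rowP => j; rewrite mxE.
have := le_trans (rV_coord_le v j) vr; rewrite ler_norml => /andP[a b].
by rewrite (min_idPr b) (max_idPr a).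
Qed.

Lemma clip_hist (rho : {nonneg R}) (x : C) : (fun s => clip rho%:num (x s)) \in @hist_pred R r n.
Proof.
apply/asboolP; split=> [s|s]; last by rewrite hist_clamp.
apply/cvgrPdist_le => e e0.
have /cvgrPdist_le/(_ _ e0) := @hist_continuous _ _ _ x s.
by apply: filterS => t; apply: le_trans; exact: clip_lip.
Qed.

Definition clipC (rho : {nonneg R}) (x : C) : C := Hist (clip_hist rho x).

Lemma clipC_lip (rho : {nonneg R}) (x y : C) : `|clipC rho x - clipC rho y| <= `|x - y|.
Proof.
apply: hist_norm_le => s _.
apply: le_trans (_ : `|x s - y s| <= _); last exact: (hist_norm_ub (x - y)).
exact: clip_lip.
Qed.

Lemma clipC_id (rho : {nonneg R}) (x : C) : (forall s, `|x s| <= rho%:num) -> clipC rho x = x.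
Proof. by move=> xr; apply: histP => s _; apply: clip_id. Qed.

Definition clipped_field (rho : {nonneg R}) (w : Omega) (x : C) : E :=
  delayed_field w (clipC rho x).

Lemma clipped_field_id (rho : {nonneg R}) w (x : C) : (forall s, `|x s| <= rho%:num) ->
  clipped_field rho w x = delayed_field w x.
Proof. by move=> xr; rewrite /clipped_field clipC_id. Qed.

Lemma clipped_field_bounded (rho : {nonneg R}) : exists2 M : R, 0 <= M &
  forall w x, `|clipped_field rho w x| <= M.
Proof.
have [M M0 GM] := field_bounded rho%:num; exists M => // w x; apply: GM => s.
exact: clip_le.
Qed.

(** Clipping is 1-Lipschitz, so it keeps the constant [kap] while bounding the size by [rho]: all
    [kap]-Lipschitz histories, however large, are sent into one Lipschitz ball. *)
Lemma clipped_field_lipschitz (rho : {nonneg R}) (kap : R) : 0 <= kap ->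
  exists2 k : R, 0 <= k & forall w (x y : C),
  (forall s t, `|x s - x t| <= kap * `|s - t|) ->
  (forall s t, `|y s - y t| <= kap * `|s - t|) ->
  `|clipped_field rho w x - clipped_field rho w y| <= k * `|x - y|.
Proof.
move=> kap0; have [k k0 Gk] := field_lipschitz rho%:num kap0; exists k => // w x y xk yk.
have cb (z : C) : (forall s t, `|z s - z t| <= kap * `|s - t|) ->
    lip_ball rho%:num kap (clipC rho z).
  move=> zk; split=> [s|s t]; first exact: clip_le.
  by rewrite (le_trans _ (zk s t))//; exact: clip_lip.
apply: (le_trans (Gk w _ _ (cb x xk) (cb y yk))).
by rewrite ler_wpM2l//; exact: clipC_lip.
Qed.

Lemma clipped_field_continuous (rho : {nonneg R}) :
  continuous (fun q : Omega * C => clipped_field rho q.1 q.2).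
Proof.
move=> q; apply: (@continuous_comp _ _ _ (fun q : Omega * C => (q.1, clipC rho q.2))
  (fun q : Omega * C => delayed_field q.1 q.2)); last exact: field_continuous.
apply: continuous_pair; first exact: cvg_fst.
apply/cvgrPdist_le => e e0.
have /cvgrPdist_le/(_ _ e0) : (p : Omega * C).2 @[p --> q] --> q.2 by exact: cvg_snd.
by apply: filterS => p; apply: le_trans; exact: clipC_lip.
Qed.

(** Total continuous functions that solve the equation at positive times: one-sided derivatives and
    subspace topologies are confined to the lemmas linking them with [is_solution]. *)
Definition curve (H : Omega -> C -> E) (w : Omega) (y : R -> E) : Prop :=
  continuous y /\ forall t : R, 0 < t -> is_derive t 1 y (H (sigma t w) (segC r y t)).

Lemma shift_continuous (y : R -> E) (a : R) : continuous y -> continuous (fun s => y (s + a)).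
Proof.
move=> yc u; apply: (@continuous_comp _ _ _ (fun s : R => s + a) y); last exact: yc.
by apply: cvgD; [exact: cvg_id|exact: cvg_cst].
Qed.

Lemma is_derive_shift (y : R -> E) (a t : R) l : is_derive (t + a) 1 y l ->
  is_derive t 1 (fun s => y (s + a)) l.
Proof. by rewrite !is_derive_cvg; under eq_fun do rewrite addrA. Qed.

Lemma curve_shift H w y (a : R) : 0 <= a -> curve H w y ->
  curve H (sigma a w) (fun s => y (s + a)).
Proof.
move=> a0 [yc dy]; split=> [|t t0]; first exact: shift_continuous.
apply: is_derive_shift; rewrite (segC_shift _ _ yc) -flowD.
by apply: dy; exact: ltr_wpDr.
Qed.

Lemma rhs_continuous (H : Omega -> C -> E) w (y : R -> E) : continuous (fun q : Omega * C => H q.1 q.2) ->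
  continuous y -> continuous (fun t => H (sigma t w) (segC r y t)).
Proof.
move=> Hc yc t; apply: (@continuous_comp _ _ _ (fun t => (sigma t w, segC r y t : C))
  (fun q : Omega * C => H q.1 q.2)); last exact: Hc.
by apply: continuous_pair; [exact: flow_orbit_continuous|exact: segC_continuous].
Qed.

(** Picard iteration in the class of [kap]-Lipschitz curves: it is stable because the clipped field
    is bounded by [M <= kap], and on it the field is Lipschitz in the sup norm. *)
Lemma clipped_curve_exists (rho : {nonneg R}) (M kap : R) :
  0 <= M -> M <= kap -> (forall w x, `|clipped_field rho w x| <= M) ->
  forall w (x : C), (forall s t, `|x s - x t| <= kap * `|s - t|) ->
  exists y, [/\ curve (clipped_field rho) w y, forall s : R, s <= 0 -> y s = x s
    & forall s t, `|y s - y t| <= kap * `|s - t|].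
Proof.
move=> M0 Mk GM w x xk; have kap0 : 0 <= kap by exact: le_trans Mk.
have [L L0 GL] := clipped_field_lipschitz rho kap0.
pose Q := [set y : R -> E | forall s t, `|y s - y t| <= kap * `|s - t|].
have Qc y : Q y -> continuous y by exact: lipschitz_continuous.
have Qball y t : Q y -> forall s u, `|segC r y t s - segC r y t u| <= kap * `|s - u|.
  move=> Qy s u; have yc := Qc _ Qy; rewrite !(segC_curve _ _ yc) (le_trans (Qy _ _))//.
  by rewrite opprD addrACA subrr add0r ler_wpM2l// clamp_lip.
pose A y t := clipped_field rho (sigma t w) (segC r y t).
have x0 t : 0 <= t -> x t = x 0.
  move=> t0; rewrite hist_clamp [RHS]hist_clamp /clamp; congr (x (Num.max _ _)).
  by rewrite (min_idPr t0) minxx.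
have [y [Qy y0 dy]] : exists y, [/\ Q y, forall t : R, t <= 0 -> y t = x t
    & forall t : R, 0 < t -> is_derive t 1 y (A y t)].
  apply: (@picard R n A x (L + 1) M Q) => //.
  - exact: ltr_wpDl.
  - by move=> y Qy; apply: rhs_continuous; [exact: clipped_field_continuous|exact: Qc].
  - move=> y Y Qy Yc Yx dY.
    have H (T : R) : lip_on (- `|T|) `|T| kap Y.
      apply: (@lip_on_cat _ _ _ 0); rewrite ?oppr_le0//.
        by move=> s t /andP[_ s0] /andP[_ t0]; rewrite !Yx.
      apply: (@lip_on_deriv _ _ _ _ _ _ (A y)) => // u /andP[u0 _]; first exact: dY.
      exact: le_trans (GM _ _) Mk.
    move=> s t; apply: (H (Num.max `|s| `|t|)).
      by rewrite -ler_norml (le_trans _ (ler_norm _))// le_max lexx.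
    by rewrite -ler_norml (le_trans _ (ler_norm _))// le_max lexx orbT.
  - move=> u y Qu uy s t.
    have : `|u k s - u k t| @[k --> \oo] --> `|y s - y t|.
      by apply: cvg_norm; apply: cvgB; exact: uy.
    apply: (@closed_cvg _ _ _ _ (fun k => `|u k s - u k t|) [set v : R | v <= kap * `|s - t|]).
      exact: closed_le.
    by apply: nearW => k; exact: Qu.
  - move=> y z t B Qy Qz t0 B0 yz; have [yc zc] := (Qc _ Qy, Qc _ Qz).
    rewrite (le_trans (GL _ _ _ (Qball _ t Qy) (Qball _ t Qz)))//.
    rewrite mulrDl mul1r (@le_trans _ _ (L * B)) ?lerDl// ler_wpM2l//.
    by apply/segC_dist_leP => // s /andP[_ st]; exact: yz.
  - by move=> t _; exact: GM.
by exists y; split=> //; split; [exact: Qc|exact: dy].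
Unshelve. all: by end_near. Qed.

(** The bound of a W^{1,oo} norm on a window, in the form of [histW_norm_leP], without forming a
    segment. *)
Definition window_le (d : R -> E) (a b k : R) : Prop :=
  (forall s, a <= s <= b -> `|d s| <= k) /\ lip_on a b k d.

Lemma window_leW d a b a' b' k k' : a <= a' -> b' <= b -> k <= k' ->
  window_le d a b k -> window_le d a' b' k'.
Proof.
move=> aa bb kk [d1 d2]; split; last exact: lip_onW d2.
move=> s /andP[as_ sb]; apply: le_trans kk; apply: d1.
by rewrite (le_trans aa)// (le_trans sb).
Qed.

(** The smoothing effect: the initial difference is assumed small in the sup norm only, yet after
    time 0 its slope is small too, since the equation bounds the derivative by the sup norm of the
    history. *)
Lemma clipped_curves_growthC (rho : {nonneg R}) (kap T : R) : 0 <= kap -> 0 <= T ->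
  exists2 c : R, 1 <= c & forall w y z (h : R),
  curve (clipped_field rho) w y -> curve (clipped_field rho) w z -> 0 <= h ->
  lip_on (- r%:num) T kap y -> lip_on (- r%:num) T kap z ->
  (forall s, - r%:num <= s <= 0 -> `|y s - z s| <= h) ->
  (forall s, - r%:num <= s <= T -> `|y s - z s| <= c * h) /\
  lip_on 0 T (c * h) (fun s => y s - z s).
Proof.
move=> kap0 T0; have [k k0 Gk] := clipped_field_lipschitz rho kap0.
pose c0 : R := 2 * (1 + k * T) * expR (2 * k * T).
have kT0 : 0 <= k * T by exact: mulr_ge0.
have c01 : 1 <= c0.
  have : 1 <= expR (2 * k * T) by rewrite -expR0 ler_expR -mulrA mulr_ge0.
  move=> e1; rewrite /c0 (@le_trans _ _ (2 * (1 + k * T)))//; first by lra.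
  by rewrite ler_peMr// mulr_ge0// addr_ge0.
(* Values are bounded by [c0 h] and slopes by [k c0 h]; the factor [1 + k] covers both. *)
exists (c0 * (1 + k)); first by rewrite (le_trans c01)// ler_peMr ?lerDl// (le_trans _ c01).
move=> w y z h [yc dy] [zc dz] h0 yk zk d1.
have dc : continuous (fun s => y s - z s) by move=> s; apply: cvgB; [exact: yc|exact: zc].
have dd (t : R) : 0 < t -> is_derive t 1 (fun s => y s - z s)
    (clipped_field rho (sigma t w) (segC r y t) - clipped_field rho (sigma t w) (segC r z t)).
  by move=> t0; apply: is_deriveB; [exact: dy|exact: dz].
have dB (t B : R) : 0 < t -> t < T -> 0 <= B ->
    (forall s : R, t - r%:num <= s <= t -> `|y s - z s| <= B) ->
    `|clipped_field rho (sigma t w) (segC r y t) - clipped_field rho (sigma t w) (segC r z t)|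
    <= k * B.
  move=> t0 tT B0 dB.
  have segk (v : R -> E) : continuous v -> lip_on (- r%:num) T kap v ->
      forall s u : R, `|segC r v t s - segC r v t u| <= kap * `|s - u|.
    move=> vc vk s u; rewrite !(segC_curve _ _ vc).
    have win a : - r%:num <= t + clamp r a <= T.
      have /andP[b1 b2] := @clamp_window _ r t a.
      by rewrite (le_trans b2 (ltW tT)) andbT (le_trans _ b1)// lerDr ltW.
    apply: le_trans (vk _ _ (win _) (win _)) _.
    by rewrite opprD addrACA subrr add0r ler_wpM2l// clamp_lip.
  apply: le_trans (Gk _ _ _ (segk _ yc yk) (segk _ zc zk)) _.
  by rewrite ler_wpM2l//; apply/segC_dist_leP.
have bd (t : R) : - r%:num <= t <= T -> `|y t - z t| <= c0 * h.
  move=> tT; have := @delay_gronwall R n (fun s => y s - z s) r%:num T h k 0 h0 k0 (lexx 0) T0 _ dc d1 _ t tT.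
  rewrite mul0r addr0 => /(_ (ltW _)) H.
  apply: le_trans (H _ _) _ => //.
    move=> u /andP[u0 uT]; exists (clipped_field rho (sigma u w) (segC r y u) - clipped_field rho (sigma u w) (segC r z u)).
      exact: dd.
    by move=> B B0 yzB; rewrite addr0; exact: dB u0 uT B0 yzB.
  by rewrite le_eqVlt; apply/orP; left; apply/eqP; rewrite /c0; ring.
have c0h : 0 <= c0 * h by rewrite mulr_ge0// (le_trans _ c01).
have c0k : 0 <= c0 * k by rewrite mulr_ge0// (le_trans _ c01).
have c0hle : c0 * h <= c0 * (1 + k) * h by rewrite ler_wpM2r// ler_peMr ?lerDl// (le_trans _ c01).
split; first by move=> s sT; exact: le_trans (bd _ sT) c0hle.
apply: (@lip_on_deriv _ _ _ _ _ _ _ dc (fun u u0 => dd u _)) => [|u /andP[u0 uT]].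
  by move=> u /andP[].
apply: le_trans (dB _ (c0 * h) u0 uT c0h _) _.
  move=> s /andP[us su]; apply: bd; apply/andP; split.
    by apply: le_trans us; rewrite lerDr ltW.
  exact: le_trans su (ltW uT).
rewrite mulrA ler_wpM2r// mulrC mulrDr mulr1 lerDr.
by rewrite (le_trans _ c01).
Qed.

Lemma clipped_curves_growth (rho : {nonneg R}) (kap T : R) : 0 <= kap -> 0 <= T ->
  exists2 c : R, 1 <= c & forall w y z (h : R),
  curve (clipped_field rho) w y -> curve (clipped_field rho) w z -> 0 <= h ->
  lip_on (- r%:num) T kap y -> lip_on (- r%:num) T kap z ->
  window_le (fun s => y s - z s) (- r%:num) 0 h ->
  window_le (fun s => y s - z s) (- r%:num) T (c * h).
Proof.
move=> kap0 T0; have [c c1 H] := clipped_curves_growthC rho kap0 T0.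
exists c => // w y z h cy cz h0 yk zk [d1 d2].
have [H1 H2] := H w y z h cy cz h0 yk zk d1; split=> //.
apply: (@lip_on_cat _ _ _ 0) => //.
by apply: lip_onW d2 => //; rewrite ler_peMl.
Qed.

(** * Uniqueness and gluing of solutions *)

Local Notation solves := (is_solution sigma F tau).

Lemma nondelayed_rhs w (y : R -> E) (t : R) :
  {within `[t - r%:num, t], continuous y} ->
  F (sigma t w) (y t) (y (t - tau (sigma t w) (segC r y t)))
  = delayed_field (sigma t w) (segC r y t).
Proof.
move=> yc; have I0 : I 0 by rewrite /= in_itv/= oppr_le0 lexx andbT.
by rewrite /delayed_field (segCE yc I0) (segCE yc (tauI _ _)) addr0.
Qed.

Lemma curve_is_solution w (x : W) (b : R) (y : R -> E) : 0 < b -> continuous y ->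
  (forall s, I s -> y s = x s) ->
  (forall t, 0 < t < b -> is_derive t 1 y (delayed_field (sigma t w) (segC r y t))) ->
  solves w x b y.
Proof.
move=> b0 yc yx dy; split=> //; first exact: continuous_subspaceT.
move=> t /andP[t0 tb]; rewrite nondelayed_rhs; last exact: continuous_subspaceT.
move: t0; rewrite le_eqVlt => /predU1P[<-|t0].
  apply: (@right_derivative_at0 _ _ y (fun t => delayed_field (sigma t w) (segC r y t)) _ b) => //.
    by move=> s /=; rewrite in_itv/= => /andP[].
  by apply: rhs_continuous => //; exact: field_continuous.
apply/has_deriv_within_interior; first by apply: nbhs_itvco; rewrite t0.
by apply: dy; rewrite t0.
Qed.

Lemma continuous_within_comp (A : set R) (y : R -> E) (p : R -> R) :
  {within A, continuous y} -> continuous p -> (forall s, A (p s)) -> continuous (y \o p).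
Proof.
move=> yc pc Ap s B /= nB.
have /subspace_continuousP/(_ (p s) (Ap s) B nB) := yc.
by move=> /(pc s); apply: (@filterS _ _ (nbhs_filter s)) => c /(_ (Ap c)).
Qed.

(** Freezing a solution outside [[- r, T]] with [T < b] gives a globally continuous curve with
    finite bounds [rho] and [kap], to which the Gronwall and history lemmas apply. *)
Lemma solution_restrict w (x : W) (b T : R) (y : R -> E) : solves w x b y ->
  0 <= T < b -> exists z, [/\ continuous z,
    forall s, - r%:num <= s <= T -> z s = y s,
    forall t, 0 < t < T -> is_derive t 1 z (delayed_field (sigma t w) (segC r z t)) &
    exists rho kap : R, [/\ 0 <= kap, forall s, `|z s| <= rho & lip_on (- r%:num) T kap z]].
Proof.
move=> [b0 yx yc dy] /andP[T0 Tb].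
have nr0 : - r%:num <= 0 by rewrite oppr_le0.
have rT : - r%:num <= T by rewrite (le_trans nr0).
pose p (s : R) := Num.max (- r%:num) (Num.min s T).
have pc : continuous p.
  move=> s; apply: (@continuous_max _ _ (cst (- r%:num)) (fun s => Num.min s T)).
    exact: cvg_cst.
  by apply: (@continuous_min _ _ (id : R -> R) (cst T)); [exact: cvg_id|exact: cvg_cst].
have p_in s : - r%:num <= p s <= T.
  by rewrite /p le_max lexx/= ge_max rT ge_min lexx orbT.
have p_id s : - r%:num <= s <= T -> p s = s.
  by move=> /andP[rs sT]; rewrite /p (min_idPl sT) (max_idPr rs).
pose z := y \o p.
have zc : continuous z.
  apply: (continuous_within_comp yc pc) => s /=; rewrite in_itv/=.
  by have /andP[-> /le_lt_trans->] := p_in s.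
have zy s : - r%:num <= s <= T -> z s = y s by move=> sT; rewrite /z /= p_id.
have seg_zy t : 0 <= t <= T -> segC r z t = segC r y t.
  move=> /andP[t0 tT]; congr insubd; apply/funext => s; rewrite zy//.
  have /andP[a c] := @clamp_window _ r t s.
  rewrite (le_trans c tT) andbT (le_trans _ a)//.
  by rewrite lerDr.
have dz t : 0 < t < T -> is_derive t 1 z (delayed_field (sigma t w) (segC r z t)).
  move=> /andP[t0 tT].
  have tb : 0 <= t < b by rewrite ltW//= (lt_trans tT).
  have := dy t tb; rewrite nondelayed_rhs; last first.
    apply: continuous_subspaceW yc => s /=; rewrite !in_itv/= => /andP[ts st].
    by rewrite (le_lt_trans st (lt_trans tT Tb)) andbT (le_trans _ ts)// lerDr ltW.
  move/has_deriv_within_interior => /(_ (nbhs_itvco _)) dyt.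
  rewrite seg_zy; last by rewrite !ltW.
  apply: (near_eq_is_derive _ (dyt _)); last by rewrite t0 (lt_trans tT).
  near=> s; rewrite zy//; apply/andP; split.
    apply: le_trans nr0 (ltW _); near: s; exact: lt_nbhsr.
  apply: ltW; near: s; exact: lt_nbhsl.
have [rho zrho] : exists rho : R, forall s, `|z s| <= rho.
  have nzc : continuous (fun s => `|z s|) by move=> s; apply: cvg_norm; exact: zc.
  have [c _ cmax] := EVT_max rT (continuous_subspaceT nzc).
  exists `|z c| => s; have -> : z s = z (p s) by rewrite /z /= (p_id (p s)).
  by apply: cmax; rewrite in_itv/=; exact: p_in.
have [M M0 GM] := field_bounded rho.
have [k k0 xk] := histW_lipP x.
exists z; split=> //; exists rho, (k + M); split=> //; first exact: addr_ge0.
apply: (@lip_on_cat _ _ _ 0) => //.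
  move=> s t sI tI; have [sT tT] : - r%:num <= s <= T /\ - r%:num <= t <= T.
    by move: sI tI => /andP[-> /le_trans->//] /andP[-> /le_trans->].
  have zx u : - r%:num <= u <= 0 -> - r%:num <= u <= T -> z u = x u.
    by move=> uI uT; rewrite zy// yx//= in_itv.
  rewrite (zx s)// (zx t)//.
  by rewrite (le_trans (xk s t))// ler_wpM2r// lerDl.
apply: (@lip_on_deriv _ _ _ _ _ _ _ zc dz) => u uT.
rewrite (le_trans (GM _ _ _)) ?lerDr// => s.
by rewrite (segC_curve _ _ zc).
Unshelve. all: by end_near. Qed.

(** Since the initial history is Lipschitz, both solutions are Lipschitz up to [T]; their histories
    share a Lipschitz ball, on which the field is Lipschitz, and Gronwall applies with zero data. *)
Lemma solution_unique w (x : W) (b1 b2 : R) (y1 y2 : R -> E) :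
  solves w x b1 y1 -> solves w x b2 y2 ->
  forall t, - r%:num <= t -> t < b1 -> t < b2 -> y1 t = y2 t.
Proof.
move=> s1 s2 t rt t1 t2; pose T : R := Num.max t 0.
have T0 : 0 <= T by rewrite le_max lexx orbT.
have tT : t <= T by rewrite le_max lexx.
have [b10 yx1 _ _] := s1; have [b20 yx2 _ _] := s2.
have [T1 T2] : 0 <= T < b1 /\ 0 <= T < b2 by rewrite T0 !gt_max t1 t2 b10 b20.
have [z1 [z1c zy1 dz1 [rho1 [kap1 [kap10 zr1 zk1]]]]] := solution_restrict s1 T1.
have [z2 [z2c zy2 dz2 [rho2 [kap2 [kap20 zr2 zk2]]]]] := solution_restrict s2 T2.
rewrite -zy1 ?rt// -zy2 ?rt//; apply/eqP; rewrite -subr_eq0 -normr_le0.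
have kap0 : 0 <= kap1 + kap2 by exact: addr_ge0.
have [k k0 Gk] := field_lipschitz (Num.max rho1 rho2) kap0.
have dc : continuous (fun s => z1 s - z2 s) by move=> s; apply: cvgB; [exact: z1c|exact: z2c].
have win u : 0 < u < T -> - r%:num <= u - r%:num /\ u <= T.
  by move=> /andP[u0 uT]; rewrite lerDr !ltW.
have := @delay_gronwall R n (fun s => z1 s - z2 s) r%:num T 0 k 0 (lexx 0) k0 (lexx 0) T0 _ dc _ _ t _.
rewrite !mul0r addr0 mulr0 mul0r; apply => //.
- move=> s /andP[rs s0]; have sT : - r%:num <= s <= T by rewrite rs (le_trans s0).
  by rewrite zy1// zy2// yx1 ?yx2 ?subrr ?normr0//= in_itv/= rs.
- move=> u uT; have [wa wb] := win u uT.
  exists (delayed_field (sigma u w) (segC r z1 u) - delayed_field (sigma u w) (segC r z2 u)).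
    by apply: is_deriveB; [exact: dz1|exact: dz2].
  move=> B B0 dB; rewrite addr0.
  have b1' : lip_ball (Num.max rho1 rho2) (kap1 + kap2) (segC r z1 u).
    apply: (segC_lip_ball z1c) => //; first by move=> s _; rewrite le_max zr1.
    by apply: (lip_onW wa wb _ zk1); rewrite lerDl.
  have b2' : lip_ball (Num.max rho1 rho2) (kap1 + kap2) (segC r z2 u).
    apply: (segC_lip_ball z2c) => //; first by move=> s _; rewrite le_max zr2 orbT.
    by apply: (lip_onW wa wb _ zk2); rewrite lerDr.
  apply: le_trans (Gk _ _ _ b1' b2') _.
  by rewrite ler_wpM2l//; apply/segC_dist_leP.
- by rewrite rt.
Qed.

Lemma solutionE w (x : W) (b : R) (y : R -> E) (t : R) : solves w x b y ->
  - r%:num <= t -> t < b -> solution sigma F tau (w, x) t = y t.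
Proof.
move=> sy rt tb; rewrite /solution; case: xgetP => [v _ [b' [y' [sy' tb' ->]]]|H].
  exact: (solution_unique sy' sy rt tb' tb).
by exfalso; apply: (H (y t)); exists b, y.
Qed.

Definition global_solution w (x : W) (y : R -> E) : Prop :=
  curve delayed_field w y /\ forall s, I s -> y s = x s.

Lemma global_is_solution w (x : W) (y : R -> E) (b : R) : 0 < b ->
  global_solution w x y -> solves w x b y.
Proof.
move=> b0 [[yc dy] yx]; apply: curve_is_solution => // t /andP[t0 _]; exact: dy.
Qed.

Lemma global_solutionE w (x : W) (y : R -> E) (t : R) : global_solution w x y ->
  - r%:num <= t -> solution sigma F tau (w, x) t = y t.
Proof.
move=> gy rt; apply: (@solutionE w x (`|t| + 1) y) => //.
  by apply: global_is_solution => //; rewrite ltr_wpDl.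
by rewrite (le_lt_trans (ler_norm t))// ltrDl.
Qed.

Lemma global_lifespan w (x : W) (y : R -> E) : global_solution w x y ->
  lifespan sigma F tau (w, x) = +oo%E.
Proof.
move=> gy; apply/eqyP => A A0; apply: ereal_sup_ubound.
by exists A => //; exists y; exact: global_is_solution.
Qed.

Lemma global_state w (x : W) (y : R -> E) (t : R) : global_solution w x y -> 0 <= t ->
  state sigma F tau t (w, x) = segW r y t.
Proof.
move=> gy t0; rewrite /state /segW; congr insubd; congr insubd; apply/funext => s.
apply: global_solutionE => //; have /andP[a _] := @clamp_window _ r t s.
by rewrite (le_trans _ a)// lerDr.
Qed.

Lemma lifespan_global w (x : W) : lifespan sigma F tau (w, x) = +oo%E ->
  exists y, global_solution w x y.
Proof.
move=> lifeE.
have ex_sol (T : R) : exists b y, T < b /\ solves w x b y.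
  have : (T%:E < lifespan sigma F tau (w, x))%E by rewrite lifeE ltry.
  move=> /ereal_sup_gt[_ [b [y sy] <-]]; rewrite lte_fin => Tb.
  by exists b, y.
have ex_curve (T : R) : 0 < T -> exists z, [/\ continuous z,
    forall s, - r%:num <= s <= T -> z s = solution sigma F tau (w, x) s,
    forall s, I s -> z s = x s
  & forall t, 0 < t < T -> is_derive t 1 z (delayed_field (sigma t w) (segC r z t))].
  move=> T0; have [b [y [Tb sy]]] := ex_sol T.
  have [|z [zc zy dz _]] := @solution_restrict w x b T y sy; first by rewrite ltW.
  exists z; split=> // s.
    by move=> /andP[rs sT]; rewrite zy ?rs// (solutionE sy rs (le_lt_trans sT Tb)).
  rewrite /= in_itv/= => /andP[rs s0]; have [_ yx _ _] := sy.
  by rewrite zy ?rs ?(le_trans s0 (ltW T0))// yx//= in_itv/= rs.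
(* Before [- r] the value of [solution] is an arbitrary choice; extending constantly to the left
   makes [y] continuous. *)
pose y (t : R) := solution sigma F tau (w, x) (Num.max (- r%:num) t).
have near_curve (z : R -> E) (T t : R) :
    (forall s, - r%:num <= s <= T -> z s = solution sigma F tau (w, x) s) ->
    - r%:num <= t <= T -> y t = z t.
  by move=> zs /andP[rt tT]; rewrite /y (max_idPr rt) zs// rt.
have yx s : s <= 0 -> y s = x s.
  move=> s0; have [z [zc zs zx _]] := ex_curve 1 ltr01.
  have m0 : Num.max (- r%:num) s <= 0 by rewrite ge_max oppr_le0 s0 andbT.
  rewrite /y -zs; last by rewrite le_max lexx/= (le_trans m0).
  rewrite zx; last by rewrite /= in_itv/= le_max lexx.
  by rewrite [RHS]hist_clamp /clamp (min_idPl s0).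
have yc : continuous y.
  move=> t; have [z [zc zs zx _]] := ex_curve (`|t| + 1) (ltr_wpDl (normr_ge0 _) ltr01).
  have p_c : continuous (fun s : R => z (Num.max (- r%:num) s)).
    move=> s; apply: (@continuous_comp _ _ _ (fun s : R => Num.max (- r%:num) s) z); last exact: zc.
    by apply: (@continuous_max _ _ (cst (- r%:num)) (id : R -> R)); [exact: cvg_cst|exact: cvg_id].
  have yE : \forall s \near t, z (Num.max (- r%:num) s) = y s.
    near=> s; rewrite /y zs// le_max lexx/= ge_max; apply/andP; split.
      by rewrite (@le_trans _ _ 0) ?oppr_le0// addr_ge0.
    rewrite ltW//; near: s; apply: lt_nbhsl.
    by rewrite (le_lt_trans (ler_norm t))// ltrDl.
  apply: cvg_trans (_ : z (Num.max (- r%:num) s) @[s --> t] --> y t).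
    exact: near_eq_cvg.
  by rewrite -(nbhs_singleton yE); exact: p_c.
exists y; split; last by move=> s; rewrite /= in_itv/= => /andP[_ s0]; exact: yx.
split=> // t t0.
have [z [zc zs zx dz]] := ex_curve (t + 1) (ltr_pwDl t0 ler01).
have seg_yz : segC r y t = segC r z t.
  apply: segC_ext => // s /andP[ts st]; apply: (near_curve z (t + 1)) => //.
  by rewrite (le_trans st) ?lerDl// andbT (le_trans _ ts)// lerDr ltW.
rewrite seg_yz; have tt : 0 < t < t + 1 by rewrite t0 ltrDl ltr01.
apply: (near_eq_is_derive _ (dz t tt)); near=> s; apply/esym/(near_curve z (t + 1)) => //.
apply/andP; split.
  apply: (@le_trans _ _ 0); first by rewrite oppr_le0.
  apply: ltW; near: s; exact: lt_nbhsr.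
apply: ltW; near: s; apply: lt_nbhsl; by rewrite ltrDl.
Unshelve. all: by end_near. Qed.

Lemma global_shift w (x : W) (y : R -> E) (a : R) : global_solution w x y -> 0 <= a ->
  forall k : R, 0 <= k -> lip_on (a - r%:num) a k y ->
  global_solution (sigma a w) (segW r y a) (fun s => y (s + a)).
Proof.
move=> [cy yx] a0 k k0 yk; have yc := cy.1; split; first exact: curve_shift.
move=> s Is.
by rewrite (segW_hist yc k0 yk) (segC_in _ yc Is) addrC.
Qed.

Lemma global_lip w (x : W) (y : R -> E) (T : R) : global_solution w x y -> 0 <= T ->
  exists2 k : R, 0 <= k & lip_on (- r%:num) T k y.
Proof.
move=> gy T0; have sy := global_is_solution (ltr_pwDl ltr01 T0) gy.
have [|z [_ zy _ [_ [k [k0 _ zk]]]]] := solution_restrict sy (_ : 0 <= T < _).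
  by rewrite T0 ltrDr ltr01.
by exists k => // s t sT tT; rewrite -!zy//; exact: zk.
Qed.

Lemma I_dense_in_itself (s0 d : R) : I s0 -> 0 < d ->
  exists s, [/\ I s, s != s0 & `|s - s0| < d].
Proof.
rewrite /= in_itv/= => /andP[rs s0'] d0; have r0 : 0 < r%:num by [].
pose m : R := Num.min (d / 2) (r%:num / 2).
have m0 : 0 < m by rewrite lt_min !divr_gt0.
have md : m < d by rewrite (@le_lt_trans _ _ (d / 2)) ?ge_min ?lexx// ltr_pdivrMr// ltr_pMr// ltr1n.
have mr : m <= r%:num / 2 by rewrite ge_min lexx orbT.
have [sr|sr] := leP s0 (- (r%:num / 2)).
  exists (s0 + m); split; first by rewrite /= in_itv/=; apply/andP; split; lra.
    by rewrite -subr_eq0 addrC addKr gt_eqF.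
  by rewrite addrC addKr gtr0_norm.
exists (s0 - m); split; first by rewrite /= in_itv/=; apply/andP; split; lra.
  by rewrite -subr_eq0 addrC addKr oppr_eq0 gt_eqF.
by rewrite addrC addKr normrN gtr0_norm.
Qed.

Lemma strict_deriv_within (x : R -> E) (s0 : R) (c : E) : I s0 ->
  (forall e : R, 0 < e -> exists2 d : R, 0 < d & forall s t : R, I s -> I t ->
    `|s - s0| < d -> `|t - s0| < d -> `|x s - x t - (s - t) *: c| <= e * `|s - t|) ->
  deriv_within I x s0 = c.
Proof.
move=> Is0 xc.
have PF : ProperFilter (within [set h | I (h + s0)] (0 : R)^').
  apply: Build_ProperFilter_ex => B; rewrite /within/= => -[d /= d0 dB].
  have [s [Is ss0 sd]] := I_dense_in_itself Is0 d0.
  exists (s - s0); apply: dB; rewrite ?subr_eq0 ?subrK//.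
  by rewrite /ball/= sub0r normrN.
apply: cvg_lim => //; apply/cvgrPdist_le => e e0.
have [d d0 dx] := xc _ e0; rewrite near_withinE; near=> h => Ih.
have h0 : h != 0 by near: h; exact: nbhs_dnbhs_neq.
have hd : `|h| < d by near: h; exact: dnbhs0_lt.
have := dx _ _ Ih Is0; rewrite addrK subrr normr0 => /(_ hd d0) H.
rewrite distrC.
have -> : h^-1 *: (x (h + s0) - x s0) - c = h^-1 *: (x (h + s0) - x s0 - h *: c).
  by rewrite [RHS]scalerBr scalerA mulVf// scale1r.
by rewrite normrZ normfV ler_pdivrMl ?normr_gt0// mulrC.
Unshelve. all: by end_near. Qed.

(** * The invariant set *)

Variable K : set (Omega * W).
Hypothesis K_invariant : pos_invariant sigma F tau K.
Hypothesis K_compact : compact K.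
Hypothesis K_backward : forall p, K p -> backward_extension sigma F tau K p.

Lemma K_bounded : exists rho : {nonneg R}, forall w x, K (w, x) -> `|x| <= rho%:num.
Proof.
have /compact_near_coveringP/(_ R +oo%R (fun M p => `|p.2| <= M) _) H := K_compact.
have [|M [_ MK]] := H.
  move=> p Kp; near=> q M.
  have qp : `|p.2 - q.2| <= 1.
    near: q; have /cvgrPdist_le : (q : Omega * W).2 @[q --> p] --> p.2 by exact: cvg_snd.
    by apply.
  have pM : 1 + `|p.2| <= M by near: M; apply: nbhs_pinfty_ge; rewrite num_real.
  apply: le_trans pM; rewrite -[q.2](subrK p.2) (le_trans (ler_normD _ _))//.
  by rewrite lerD2r distrC.
have M0 : 0 <= `|M| + 1 by rewrite addr_ge0.
exists (NngNum M0) => w x Kwx; apply: (MK (`|M| + 1) _ (w, x)) => //.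
by rewrite (le_lt_trans (ler_norm _))// ltrDl.
Unshelve. all: by end_near. Qed.

Lemma K_global w x : K (w, x) -> exists y, global_solution w x y.
Proof. by move=> /K_invariant[lifeE _]; exact: lifespan_global. Qed.

Lemma K_segW w x y (t : R) : K (w, x) -> global_solution w x y -> 0 <= t ->
  K (sigma t w, segW r y t).
Proof.
move=> Kp gy t0; have [_ /(_ t t0)] := K_invariant Kp.
by rewrite /skew_product (global_state gy t0).
Qed.

(** A value of [y] at a positive time is the value at 0 of a history in [K], hence bounded by [rho];
    the equation then bounds the derivative. *)
Lemma K_curve_bounds : exists (rho : {nonneg R}) (kap : R), [/\ rho%:num <= kap &
  forall w x y, K (w, x) -> global_solution w x y ->
    (forall s, - r%:num <= s -> `|y s| <= rho%:num) /\
    forall T, 0 <= T -> lip_on (- r%:num) T kap y].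
Proof.
have [rho Krho] := K_bounded; have [M M0 GM] := field_bounded rho%:num.
exists rho, (Num.max rho%:num M); split; first by rewrite le_max lexx.
move=> w x y Kp gy; have yc := gy.1.1.
have yrho s : - r%:num <= s -> `|y s| <= rho%:num.
  move=> rs; have [s0|s0] := leP s 0.
    have Is : I s by rewrite /= in_itv/= rs.
    by rewrite gy.2// (le_trans (histW_norm_ub _ _))// (Krho w).
  have [k k0 yk] := global_lip gy (ltW s0).
  have ykw : lip_on (s - r%:num) s k y by apply: lip_onW yk => //; rewrite lerDr ltW.
  have I0 : I 0 by rewrite /= in_itv/= oppr_le0 lexx andbT.
  have -> : y s = (segW r y s : C) 0.
    by rewrite (segW_hist yc k0 ykw) (segC_in _ yc I0) addr0.
  apply: le_trans (histW_norm_ub (segW r y s) 0) _.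
  exact: Krho (K_segW Kp gy (ltW s0)).
split=> // T T0; apply: (@lip_on_cat _ _ _ 0) => //.
  move=> s t sI tI; rewrite !gy.2 ?in_itv//= (le_trans (histW_norm_lip _ _ _))//.
  by rewrite ler_wpM2r// le_max (Krho w).
apply: (@lip_on_deriv _ _ _ _ _ _ _ yc (fun u u0 => gy.1.2 u _)) => [u /andP[]//|u /andP[u0 _]].
rewrite (le_trans (GM _ _ _)) ?le_max ?lexx ?orbT// => s.
rewrite (segC_curve _ _ yc) yrho//; have /andP[a _] := @clamp_window _ r u s.
by rewrite (le_trans _ a)// lerDr ltW.
Qed.

(** Going back by exactly one delay exhibits the whole history [x] as a stretch of a solution,
    whence its regularity. *)
Lemma K_past w x : K (w, x) -> exists w' x' y, [/\ K (w', x'), global_solution w' x' y,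
  w = sigma r%:num w' & x = segW r y r%:num].
Proof.
move=> /K_backward[theta [_ Ktheta theta0 thetaE]].
have nr0 : - r%:num <= 0 by rewrite oppr_le0.
have r0 : 0 <= r%:num by [].
have := thetaE (- r%:num) r%:num r0 (lexx _); rewrite subrr theta0.
have := Ktheta _ nr0; case: (theta _) => w' x' Kp.
have [y gy] := K_global Kp.
rewrite /skew_product (global_state gy)// => -[<- <-].
by exists w', x', y.
Qed.

(** On the interior of [I] the history has the derivative [g], which is continuous up to the end
    points. The mean value inequality for [y (u + r) - u *: g s0] then gives strict
    differentiability, end points included. *)
Lemma K_strict_deriv w x (s0 : R) : K (w, x) -> I s0 -> forall e : R, 0 < e ->
  exists2 d : R, 0 < d & forall s t : R, I s -> I t -> `|s - s0| < d -> `|t - s0| < d ->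
    `|x s - x t - (s - t) *: deriv_within I x s0| <= e * `|s - t|.
Proof.
move=> /K_past[w' [x' [y [Kp gy _ ->]]]] Is0.
have r0 : 0 <= r%:num by [].
have yc := gy.1.1; have [k k0 yk] := global_lip gy r0.
have xE s : I s -> (segW r y r%:num : W) s = y (s + r%:num).
  move=> Is; rewrite (segW_hist yc k0); first by rewrite (segC_in _ yc Is) addrC.
  by apply: lip_onW yk => //; rewrite subrr oppr_le0.
pose g (s : R) := delayed_field (sigma (s + r%:num) w') (segC r y (s + r%:num)).
have gc : continuous g.
  move=> s; apply: (@continuous_comp _ _ _ (fun s : R => s + r%:num)
    (fun s => delayed_field (sigma s w') (segC r y s))).
    by apply: cvgD; [exact: cvg_id|exact: cvg_cst].
  by apply: rhs_continuous => //; exact: field_continuous.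
have strict e : 0 < e -> exists2 d : R, 0 < d & forall s t : R, I s -> I t ->
    `|s - s0| < d -> `|t - s0| < d ->
    `|(segW r y r%:num : W) s - (segW r y r%:num : W) t - (s - t) *: g s0| <= e * `|s - t|.
  move=> e0; have /cvgrPdist_le/(_ _ e0)/nbhs_ballP[d /= d0 dg] := gc s0.
  exists d => // s t Is It sd td; rewrite !xE//.
  have vc : continuous (fun u => y (u + r%:num) - u *: g s0).
    move=> u; apply: cvgB; first exact: shift_continuous.
    by apply: cvgZl; exact: cvg_id.
  have dv u : - r%:num < u -> is_derive u 1 (fun u => y (u + r%:num) - u *: g s0) (g u - g s0).
    move=> ru; apply: is_deriveB; last exact: is_derive_scalel.
    by apply: is_derive_shift; apply: gy.1.2; rewrite -ltrBlDr sub0r.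
  have H (a b : R) : I a -> a <= b -> `|a - s0| < d -> `|b - s0| < d ->
      `|(y (b + r%:num) - b *: g s0) - (y (a + r%:num) - a *: g s0)| <= e * (b - a).
    move=> Ia ab ad bd; have ra : - r%:num <= a by move: Ia; rewrite /= in_itv/= => /andP[].
    apply: (@derive_le_lipschitz R n _ _ e a b ab vc) => u /andP[au ub].
      by apply: dv; exact: le_lt_trans au.
    rewrite distrC; apply: dg; rewrite /ball/= distrC.
    move: ad bd; rewrite !ltr_norml; move=> /andP[a1 a2] /andP[b1 b2].
    by apply/andP; split; lra.
  have E (a b : R) : y (b + r%:num) - b *: g s0 - (y (a + r%:num) - a *: g s0)
      = y (b + r%:num) - y (a + r%:num) - (b - a) *: g s0.
    by rewrite scalerBl !opprB addrACA [RHS]addrACA (addrC (- (b *: _))).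
  have [st|/ltW ts] := leP s t.
    rewrite -normrN (distrC s) (ger0_norm (_ : 0 <= t - s)) ?subr_ge0//.
    by rewrite -E opprB H.
  by rewrite (ger0_norm (_ : 0 <= s - t)) ?subr_ge0// -E H.
have -> : deriv_within I (segW r y r%:num : W) s0 = g s0 by exact: strict_deriv_within.
exact: strict.
Qed.

(** * Uniform strict differentiability and the linearization over [K] *)

Lemma K_strict_diff q (e : R) : K q -> 0 < e ->
  exists2 d : R, 0 < d & strict_linear_approx q e d.
Proof.
case: q => w x Kq e0; apply: field_strict_diff => // e' e'0.
have [d d0 dP] := K_strict_deriv Kq (tauI w x) e'0.
by exists d => // s t Is It sd td; apply: dP => //; rewrite opprK.
Qed.

(** Both linear maps approximate the same increment of the field, from [q.2] to [q.2 + h *: v] with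
    [h] small enough for both balls; by homogeneity [h] cancels. *)
Lemma linearization_close q0 q (e d d' e' : R) : 0 < d' ->
  strict_linear_approx q0 e d -> strict_linear_approx q e' d' -> ball q0 d q ->
  forall v : W, `|lin q v - lin q0 v| <= (e + e') * `|v|.
Proof.
move=> d'0 H0 H [/= bw]; rewrite -ball_normE /= => bx v.
pose m : R := Num.min d' (d - `|q0.2 - q.2|).
have m0 : 0 < m by rewrite lt_min d'0 subr_gt0.
pose h : R := m / (`|v| + 1).
have v1 : 0 < `|v| + 1 by rewrite ltr_wpDl.
have h0 : 0 < h by rewrite divr_gt0.
have hv : `|h *: v| < m.
  by rewrite normrZ gtr0_norm// /h mulrAC ltr_pdivrMr// ltr_pM2l// ltrDl.
have hv_d' : `|h *: v| < d' by rewrite (lt_le_trans hv)// ge_min lexx.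
have hv_d : `|q0.2 - q.2| + `|h *: v| < d.
  by rewrite addrC -ltrBrDr (lt_le_trans hv)// ge_min lexx orbT.
have b1 : ball q0 d (q.1, q.2 + h *: v).
  split=> //=; rewrite -ball_normE /=.
  by rewrite opprD addrA (le_lt_trans (ler_normB _ _)).
have b2 : ball q0 d (q.1, q.2).
  by split=> //=; rewrite -ball_normE.
have d0 : ball q d' (q.1, q.2).
  by split=> /=; exact: ballxx.
have b3 : ball q d' (q.1, q.2 + h *: v).
  split=> /=; first exact: ballxx.
  by rewrite -ball_normE /= opprD addrA subrr add0r normrN.
have := H0 _ _ _ b1 b2; have := H _ _ _ b3 d0.
rewrite (addrC q.2) addrK.
have linZ p : lin p (h *: v : W) = h *: lin p v by exact: linearizationZ.
rewrite !linZ.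
set G := delayed_field _ _ - _; set a := _ *: _; set b := _ *: lin q0 _ => Ha Hb.
have : `|a - b| <= (e + e') * (h * `|v|).
  rewrite -(subrKA G) (le_trans (ler_normD _ _))// addrC mulrDl -(gtr0_norm h0) -normrZ.
  by rewrite lerD// distrC.
rewrite /a /b -scalerBr normrZ gtr0_norm// mulrCA ler_pM2l//.
Qed.

Lemma K_uniform_strict_diff (e : R) : 0 < e ->
  exists2 d : R, 0 < d & forall q, K q -> strict_linear_approx q e d.
Proof.
move=> e0; have e30 : 0 < e / 3 by rewrite divr_gt0.
have /compact_near_coveringP/near_covering_withinP := K_compact.
move=> /(_ R (0 : R)^'+ (fun d q => strict_linear_approx q e d) _) H.
have [|d0 /= d00 dP] := H.
  move=> q0 Kq0; have [d d0 dq0] := K_strict_diff Kq0 e30.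
  have d20 : 0 < d / 2 by rewrite divr_gt0.
  near=> q d1.
  have q0q : ball q0 (d / 2) q by near: q; exact: nbhsx_ballx.
  have d1d : d1 <= d / 2 by near: d1; exact: nbhs_right_le.
  (* The radius [d'] depends on [q] without a uniform lower bound. It serves only to compare the
     linear maps at [q] and [q0]; the field itself is approximated with the radius [d] of [q0]. *)
  move=> Kq /=; have [d' d'0 dq] := K_strict_diff Kq e30.
  have close := linearization_close d'0 dq0 dq (le_ball (_ : d / 2 <= d) q0q).
  have d2d : d / 2 <= d by rewrite ler_pdivrMr// ler_pMr// ler1n.
  move=> w x y bx by_.
  have sub p : ball q d1 p -> ball q0 d p.
    by move=> /(le_ball d1d) qp; rewrite (splitr d); exact: ball_triangle q0q qp.
  have := dq0 _ _ _ (sub _ bx) (sub _ by_); have := close d2d (x - y).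
  set G := delayed_field _ _ - _; set a := lin q _; set b := lin q0 _ => Ha Hb.
  rewrite -(subrKA b) (le_trans (ler_normD _ _))//.
  rewrite distrC in Ha; apply: (le_trans (lerD Hb Ha)).
  rewrite -mulrDl ler_wpM2r//; lra.
exists (d0 / 2); first by rewrite divr_gt0.
apply: dP; rewrite ?divr_gt0//= sub0r normrN gtr0_norm ?divr_gt0//.
by rewrite ltr_pdivrMr// ltr_pMr// ltr1n.
Unshelve. all: by end_near. Qed.

Lemma K_linearization_continuous (e : R) : 0 < e -> exists2 d : R, 0 < d &
  forall q0 q, K q0 -> K q -> ball q0 d q -> forall v : W, `|lin q v - lin q0 v| <= e * `|v|.
Proof.
move=> e0; have e20 : 0 < e / 2 by rewrite divr_gt0.
have [d d0 dK] := K_uniform_strict_diff e20; exists d => // q0 q Kq0 Kq qq0 v.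
by have := linearization_close d0 (dK _ Kq0) (dK _ Kq) qq0 v; rewrite -splitr.
Qed.

Lemma K_deriv_bounded (rho : R) w x (s0 : R) : K (w, x) -> `|x| <= rho -> I s0 ->
  `|deriv_within I x s0| <= rho + 1.
Proof.
move=> Kp xr Is0; have [d d0 dP] := K_strict_deriv Kp Is0 ltr01.
have [s [Is ss0 sd]] := I_dense_in_itself Is0 d0.
have ss : 0 < `|s - s0| by rewrite normr_gt0 subr_eq0.
have := dP s s0 Is Is0 sd; rewrite subrr normr0 mul1r => /(_ d0) H.
rewrite -(ler_pM2l ss) -normrZ.
have := histW_norm_lip x s s0 => Hx.
have -> : (s - s0) *: deriv_within I x s0
    = (x s - x s0) - (x s - x s0 - (s - s0) *: deriv_within I x s0).
  by rewrite subKr.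
rewrite (le_trans (ler_normB _ _))// mulrDr mulr1 lerD//.
by rewrite (le_trans Hx)// mulrC ler_wpM2l.
Qed.

(** This bound is for the sup norm, as Gronwall estimates require, whereas the continuity in [q]
    above is for vectors of [W], whose values at a moving delay are controlled. *)
Lemma K_linearization_bounded : exists2 L : R, 0 <= L &
  forall q v, K q -> `|lin q v| <= L * `|v|.
Proof.
have [rho Krho] := K_bounded; have [k k0 dFk] := dF_bounded rho%:num.
have [_ dtau _ _] := tau_H2.
have cA : compact ([set: Omega] `*` @lip_ball R r n rho%:num rho%:num).
  by apply: compact_setX => //; exact: lip_ball_compact.
have [l l0 Hl] := op_compact_bound D2tau_near (fun q => diff_bounded (dtau q.1 q.2)) cA.
exists (k + (k + l * (k * (rho%:num + 1)))).
  by rewrite !addr_ge0// !mulr_ge0// addr_ge0.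
move=> [w x] v Kq; have xr := Krho _ _ Kq.
have xs s : `|x s| <= rho%:num by rewrite (le_trans (histW_norm_ub _ _)).
have dF u := dFk w (x 0) (x (- tau w x)) (xs _) (xs _) u.
rewrite /linearization (le_trans (ler_normB _ _))// !mulrDl addrA lerD//.
  rewrite (le_trans (ler_normD _ _))// lerD//.
    by have [H _] := dF (v 0); rewrite (le_trans H)// ler_wpM2l// hist_norm_ub.
  by have [_ H] := dF (v (- tau w x)); rewrite (le_trans H)// ler_wpM2l// hist_norm_ub.
rewrite normrZ mulrAC ler_pM//.
  apply: (Hl (w, x : C)); split=> //; split=> [s|s t]; first exact: xs.
  by rewrite (le_trans (histW_norm_lip _ _ _))// ler_wpM2r.
have [_ H] := dF (deriv_within I x (- tau w x)); rewrite (le_trans H)// ler_wpM2l//.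
exact: K_deriv_bounded Kq xr (tauI _ _).
Qed.

Lemma global_unique w (x : W) y z (t : R) : global_solution w x y -> global_solution w x z ->
  - r%:num <= t -> y t = z t.
Proof. by move=> gy gz rt; rewrite -(global_solutionE gy rt) (global_solutionE gz rt). Qed.

Lemma segC_near (g : R -> E) (t0 e : R) : continuous g -> 0 < e ->
  \forall t \near t0, forall s, I s -> `|g (s + t) - g (s + t0)| <= e.
Proof.
move=> gc e0; have /cvgrPdist_le/(_ _ e0) := @segC_continuous R r n g gc t0.
apply: filterS => t te s Is.
rewrite ![s + _]addrC -!(segC_in _ gc Is) distrC.
exact: le_trans (hist_norm_ub (segC r g t0 - segC r g t) s) te.
Qed.

(** Translation is not continuous in W^{1,oo} for arbitrary Lipschitz curves. Here the derivative is
    continuous on the whole window, because the curve is prolonged into the past by one delay. *)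
Lemma K_state_near w x y (t0 e : R) : K (w, x) -> global_solution w x y -> 0 <= t0 -> 0 < e ->
  \forall t \near t0, 0 <= t ->
    window_le (fun s => y (s + t) - y (s + t0)) (- r%:num) 0 e.
Proof.
move=> /K_past[w' [x' [u [Kp gu -> ->]]]] gy t00 e0.
have uc := gu.1.1; have r0 : 0 <= r%:num by [].
have [k k0 uk] := global_lip gu r0.
have uk' : lip_on (r%:num - r%:num) r%:num k u.
  by apply: lip_onW uk => //; rewrite subrr oppr_le0.
have gu' := global_shift gu r0 k0 uk'.
pose g (s : R) := delayed_field (sigma s w') (segC r u s).
have gc : continuous g by apply: rhs_continuous => //; exact: field_continuous.
have N1 := segC_near (t0 + r%:num) uc e0; have N2 := segC_near (t0 + r%:num) gc e0.
have sh : (t + r%:num) @[t --> t0] --> t0 + r%:num.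
  by apply: cvgD; [exact: cvg_id|exact: cvg_cst].
near=> t => t_ge0.
have M1 : forall s, I s -> `|u (s + (t + r%:num)) - u (s + (t0 + r%:num))| <= e.
  by near: t; exact: (sh _ N1).
have M2 : forall s, I s -> `|g (s + (t + r%:num)) - g (s + (t0 + r%:num))| <= e.
  by near: t; exact: (sh _ N2).
have yu s a : - r%:num <= s -> 0 <= a -> y (s + a) = u (s + (a + r%:num)).
  move=> rs a0; rewrite (global_unique gy gu') ?addrA//.
  by rewrite (le_trans rs)// lerDl.
split=> [s sI|]; first by move: (sI) => /andP[rs _]; rewrite !yu// M1//= in_itv.
have dc a : continuous (fun s => u (s + a)) by exact: shift_continuous.
have vc : continuous (fun s => u (s + (t + r%:num)) - u (s + (t0 + r%:num))).
  by move=> s; apply: cvgB; exact: dc.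
have du a s : 0 <= a -> - r%:num < s -> is_derive s 1 (fun s => u (s + (a + r%:num))) (g (s + (a + r%:num))).
  move=> a0 rs; apply: is_derive_shift; apply: gu.1.2.
  by rewrite addrCA ltr_wpDl// -ltrBlDr sub0r.
have H : lip_on (- r%:num) 0 e (fun s => u (s + (t + r%:num)) - u (s + (t0 + r%:num))).
  apply: (@lip_on_deriv _ _ _ _ _ _ (fun s => g (s + (t + r%:num)) - g (s + (t0 + r%:num))) vc).
    by move=> s /andP[rs _]; apply: is_deriveB; exact: du.
  by move=> s /andP[rs s0]; apply: M2; rewrite /= in_itv/= !ltW.
move=> s s' sI s'I; move: (sI) (s'I) => /andP[rs _] /andP[rs' _].
by rewrite !yu//; exact: H.
Unshelve. all: by end_near. Qed.

Lemma segW_window (y z : R -> E) (t u k e : R) : continuous y -> continuous z ->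
  0 <= k -> 0 <= e -> lip_on (t - r%:num) t k y -> lip_on (u - r%:num) u k z ->
  window_le (fun s => y (s + t) - z (s + u)) (- r%:num) 0 e ->
  `|segW r y t - segW r z u| <= e.
Proof.
move=> yc zc k0 e0 yk zk yz.
have shiftE (v : R -> E) a : continuous v -> segW r v a = segW r (fun s => v (s + a)) 0.
  by move=> vc; rewrite /segW segC_shift// add0r.
have shift_lip (v : R -> E) a : lip_on (a - r%:num) a k v ->
    lip_on (0 - r%:num) 0 k (fun s => v (s + a)).
  move=> vk s s' /andP[s1 s2] /andP[s'1 s'2].
  have win b : 0 - r%:num <= b -> b <= 0 -> a - r%:num <= b + a <= a.
    by move=> b1 b2; apply/andP; split; lra.
  rewrite (le_trans (vk _ _ (win _ s1 s2) (win _ s'1 s'2)))//.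
  by rewrite opprD addrACA subrr addr0.
rewrite (shiftE y t yc) (shiftE z u zc).
apply/(segW_dist_leP (shift_continuous yc) (shift_continuous zc) e0 k0
  (shift_lip _ _ yk) (shift_lip _ _ zk)).
by rewrite sub0r.
Qed.

Lemma K_segW_near w x y (t0 e : R) : K (w, x) -> global_solution w x y -> 0 <= t0 -> 0 < e ->
  \forall t \near t0, 0 <= t -> `|segW r y t - segW r y t0| <= e.
Proof.
move=> Kp gy t00 e0; have yc := gy.1.1.
have [rho [kap [rk Kb]]] := K_curve_bounds.
have [_ yk] := Kb _ _ _ Kp gy; have kap0 : 0 <= kap by exact: le_trans rk.
have := K_state_near Kp gy t00 e0; apply: filterS => t H t0'.
have win a : 0 <= a -> lip_on (a - r%:num) a kap y.
  by move=> a0; apply: lip_onW (yk _ a0) => //; rewrite lerDr.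
exact: (segW_window yc yc kap0 (ltW e0) (win _ t0') (win _ t00) (H t0')).
Qed.

Lemma orbit_near (w0 : Omega) (T e : R) : 0 < e ->
  \forall w \near w0, forall t, 0 <= t <= T -> ball (sigma t w0) e (sigma t w).
Proof.
move=> e0; have /compact_near_coveringP := @segment_compact R 0 T.
move=> /(_ Omega (nbhs w0) (fun w t => ball (sigma t w0) e (sigma t w)) _) H.
have {H} : \forall w \near w0, `[0, T]%classic `<=` (fun t => ball (sigma t w0) e (sigma t w)).
  apply: H => t0 _; have e20 : 0 < e / 2 by rewrite divr_gt0.
  have N1 : \forall p \near (t0, w0), ball (sigma t0 w0) (e / 2) (sigma p.1 p.2).
    exact: (flow_continuous (nbhsx_ballx _ _ e20)).
  have N2 : \forall p \near (t0, w0), ball (sigma t0 w0) (e / 2) (sigma p.1 w0).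
    have := @cvg_fst _ _ (nbhs t0) (nbhs w0) _ _ (flow_orbit_continuous (nbhsx_ballx _ _ e20)).
    exact.
  near=> p; rewrite (splitr e); apply: (@ball_triangle _ _ (sigma t0 w0)).
    by apply: ball_sym; near: p.
  by near: p.
by apply: filterS => w wH t tT; apply: wH; rewrite /= in_itv.
Unshelve. all: by end_near. Qed.

Lemma field_orbit_near (w0 : Omega) (y : R -> E) (T e : R) : continuous y -> 0 < e ->
  \forall w \near w0, forall t, 0 <= t <= T ->
    `|delayed_field (sigma t w) (segC r y t) - delayed_field (sigma t w0) (segC r y t)| <= e.
Proof.
move=> yc e0; have /compact_near_coveringP := @segment_compact R 0 T.
pose G (t : R) w := delayed_field (sigma t w) (segC r y t).
move=> /(_ Omega (nbhs w0) (fun w t => `|G t w - G t w0| <= e) _) H.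
have {H} : \forall w \near w0, `[0, T]%classic `<=` (fun t => `|G t w - G t w0| <= e).
  apply: H => t0 _; have e20 : 0 < e / 2 by rewrite divr_gt0.
  have Gc : {for (t0, w0), continuous (fun p : R * Omega => G p.1 p.2)}.
    apply: (@continuous_comp _ _ _ (fun p : R * Omega => (sigma p.1 p.2, segC r y p.1 : C))
      (fun q : Omega * C => delayed_field q.1 q.2)); last exact: field_continuous.
    apply: continuous_pair; first exact: flow_continuous.
    apply: (@continuous_comp _ _ _ (fst : R * Omega -> R) (fun t => segC r y t : C)).
      exact: cvg_fst.
    exact: segC_continuous.
  have G0c : {for t0, continuous (fun t => G t w0)}.
    exact: (@rhs_continuous delayed_field w0 y field_continuous yc t0).
  have N1 : \forall p \near (t0, w0), `|G t0 w0 - G p.1 p.2| <= e / 2.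
    by have /cvgrPdist_le := Gc; apply.
  have N2 : \forall p \near (t0, w0), `|G t0 w0 - G p.1 w0| <= e / 2.
    have /cvgrPdist_le/(_ _ e20) N := G0c.
    exact: (@cvg_fst _ _ (nbhs t0) (nbhs w0) _ _ N).
  near=> p; rewrite -(subrKA (G t0 w0)) (splitr e) (le_trans (ler_normD _ _))// lerD//.
    by rewrite distrC; near: p.
  by near: p.
by apply: filterS => w wH t tT; apply: wH; rewrite /= in_itv.
Unshelve. all: by end_near. Qed.

(** The base point moves as well. The change of the field is needed only along the fixed curve [y0],
    uniformly on [[0, T]], and enters Gronwall's inequality as a forcing [eta]. *)
Lemma K_curves_close w0 x0 y0 (T e : R) : K (w0, x0) -> global_solution w0 x0 y0 ->
  0 <= T -> 0 < e ->
  \forall q \near (w0, x0), K q -> forall y, global_solution q.1 q.2 y ->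
    window_le (fun s => y s - y0 s) (- r%:num) T e.
Proof.
move=> Kp0 gy0 T0 e0; have [rho [kap [rk Kb]]] := K_curve_bounds.
have kap0 : 0 <= kap by exact: le_trans rk.
have [y0r y0k] := Kb _ _ _ Kp0 gy0.
have [k k0 Gk] := field_lipschitz rho%:num kap0.
pose c : R := 2 * ((1 + k * T) + T) * expR (2 * k * T).
have kT0 : 0 <= k * T by exact: mulr_ge0.
have c0 : 0 <= c by rewrite mulr_ge0 ?expR_ge0// mulr_ge0// !addr_ge0.
(* With initial error and forcing both [eta], values differ by [c eta] and slopes by
   [(k c + 1) eta]; [D] dominates both coefficients. *)
pose D : R := c + (k * c + 1).
have D0 : 0 < D by rewrite ltr_wpDl// ltr_wpDl// mulr_ge0.
pose eta : R := e / D.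
have eta0 : 0 < eta by rewrite divr_gt0.
have ce : c * eta <= e.
  by rewrite /eta mulrCA ler_piMr ?(ltW e0)// ler_pdivrMr// mul1r lerDl addr_ge0// mulr_ge0.
have ke : (k * c + 1) * eta <= e.
  by rewrite /eta mulrCA ler_piMr ?(ltW e0)// ler_pdivrMr// mul1r lerDr.
have eta_e : eta <= e.
  by rewrite (le_trans _ ke)// ler_peMl ?(ltW eta0)// lerDr mulr_ge0.
have N1 : \forall q \near (w0, x0), forall t, 0 <= t <= T ->
    `|delayed_field (sigma t q.1) (segC r y0 t) - delayed_field (sigma t w0) (segC r y0 t)| <= eta.
  exact: (@cvg_fst _ _ (nbhs w0) (nbhs x0) _ _ (field_orbit_near w0 T gy0.1.1 eta0)).
have N2 : \forall q \near (w0, x0), `|x0 - q.2| <= eta.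
  have S : (q : Omega * W).2 @[q --> (w0, x0)] --> x0 by exact: cvg_snd.
  by have /cvgrPdist_le := S; apply.
near=> q => Kq y gy.
have M1 : forall t, 0 <= t <= T ->
    `|delayed_field (sigma t q.1) (segC r y0 t) - delayed_field (sigma t w0) (segC r y0 t)| <= eta.
  by near: q.
have M2 : `|x0 - q.2| <= eta by near: q.
have Kq' : K (q.1, q.2) by case: (q) Kq.
have [yr yk] := Kb _ _ _ Kq' gy.
have [yc y0c] := (gy.1.1, gy0.1.1).
have dc : continuous (fun s => y s - y0 s) by move=> s; apply: cvgB; [exact: yc|exact: y0c].
have init s : - r%:num <= s <= 0 -> y s - y0 s = (q.2 - x0 : W) s.
  by move=> sI; rewrite gy.2 ?gy0.2//= in_itv.
have init1 s : - r%:num <= s <= 0 -> `|y s - y0 s| <= eta.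
  by move=> sI; rewrite init// (le_trans (histW_norm_ub _ _))// distrC.
pose dd (t : R) := delayed_field (sigma t q.1) (segC r y t) - delayed_field (sigma t w0) (segC r y0 t).
have dD (t : R) : 0 < t -> is_derive t 1 (fun s => y s - y0 s) (dd t).
  by move=> t0; apply: is_deriveB; [exact: gy.1.2|exact: gy0.1.2].
have win t s : 0 <= t -> t - r%:num <= s -> - r%:num <= s.
  by move=> t0; apply: le_trans; rewrite lerDr.
have ddB t B : 0 < t -> t < T -> 0 <= B ->
    (forall s, t - r%:num <= s <= t -> `|y s - y0 s| <= B) -> `|dd t| <= k * B + eta.
  move=> t0 tT B0 yB; rewrite /dd -(subrKA (delayed_field (sigma t q.1) (segC r y0 t))).
  rewrite (le_trans (ler_normD _ _))// lerD//; last by apply: M1; rewrite !ltW.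
  have ball_seg (v : R -> E) : continuous v -> (forall s, - r%:num <= s -> `|v s| <= rho%:num) ->
      (forall T, 0 <= T -> lip_on (- r%:num) T kap v) -> lip_ball rho%:num kap (segC r v t).
    move=> vc vr vk; apply: segC_lip_ball => //.
      by move=> s /andP[ts _]; apply: vr; exact: win (ltW t0) ts.
    by apply: lip_onW (vk _ (ltW t0)) => //; rewrite lerDr ltW.
  rewrite (le_trans (Gk _ _ _ (ball_seg _ yc yr yk) (ball_seg _ y0c y0r y0k)))//.
  by rewrite ler_wpM2l//; apply/segC_dist_leP.
have bd t : - r%:num <= t <= T -> `|y t - y0 t| <= c * eta.
  move=> tT; have := @delay_gronwall R n (fun s => y s - y0 s) r%:num T eta k eta
    (ltW eta0) k0 (ltW eta0) T0 _ dc init1 _ t tT.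
  move=> /(_ (ltW _)) H; apply: le_trans (H _ _) _ => //.
    by move=> u /andP[u0 uT]; exists (dd u); [exact: dD|move=> B; exact: ddB].
  by rewrite le_eqVlt; apply/orP; left; apply/eqP; rewrite /c; ring.
split=> [s sT|]; first exact: le_trans (bd _ sT) ce.
apply: (@lip_on_cat _ _ _ 0) => //.
  move=> s s' sI s'I; rewrite !init// (le_trans (histW_norm_lip _ _ _))//.
  by rewrite ler_wpM2r// distrC (le_trans M2).
apply: (@lip_on_deriv _ _ _ _ _ _ dd dc) => u /andP[u0 uT]; first exact: dD.
apply: le_trans (ddB _ (c * eta) u0 uT _ _) _; first by rewrite mulr_ge0// ltW.
  move=> s /andP[us su]; apply: bd; rewrite (win u)// ?(ltW u0)//=.
  exact: le_trans su (ltW uT).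
by rewrite mulrA -[X in _ + X]mul1r -mulrDl.
Unshelve. all: by end_near. Qed.

(** * The linearized equation *)

Definition orbit_linearization (w : Omega) (y : R -> E) (t : R) : C -> E :=
  lin (sigma t w, segW r y t).

(** The change of the segment of [z] is handled by the sup bound on the operators; the change of
    operator acts on the fixed segment at [t0], which is Lipschitz, so continuity over [K]
    applies. *)
Lemma orbit_linearization_near w x y z (t0 k e : R) : K (w, x) -> global_solution w x y ->
  continuous z -> 0 <= k -> lip_on (t0 - r%:num) t0 k z -> 0 <= t0 -> 0 < e ->
  \forall t \near t0, 0 <= t ->
    `|orbit_linearization w y t (segC r z t) - orbit_linearization w y t0 (segC r z t0)| <= e.
Proof.
move=> Kp gy zc k0 zk t00 e0; have [L L0 HL] := K_linearization_bounded.
have L1 : 0 < L + 1 by rewrite ltr_wpDl.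
pose v : W := segW r z t0; have v1 : 0 < `|v| + 1 by rewrite ltr_wpDl.
have e1 : 0 < e / 2 / (L + 1) by rewrite !divr_gt0.
have e2 : 0 < e / 2 / (`|v| + 1) by rewrite !divr_gt0.
have [d d0 Hd] := K_linearization_continuous e2.
have d20 : 0 < d / 2 by rewrite divr_gt0.
have N1 := K_segW_near Kp gy t00 d20.
have N2 : \forall t \near t0, ball (sigma t0 w) d (sigma t w).
  exact: (@flow_orbit_continuous w t0 _ (nbhsx_ballx (sigma t0 w) _ d0)).
have /cvgrPdist_le/(_ _ e1) N3 := @segC_continuous R r n z zc t0.
near=> t => t_ge0.
have M1 : `|segW r y t - segW r y t0| <= d / 2 by move: t_ge0; near: t.
have M2 : ball (sigma t0 w) d (sigma t w) by near: t.
have M3 : `|segC r z t0 - segC r z t| <= e / 2 / (L + 1) by near: t.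
have Kt0 := K_segW Kp gy t00; have Kt := K_segW Kp gy t_ge0.
have b : ball (sigma t0 w, segW r y t0) d (sigma t w, segW r y t).
  split=> //=; rewrite -ball_normE /= distrC (le_lt_trans M1)//.
  by rewrite ltr_pdivrMr// ltr_pMr// ltr1n.
have vE : (v : C) = segC r z t0 by exact: segW_hist zk.
have H1 := Hd _ _ Kt0 Kt b v; rewrite vE in H1.
have H2 := HL _ (segC r z t - segC r z t0) Kt; rewrite linearizationB in H2.
rewrite -(subrKA (orbit_linearization w y t (segC r z t0))) (splitr e).
rewrite (le_trans (ler_normD _ _))// lerD//.
  rewrite (le_trans H2)// (@le_trans _ _ ((L + 1) * (e / 2 / (L + 1))))//.
    by rewrite ler_pM ?lerDl// distrC.
  by rewrite mulrCA divff ?mulr1// gt_eqF.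
rewrite (le_trans H1)// (@le_trans _ _ (e / 2 / (`|v| + 1) * (`|v| + 1)))//.
  by rewrite ler_wpM2l ?(ltW e2)// lerDl.
by rewrite divfK// gt_eqF.
Unshelve. all: by end_near. Qed.

Lemma continuous_pos_part : continuous (fun t : R => Num.max t 0).
Proof.
move=> t; apply: (@continuous_max _ _ (id : R -> R) (cst 0)); [exact: cvg_id|exact: cvg_cst].
Qed.

Lemma orbit_linearization_continuous w x y z : K (w, x) -> global_solution w x y ->
  continuous z -> (forall T : R, 0 <= T -> exists2 k : R, 0 <= k & lip_on (T - r%:num) T k z) ->
  continuous (fun t : R => orbit_linearization w y (Num.max t 0) (segC r z (Num.max t 0))).
Proof.
move=> Kp gy zc zk t; have m0 : 0 <= Num.max t 0 by rewrite le_max lexx orbT.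
have [k k0 zk'] := zk _ m0; apply/cvgrPdist_le => e e0.
have N := orbit_linearization_near Kp gy zc k0 zk' m0 e0.
near=> s; rewrite distrC.
have s0 : 0 <= Num.max s 0 by rewrite le_max lexx orbT.
move: s0; near: s; exact: (@continuous_pos_part t _ N).
Unshelve. all: by end_near. Qed.

Definition linear_curve (w : Omega) (y : R -> E) (v : W) (z : R -> E) : Prop :=
  [/\ continuous z, forall s, I s -> z s = v s
    & forall t : R, 0 < t -> is_derive t 1 z (orbit_linearization w y t (segC r z t))].

Lemma half_growth_bound (a c1 c2 B d : R) : a <= c1 + c2 -> c1 <= B / 2 * d - B / 2 ->
  c2 <= B -> B <= B * d -> a <= B * d.
Proof. lra. Qed.

(** Picard iteration in the class of curves with [|z t| <= |v| e^(2 L t)] and local Lipschitz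
    bounds. The iteration reproduces the growth bound, which in turn bounds slopes; Lipschitz
    windows make the right-hand side continuous in time. *)
Lemma linear_curve_exists w x y (v : W) : K (w, x) -> global_solution w x y ->
  exists z, linear_curve w y v z /\
    forall T : R, 0 <= T -> exists2 k : R, 0 <= k & lip_on (T - r%:num) T k z.
Proof.
move=> Kp gy; have [L' L'0 HL'] := K_linearization_bounded.
pose L : R := L' + 1; have L0 : 0 < L by rewrite ltr_wpDl.
have HL (t : R) u : 0 <= t -> `|orbit_linearization w y t u| <= L' * `|u|.
  by move=> t0; apply: HL'; exact: (K_segW Kp gy t0).
pose B : R := `|v|; have B0 : 0 <= B by exact: normr_ge0.
pose ex (t : R) : R := expR (2 * L * t).
have ex0 : ex 0 = 1 by rewrite /ex mulr0 expR0.
have ex_gt0 t : 0 < ex t by exact: expR_gt0.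
have ex_le (s t : R) : s <= t -> ex s <= ex t.
  by move=> st; rewrite ler_expR ler_wpM2l// mulr_ge0// ltW.
have dexp (s : R) : is_derive s 1 ex (2 * L * ex s).
  rewrite mulrC; exact: (is_derive1_comp (is_derive_expR _) (is_derive_mull (2 * L) s)).
have exc : continuous ex.
  by move=> t; apply/differentiable_continuous/derivable1_diffP; case: (dexp t).
pose kap (T : R) := B + L * (B * ex T).
have kap0 T : 0 <= kap T.
  by rewrite addr_ge0// (mulr_ge0 (ltW L0) (mulr_ge0 B0 (ltW (ex_gt0 T)))).
pose Q := [set z : R -> E | continuous z /\
  (forall t : R, `|z t| <= B * ex (Num.max t 0)) /\
  forall T : R, 0 <= T -> lip_on (- T) T (kap T) z].
pose A (z : R -> E) (t : R) := orbit_linearization w y (Num.max t 0) (segC r z (Num.max t 0)).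
have AE z t : 0 <= t -> A z t = orbit_linearization w y t (segC r z t).
  by move=> t0; rewrite /A (max_idPl t0).
have Qlip z : Q z -> forall T : R, 0 <= T -> exists2 k : R, 0 <= k & lip_on (T - r%:num) T k z.
  move=> [_ [_ zk]] T T0; have Tr : 0 <= T + r%:num by rewrite addr_ge0.
  exists (kap (T + r%:num)) => //; apply: lip_onW (zk _ Tr) => //.
    by rewrite opprD lerD2r (le_trans _ T0)// oppr_le0.
  by rewrite lerDl.
have QA z t : Q z -> 0 <= t -> `|A z t| <= L' * (B * ex t).
  move=> [zc [zb _]] t0; rewrite AE// (le_trans (HL _ _ t0))// ler_wpM2l//.
  apply: hist_norm_le => s _; rewrite (segC_curve _ _ zc) (le_trans (zb _))//.
  rewrite ler_wpM2l// ex_le// ge_max t0 andbT.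
  by have /andP[] := @clamp_window _ r t s.
have v0 (t : R) : 0 <= t -> v t = v 0.
  move=> t0; rewrite hist_clamp [RHS]hist_clamp /clamp; congr (v (Num.max _ _)).
  by rewrite (min_idPr t0) minxx.
have Bex (t : R) : B <= B * ex (Num.max t 0).
  by rewrite ler_peMr// -ex0 ex_le// le_max lexx orbT.
have Qv : Q v.
  split; first exact: hist_continuous.
  split=> [t|T T0 s t _ _]; first exact: le_trans (histW_norm_ub _ _) (Bex t).
  rewrite (le_trans (histW_norm_lip _ _ _))// ler_wpM2r// lerDl.
  exact: (mulr_ge0 (ltW L0) (mulr_ge0 B0 (ltW (ex_gt0 T)))).
have QAc z : Q z -> continuous (A z).
  by move=> Qz; apply: (orbit_linearization_continuous Kp gy Qz.1); exact: Qlip.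
have L'L : L' <= L by rewrite lerDl.
have [z [Qz zv dz]] : exists z, [/\ Q z, forall t : R, t <= 0 -> z t = v t
    & forall t : R, 0 < t -> is_derive t 1 z (A z t)].
  apply: (@picard R n A v L (L' * B) Q L0 (mulr_ge0 L'0 B0) v0 _ QAc Qv).
  - by move=> z [].
  - move=> z Y Qz Yc Yv dY; split=> //; split=> [t|T T0].
      have [t0|t0] := leP t 0.
        by rewrite ex0 mulr1 Yv// histW_norm_ub.
      have dcex (s : R) : is_derive s 1 (fun s : R => B / 2 * ex s) (B / 2 * (2 * L * ex s)).
        exact: (@is_deriveZ _ _ _ ex (B / 2) s 1 _ (dexp s)).
      have cexc : continuous (fun s : R => B / 2 * ex s).
        by move=> s; apply: cvgM; [exact: cvg_cst|exact: exc].
      have H : `|Y t - Y 0| <= B / 2 * ex t - B / 2 * ex 0.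
        apply: (@derive_le_comparison R n Y (A z) _ (fun s => B / 2 * (2 * L * ex s)) 0 t (ltW t0) Yc cexc) => s /andP[s0 _].
        - exact: dY.
        - apply: le_trans (QA z s Qz (ltW s0)) _.
          have -> : B / 2 * (2 * L * ex s) = L * (B * ex s) by field.
          by rewrite ler_wpM2r// (mulr_ge0 B0 (ltW (ex_gt0 s))).
      rewrite ex0 mulr1 in H.
      have Y0 : `|Y 0| <= B by rewrite Yv// histW_norm_ub.
      have ext : B <= B * ex t by have := Bex t; rewrite (max_idPl (ltW t0)).
      have := ler_normD (Y t - Y 0) (Y 0); rewrite subrK.
      by move=> /half_growth_bound; apply.
    apply: (@lip_on_cat _ _ _ 0) => //; first by rewrite oppr_le0.
      move=> s t /andP[_ s0] /andP[_ t0]; rewrite !Yv//.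
      rewrite (le_trans (histW_norm_lip _ _ _))// ler_wpM2r// lerDl.
      exact: (mulr_ge0 (ltW L0) (mulr_ge0 B0 (ltW (ex_gt0 T)))).
    apply: (@lip_on_deriv _ _ _ _ _ _ (A z) Yc) => s /andP[s0 sT]; first exact: dY.
    apply: le_trans (QA z s Qz (ltW s0)) _; rewrite ler_wpDl//.
    have H : B * ex s <= B * ex T by rewrite ler_wpM2l// ex_le// ltW.
    exact: ler_pM L'0 (mulr_ge0 B0 (ltW (ex_gt0 s))) L'L H.
  - move=> u z Qu uz.
    have zb (t : R) : `|z t| <= B * ex (Num.max t 0).
      apply: (@closed_cvg _ _ _ _ (fun k => `|u k t|) [set a : R | a <= B * ex (Num.max t 0)] _ _ _ (cvg_norm (uz t))).
        exact: closed_le.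
      by apply: nearW => k; have [_ [H _]] := Qu k; exact: H.
    have zk T : 0 <= T -> lip_on (- T) T (kap T) z.
      move=> T0 s t sT tT.
      have : `|u k s - u k t| @[k --> \oo] --> `|z s - z t|.
        by apply: cvg_norm; apply: cvgB; exact: uz.
      apply: (@closed_cvg _ _ _ _ (fun k => `|u k s - u k t|) [set a : R | a <= kap T * `|s - t|]).
        exact: closed_le.
      by apply: nearW => k; have [_ [_ H]] := Qu k; exact: H.
    split=> //; move=> t; pose T : R := `|t| + 1.
    have T0 : 0 <= T by rewrite addr_ge0.
    apply/cvgrPdist_le => e e0.
    have K0 : 0 < kap T + 1 by rewrite ltr_wpDl.
    have e10 : 0 < e / (kap T + 1) by rewrite divr_gt0.
    have tT : - T <= t <= T by rewrite -ler_norml lerDl.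
    near=> s.
    have st : `|t - s| <= e / (kap T + 1).
      by near: s; have /cvgrPdist_le := @cvg_id _ (nbhs t); apply.
    have sT : - T <= s <= T.
      rewrite -ler_norml -[s](subrK t) (le_trans (ler_normD _ _))// addrC lerD2l.
      rewrite distrC; near: s; have /cvgrPdist_le := @cvg_id _ (nbhs t); apply.
      exact: ltr01.
    rewrite (le_trans (zk T T0 t s tT sT))// (@le_trans _ _ ((kap T + 1) * `|t - s|))//.
      by rewrite ler_wpM2r// lerDl.
    by rewrite mulrC -ler_pdivlMr.
  - move=> z1 z2 t b Q1 Q2 t0 b0 zb; rewrite !AE// /orbit_linearization -linearizationB.
    rewrite (le_trans (HL _ _ t0))// ler_pM//.
    by apply/(segC_dist_leP _ _ Q1.1 Q2.1) => s /andP[_ st]; exact: zb.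
  - move=> t t0; rewrite AE// (le_trans (HL _ _ t0))// ler_wpM2l//.
    by apply: hist_norm_le => s _; rewrite (segC_curve _ _ Qv.1) histW_norm_ub.
exists z; split; last exact: Qlip.
split=> [|s|t t0]; first exact: Qz.1.
  by rewrite /= in_itv/= => /andP[_ s0]; exact: zv.
by rewrite -AE ?ltW//; exact: dz.
Unshelve. all: by end_near. Qed.

Lemma linear_curve_lip w x y v z (T : R) : K (w, x) -> global_solution w x y ->
  linear_curve w y v z -> 0 <= T -> exists2 k : R, 0 <= k & lip_on (- r%:num) T k z.
Proof.
move=> Kp gy [zc zv dz] T0; have [L L0 HL] := K_linearization_bounded.
have [B B0 zB] : exists2 B : R, 0 <= B & forall s, - r%:num <= s <= T -> `|z s| <= B.
  have zw : {within `[- r%:num, T], continuous (fun s => `|z s|)}.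
    by apply: continuous_subspaceT => s; apply: cvg_norm; exact: zc.
  have rT : - r%:num <= T by rewrite (le_trans _ T0)// oppr_le0.
  have [c _ zM] := EVT_max rT zw.
  by exists `|z c| => // s sT; apply: zM; rewrite in_itv.
have [k k0 vk] := histW_lipP v.
exists (k + L * B); first by rewrite addr_ge0// mulr_ge0.
apply: (@lip_on_cat _ _ _ 0) => //.
  move=> s t sI tI; rewrite !zv ?in_itv//=; apply: le_trans (vk _ _) _.
  by rewrite ler_wpM2r// lerDl mulr_ge0.
apply: (@lip_on_deriv _ _ _ _ _ _ _ zc (fun u _ => dz u _)) => [u /andP[]//|u /andP[u0 uT]].
have Kt := K_segW Kp gy (ltW u0).
apply: le_trans (HL _ _ Kt) _; rewrite ler_wpDl// ler_wpM2l//.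
apply: hist_norm_le => s _; rewrite (segC_curve _ _ zc); apply: zB.
have /andP[a b] := @clamp_window _ r u s.
by rewrite (le_trans b (ltW uT)) andbT (le_trans _ a)// lerDr ltW.
Qed.

Lemma linear_curve_window w x y v z : K (w, x) -> global_solution w x y ->
  linear_curve w y v z -> forall T : R, 0 <= T -> exists2 k : R, 0 <= k & lip_on (T - r%:num) T k z.
Proof.
move=> Kp gy lz T T0; have [k k0 zk] := linear_curve_lip Kp gy lz T0; exists k => //.
by apply: lip_onW zk => //; rewrite lerDr.
Qed.

Lemma linear_curve_is_solution w x y v z : K (w, x) -> global_solution w x y ->
  linear_curve w y v z -> is_linear_solution sigma F tau (w, x) v z.
Proof.
move=> Kp gy lz; have [zc zv dz] := lz; split=> //; first exact: continuous_subspaceT.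
move=> t t0; have -> : skew_product sigma F tau t (w, x) = (sigma t w, segW r y t).
  by rewrite /skew_product (global_state gy t0).
move: t0; rewrite le_eqVlt => /predU1P[<-|t0]; last first.
  by apply/has_deriv_within_interior; [exact: nbhs_itvcy|exact: dz].
have Ac := orbit_linearization_continuous Kp gy zc (linear_curve_window Kp gy lz).
pose A (t : R) := orbit_linearization w y (Num.max t 0) (segC r z (Num.max t 0)).
have -> : lin (sigma 0 w, segW r y 0) (segC r z 0) = A 0 by rewrite /A maxxx.
have dA (u : R) : 0 < u < 1 -> is_derive u 1 z (A u).
  by move=> /andP[u0 _]; rewrite /A (max_idPl (ltW u0)); exact: dz.
have A0 : {for (0 : R), continuous A} by exact: (Ac 0).
have J0 : `[0, +oo[%classic `<=` [set s : R | 0 <= s] by move=> s /=; rewrite in_itv/= andbT.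
clearbody A; exact: (@right_derivative_at0 R n z A `[0, +oo[%classic 1 ltr01 J0 zc A0 dA).
Qed.

(** The Lyapunov exponent refers to the chosen [linear_solution], so decay is obtained for that one;
    [Num.max] freezes it before [- r], where its values are unconstrained. *)
Lemma linear_solution_curve w x y v : K (w, x) -> global_solution w x y ->
  linear_curve w y v (fun t => linear_solution sigma F tau (w, x) v (Num.max (- r%:num) t)).
Proof.
move=> Kp gy; set z := linear_solution _ _ _ _ _.
have [zv zc dz] : is_linear_solution sigma F tau (w, x) v z.
  have [z' [lz' _]] := linear_curve_exists v Kp gy.
  exact: (xgetPex (fun=> 0) (ex_intro _ z' (linear_curve_is_solution Kp gy lz'))).
set Z := fun t : R => z (Num.max (- r%:num) t).
have ZE t : - r%:num <= t -> Z t = z t by move=> rt; rewrite /Z (max_idPr rt).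
have Zc : continuous Z.
  apply: (@continuous_within_comp `[- r%:num, +oo[%classic z (fun t => Num.max (- r%:num) t)) => //.
    move=> s; apply: (@continuous_max _ _ (cst (- r%:num)) (id : R -> R)); [exact: cvg_cst|exact: cvg_id].
  by move=> s; rewrite /= in_itv/= andbT le_max lexx.
split=> // [s Is|t t0]; first by rewrite ZE ?zv//; move: Is; rewrite /= in_itv/= => /andP[].
have := dz _ (ltW t0) => /(has_deriv_within_interior _ _ (nbhs_itvcy t0)).
rewrite /skew_product (global_state gy (ltW t0)) => dzt.
have -> : segC r Z t = segC r z t.
  rewrite /segC; congr insubd; apply/funext => s; rewrite ZE//.
  by have /andP[a _] := @clamp_window _ r t s; rewrite (le_trans _ a)// lerDr ltW.
apply: near_eq_is_derive dzt; near=> s; rewrite ZE//.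
rewrite ltW//; near: s; apply: lt_nbhsr; by rewrite (le_lt_trans _ t0)// oppr_le0.
Unshelve. all: by end_near. Qed.

Lemma limsup_log_decay (f : R -> R) (eta T0 : R) :
  (limf_esup (fun t : R => ((t^-1)%:E * lne (f t)%:E)%E) (pinfty_nbhs R) < 0)%E ->
  0 < eta -> exists2 t : R, T0 <= t & f t <= eta.
Proof.
move=> /ereal_inf_lt[_ [V VF <-] supV] eta0.
have [a a0 Va] : exists2 a : R, 0 < a &
    forall t, V t -> ((t^-1)%:E * lne (f t)%:E <= (- a)%:E)%E.
  have ub t : V t -> ((t^-1)%:E * lne (f t)%:E <=
      ereal_sup ((fun t : R => ((t^-1)%:E * lne (f t)%:E)%E) @` V))%E.
    by move=> Vt; apply: ereal_sup_ubound; exists t.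
  move: supV ub; case: (ereal_sup _) => [s| |] //.
    rewrite lte_fin => s0 H; exists (- s); first by rewrite oppr_gt0.
    by rewrite opprK.
  (* If the supremum is -oo, every rate works and 1 is taken. *)
  move=> _ H; exists 1; first exact: ltr01.
  by move=> t /H; rewrite leeNy_eq => /eqP ->; rewrite leNye.
have [M [_ MV]] := VF.
(* Past [M] to be in [V], at least 1 to multiply by [t], at least [T0], and beyond [- ln eta / a],
   where [e^(- a t)] drops below [eta]. *)
pose t : R := Num.max (Num.max (M + 1) 1) (Num.max T0 (- ln eta / a + 1)).
have tM : M + 1 <= t by rewrite /t !le_max lexx.
have t1 : 1 <= t by rewrite /t !le_max lexx !orbT.
have tT : T0 <= t by rewrite /t !le_max lexx !orbT.
have te : - ln eta / a + 1 <= t by rewrite /t !le_max lexx !orbT.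
have t0 : 0 < t by exact: lt_le_trans t1.
exists t => //; rewrite leNgt; apply/negP => ef.
have Vt : V t by apply: MV; rewrite (lt_le_trans _ tM)// ltrDl.
have f0 : 0 < f t by exact: lt_trans ef.
have := Va _ Vt; rewrite lne_EFin// -EFinM lee_fin mulrC ler_pdivrMr// => H.
have : ln eta < ln (f t) by rewrite ltr_ln// posrE.
move=> /lt_le_trans/(_ H); rewrite mulNr ltrNr => H2.
have : - ln eta / a < t by rewrite (lt_le_trans _ te)// ltrDl.
by rewrite ltr_pdivrMr// mulrC ltNge (ltW H2).
Qed.

Hypothesis K_lyapunov : (upper_lyapunov sigma F tau K < 0)%E.

Lemma linear_decay w x y (v : W) : K (w, x) -> global_solution w x y ->
  exists z, linear_curve w y v z /\
    forall eta T0 : R, 0 < eta -> exists t, [/\ T0 <= t, 0 <= t &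
      forall s, t - r%:num <= s <= t -> `|z s| <= eta].
Proof.
(* The exponent ranges over nonzero [v]; for [v = 0] the zero curve serves. *)
move=> Kp gy; have [->|v0] := eqVneq v 0.
  exists (cst 0); split; last first.
    move=> eta T0 eta0; exists `|T0|; split; [exact: ler_norm|exact: normr_ge0|].
    by move=> s _; rewrite normr0 ltW.
  split=> [|//|t t0]; first by move=> s; exact: cvg_cst.
  have -> : segC r (cst 0 : R -> E) t = 0.
    by apply: histP => s _; rewrite segC_curve// => u; exact: cvg_cst.
  by rewrite /orbit_linearization linearization0; exact: is_derive_cst.
have lz := linear_solution_curve v Kp gy.
set Z := fun t : R => _ in lz; exists Z; split=> // eta T0 eta0.
have := K_lyapunov; rewrite /upper_lyapunov => lyap.
have : (limf_esup (fun t : R => ((t^-1)%:E * lne (`|linear_state sigma F tau t (w, x) v|)%:E)%E)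
    (pinfty_nbhs R) < 0)%E.
  by apply: le_lt_trans lyap; apply: ereal_sup_ubound; exists ((w, x), v).
move=> /limsup_log_decay/(_ eta0) => /(_ (Num.max T0 0))[t].
rewrite ge_max => /andP[Tt t0] H; exists t; split=> // s ts.
have zc := let: And3 a _ _ := lz in a.
have [k k0 zk] := linear_curve_window Kp gy lz t0.
have E : linear_state sigma F tau t (w, x) v = segW r Z t.
  rewrite /linear_state /segW; congr insubd; rewrite /segC; congr insubd; apply/funext => u.
  rewrite /Z (max_idPr _)//; have /andP[a _] := @clamp_window _ r t u.
  by rewrite (le_trans _ a)// lerDr.
apply: le_trans H; rewrite E; have := histW_norm_ub (segW r Z t) (s - t).
by rewrite (segW_hist zc k0 zk) (segC_curve _ _ zc) -(window_clamp ts).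
Qed.

(** * Exponential stability *)

(** [rho] leaves a margin of 1 around the curves of [K], so solutions within 1 of them are not
    affected by clipping. [kap] dominates the clipped field, the initial histories within 1 of [K],
    and the slopes of the curves of [K]. *)
Lemma K_clip_bounds : exists (rho : {nonneg R}) (M kap : R),
  [/\ 0 <= M, M <= kap, forall w x, K (w, x) -> `|x| + 1 <= kap,
    forall w x, `|clipped_field rho w x| <= M &
  forall w x y, K (w, x) -> global_solution w x y ->
    [/\ curve (clipped_field rho) w y, forall s, - r%:num <= s -> `|y s| + 1 <= rho%:num
      & forall T, 0 <= T -> lip_on (- r%:num) T kap y]].
Proof.
have [rho0 [kap0 [rk Kb]]] := K_curve_bounds.
have [rho2 Krho2] := K_bounded.
have rho10 : 0 <= rho0%:num + 1 by rewrite addr_ge0.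
pose rho : {nonneg R} := NngNum rho10.
have [M M0 GM] := clipped_field_bounded rho.
exists rho, M, (Num.max M (Num.max (rho2%:num + 1) kap0)); split => //; do ?by rewrite !le_max lexx ?orbT.
  by move=> w x Kwx; rewrite !le_max lerD2r (Krho2 w)// orbT.
move=> w x y Kp gy; have [yr yk] := Kb _ _ _ Kp gy; have yc := gy.1.1.
split.
- split=> // t t0; rewrite clipped_field_id; first exact: gy.1.2.
  move=> s; rewrite (segC_curve _ _ yc); apply: (@le_trans _ _ rho0%:num); last by rewrite lerDl.
  apply: yr; have /andP[a _] := @clamp_window _ r t s.
  by rewrite (le_trans _ a)// lerDr ltW.
- by move=> s rs; rewrite lerD2r yr.
- by move=> T T0; apply: lip_onW (yk _ T0) => //; rewrite !le_max lexx !orbT.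
Qed.

Section Contraction.
Variables (rho : {nonneg R}) (kap : R).
Hypothesis kap_ge0 : 0 <= kap.
Hypothesis K_clip : forall w x y, K (w, x) -> global_solution w x y ->
  [/\ curve (clipped_field rho) w y, forall s, - r%:num <= s -> `|y s| + 1 <= rho%:num
    & forall T, 0 <= T -> lip_on (- r%:num) T kap y].

Definition clipped_curve w y := curve (clipped_field rho) w y /\
  forall T, 0 <= T -> lip_on (- r%:num) T kap y.

Lemma lip_ball_histW (a k : R) (v : C) : 0 <= k -> lip_ball a k v -> exists V : W, (V : C) = v.
Proof.
move=> k0 [_ vk]; exists (insubd (0 : W) v); rewrite val_insubd ifT//.
by apply/lip_predP; exists k.
Qed.

Lemma window_sub (a b T : R) : 0 <= a -> b <= T -> forall s, a - r%:num <= s <= b -> - r%:num <= s <= T.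
Proof.
move=> a0 bT s /andP[as_ sb]; rewrite (le_trans sb bT) andbT (le_trans _ as_)//.
by rewrite lerDr.
Qed.

Lemma two_thirds_lt (a : R) : 0 < a -> a / 3 + a / 3 < a.
Proof. lra. Qed.

(** Both [y] and [yb] stay within the uniform radius of the reference curve [y0], so one
    linearization along [y0] serves for all nearby points. Their W^{1,oo} distance [c h] gives an
    error [e c h], and dividing by [h] leaves [e c]. *)
Lemma clipped_difference_linear w0 x0 y0 (T e c : R) : K (w0, x0) -> global_solution w0 x0 y0 ->
  0 <= T -> 0 < e -> 0 <= c ->
  exists2 d : R, 0 < d & \forall q \near (w0, x0), K q -> forall yb y h,
    global_solution q.1 q.2 yb -> clipped_curve q.1 y -> 0 < h -> c * h <= d ->
    window_le (fun s => y s - yb s) (- r%:num) T (c * h) ->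
    forall t, 0 < t < T ->
    `|h^-1 *: (clipped_field rho (sigma t q.1) (segC r y t)
               - clipped_field rho (sigma t q.1) (segC r yb t))
      - orbit_linearization w0 y0 t (h^-1 *: (segC r y t - segC r yb t))| <= e * c.
Proof.
move=> Kp gy0 T0 e0 c0; have [d1 d10 Hd] := K_uniform_strict_diff e0.
have d30 : 0 < d1 / 3 by rewrite divr_gt0.
(* The bound 1 keeps [y] where clipping is inactive; two thirds of [d1] keep it in the ball around
   [y0]. *)
exists (Num.min 1 (d1 / 3)); first by rewrite lt_min ltr01.
have N1 : \forall q \near (w0, x0), forall t, 0 <= t <= T -> ball (sigma t w0) d1 (sigma t q.1).
  exact: (@cvg_fst _ _ (nbhs w0) (nbhs x0) _ _ (orbit_near w0 T d10)).
have N2 := K_curves_close Kp gy0 T0 d30.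
near=> q => Kq yb y h gyb cy h0; rewrite le_min => /andP[ch1 chd] [D1 D2] t /andP[t0 tT].
have M1 : ball (sigma t w0) d1 (sigma t q.1).
  have M : forall t, 0 <= t <= T -> ball (sigma t w0) d1 (sigma t q.1) by near: q.
  by apply: M; rewrite !ltW.
have [E1 E2] : window_le (fun s => yb s - y0 s) (- r%:num) T (d1 / 3).
  by move: yb gyb {D1 D2}; move: Kq; near: q; apply: filterS N2 => q H Kq yb gyb; exact: H.
have [[yc _] yk] := cy; have ybc := gyb.1.1; have y0c := gy0.1.1.
have Kq' : K (q.1, q.2) by case: (q) Kq.
have [_ ybr ybk] := K_clip Kq' gyb; have [_ y0r y0k] := K_clip Kp gy0.
have win := window_sub (ltW t0) (ltW tT).
have win0 : - r%:num <= t - r%:num by rewrite lerDr ltW.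
have wl (z : R -> E) : (forall T, 0 <= T -> lip_on (- r%:num) T kap z) ->
    lip_on (t - r%:num) t kap z.
  by move=> zk; apply: lip_onW (zk _ (ltW t0)).
have ch0 : 0 <= c * h by rewrite mulr_ge0// ltW.
have yyb : `|segW r y t - segW r yb t| <= c * h.
  apply/(segW_dist_leP yc ybc ch0 kap_ge0 (wl _ yk) (wl _ ybk)); split.
    by move=> s /win; exact: D1.
  by apply: lip_onW D2 => //; exact: ltW.
have yby0 : `|segW r yb t - segW r y0 t| <= d1 / 3.
  apply/(segW_dist_leP ybc y0c (ltW d30) kap_ge0 (wl _ ybk) (wl _ y0k)); split.
    by move=> s /win; exact: E1.
  by apply: lip_onW E2 => //; exact: ltW.
have cl (s : R) : - r%:num <= t + clamp r s <= T by apply: win; exact: clamp_window.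
rewrite !clipped_field_id; last 2 first.
- move=> s; rewrite (segC_curve _ _ ybc); have /andP[a _] := cl s.
  by apply: le_trans (ybr _ a); rewrite lerDl.
- move=> s; rewrite (segC_curve _ _ yc); have /andP[a _] := cl s.
  apply: le_trans (ybr _ a); rewrite -[y _](subrK (yb (t + clamp r s))).
  by rewrite (le_trans (ler_normD _ _))// addrC lerD2l (le_trans (D1 _ (cl s))).
have K0 := K_segW Kp gy0 (ltW t0).
have segE (z : R -> E) : continuous z -> (forall T, 0 <= T -> lip_on (- r%:num) T kap z) ->
    (segW r z t : C) = segC r z t.
  by move=> zc zk; exact: segW_hist zc kap_ge0 (wl _ zk).
have b1 : ball (sigma t w0, segW r y0 t) d1 (sigma t q.1, segW r yb t).
  split=> //=; rewrite -ball_normE /= distrC (le_lt_trans yby0)//.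
  by rewrite ltr_pdivrMr// ltr_pMr// ltr1n.
have b2 : ball (sigma t w0, segW r y0 t) d1 (sigma t q.1, segW r y t).
  split=> //=; rewrite -ball_normE /= distrC -(subrKA (segW r yb t)).
  rewrite (le_lt_trans (ler_normD _ _))// (le_lt_trans (lerD (le_trans yyb chd) yby0))//.
  exact: two_thirds_lt.
have := Hd _ K0 _ _ _ b2 b1; rewrite -(segE _ yc yk) -(segE _ ybc ybk).
rewrite /orbit_linearization linearizationZ -scalerBr normrZ gtr0_norm ?invr_gt0// => H.
rewrite ler_pdivrMl// (le_trans H)// mulrCA ler_wpM2l ?(ltW e0)//.
by rewrite mulrC.
Unshelve. all: by end_near. Qed.

Lemma lip_ball_window (d : R -> E) (v : C) (h : R) : 0 <= h -> lip_ball 1 1 v ->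
  (forall s, I s -> d s = h *: v s) -> window_le d (- r%:num) 0 h.
Proof.
move=> h0 [v1 v2] dv; split=> [s sI|s t sI tI]; rewrite ?dv ?in_itv//=.
  by rewrite normrZ ger0_norm// ler_piMr.
rewrite -scalerBr normrZ ger0_norm// ler_wpM2l//.
by have := v2 s t; rewrite mul1r.
Qed.

Lemma gronwall_constants (a b D c eta : R) : 0 < a -> 0 <= b -> 0 < D -> 0 <= c -> 0 < eta ->
  exists A e : R, [/\ 0 < A, 0 < e & 2 * (A * a + (e * c) * b) * D <= eta].
Proof.
move=> a0 b0 D0 c0 eta0; have cb0 : 0 < c * b + 1 by rewrite ltr_wpDl// mulr_ge0.
(* The initial discrepancy and the forcing contribute at most [eta / 2] each; the added 1 covers
   [c b = 0]. *)
exists (eta / (4 * D * a)), (eta / (4 * D * (c * b + 1))).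
split; do ?by rewrite divr_gt0// !mulr_gt0.
have H : eta / (4 * D * (c * b + 1)) * c * b <= eta / (4 * D).
  rewrite -mulrA (_ : eta / (4 * D * (c * b + 1)) = eta / (4 * D) / (c * b + 1)); last first.
    by field; rewrite !gt_eqF.
  rewrite -[leRHS]mulr1 -mulrA ler_wpM2l ?divr_ge0 ?mulr_ge0 ?ltW//.
  by rewrite mulrC ltr_pdivrMr// mul1r ltrDl.
have E : eta / (4 * D * a) * a = eta / (4 * D) by field; rewrite !gt_eqF.
rewrite E (@le_trans _ _ (2 * (eta / (4 * D) + eta / (4 * D)) * D))//.
  by rewrite ler_wpM2r ?(ltW D0)// ler_wpM2l// lerD2l.
rewrite le_eqVlt; apply/orP; left; apply/eqP; field; by rewrite gt_eqF.
Qed.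

(** The rescaled initial difference [p.2] is near [V] in the sup norm only, the topology for which
    it ranges over a compact set. Gronwall runs in that norm, with the nonlinear error bounded
    through the W^{1,oo} growth of the difference. *)
Lemma linear_shadowing w0 x0 y0 (V : W) z (t0 eta : R) : K (w0, x0) -> global_solution w0 x0 y0 ->
  linear_curve w0 y0 V z -> 0 <= t0 -> 0 < eta ->
  exists2 d : R, 0 < d & \forall p \near ((w0, x0), V : C), K p.1 -> lip_ball 1 1 p.2 ->
    forall yb y h, global_solution p.1.1 p.1.2 yb -> clipped_curve p.1.1 y -> 0 < h -> h <= d ->
    (forall s, I s -> y s - yb s = h *: p.2 s) ->
    forall s, - r%:num <= s <= t0 -> `|h^-1 *: (y s - yb s) - z s| <= eta.
Proof.
move=> Kp gy0 [zc zv dz] t00 eta0; have [L L0 HL] := K_linearization_bounded.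
have [c c1 growth] := clipped_curves_growth rho kap_ge0 t00.
have c0 : 0 < c by exact: lt_le_trans c1.
have a0 : 0 < 1 + L * t0 by rewrite ltr_pwDl// mulr_ge0.
have [A [e [A0 e0 Ae]]] := gronwall_constants a0 t00 (expR_gt0 (2 * L * t0)) (ltW c0) eta0.
have [d d0 N1] := clipped_difference_linear Kp gy0 t00 e0 (ltW c0).
exists (d / c); first by rewrite divr_gt0.
have N2 := @cvg_fst _ _ (nbhs (w0, x0)) (nbhs (V : C)) _ _ N1.
near=> p => Kp1 pV yb y h gyb cy h0 hd dv s sI.
have Vp : `|(V : C) - p.2| <= A.
  near: p; have /cvgrPdist_le : (p : (Omega * W) * C).2 @[p --> ((w0, x0), V : C)] --> (V : C).
    exact: cvg_snd.
  by apply.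
have Kp' : K (p.1.1, p.1.2) by case: (p.1) Kp1.
have [cyb ybr ybk] := K_clip Kp' gyb; have [[yc dy] yk] := cy; have [ybc dyb] := cyb.
have win0 := lip_ball_window (ltW h0) pV dv.
have win := growth _ _ _ _ cy.1 cyb (ltW h0) (yk _ t00) (ybk _ t00) win0.
have chd : c * h <= d by rewrite mulrC -ler_pdivlMr.
pose G (u : R) := clipped_field rho (sigma u p.1.1) (segC r y u)
               - clipped_field rho (sigma u p.1.1) (segC r yb u).
have lin_close u : 0 < u < t0 ->
    `|h^-1 *: G u - orbit_linearization w0 y0 u (h^-1 *: (segC r y u - segC r yb u))| <= e * c.
  have H : K p.1 -> forall yb y h, global_solution p.1.1 p.1.2 yb -> clipped_curve p.1.1 y ->
    0 < h -> c * h <= d -> window_le (fun s => y s - yb s) (- r%:num) t0 (c * h) ->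
    forall t, 0 < t < t0 ->
    `|h^-1 *: (clipped_field rho (sigma t p.1.1) (segC r y t)
               - clipped_field rho (sigma t p.1.1) (segC r yb t))
      - orbit_linearization w0 y0 t (h^-1 *: (segC r y t - segC r yb t))| <= e * c.
    by near: p; exact: N2.
  by move=> ut; exact: (H Kp1 yb y h gyb cy h0 chd win u ut).
pose D (s : R) := h^-1 *: (y s - yb s) - z s.
have qc : continuous (fun s => h^-1 *: (y s - yb s)).
  by move=> u; apply: cvgZr; apply: cvgB; [exact: yc|exact: ybc].
have Dc : continuous D by move=> u; apply: cvgB; [exact: qc|exact: zc].
have ec0 : 0 <= e * c by rewrite mulr_ge0 ?ltW.
apply: le_trans Ae.
apply: (@delay_gronwall R n D r%:num t0 A L (e * c) (ltW A0) L0 ec0 t00 (ltW _) Dc) => //.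
- move=> u uI; have Iu : I u by rewrite /= in_itv.
  rewrite /D dv// zv// scalerA mulVf ?gt_eqF// scale1r distrC.
  exact: le_trans (hist_norm_ub ((V : C) - p.2) u) Vp.
- move=> u ut; have /andP[u0 _] := ut.
  exists (h^-1 *: G u - orbit_linearization w0 y0 u (segC r z u)).
    apply: is_deriveB; last exact: dz.
    by apply: is_deriveZ; apply: is_deriveB; [exact: dy|exact: dyb].
  move=> B B0 DB; rewrite -(subrKA (orbit_linearization w0 y0 u (h^-1 *: (segC r y u - segC r yb u)))).
  rewrite (le_trans (ler_normD _ _))// addrC lerD ?lin_close//.
  rewrite /orbit_linearization -linearizationB.
  have Ku := K_segW Kp gy0 (ltW u0).
  apply: le_trans (HL _ _ Ku) _; rewrite ler_wpM2l//.
  apply: hist_norm_le => a _.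
  rewrite (_ : _ a = D (u + clamp r a)); last first.
    by rewrite /D -(segC_curve _ _ yc) -(segC_curve _ _ ybc) -(segC_curve _ _ zc).
  by apply: DB; exact: clamp_window.
Unshelve. all: by end_near. Qed.

(** [N] bounds the waiting time and [N^-1] the size of [h]: a single parameter tending to infinity
    lets one covering argument make both uniform. *)
Definition contracting (N : R) (q : Omega * W) (v : C) : Prop :=
  forall yb y (h : R), global_solution q.1 q.2 yb -> clipped_curve q.1 y ->
  0 < h -> h <= N^-1 -> (forall s, I s -> y s - yb s = h *: v s) ->
  exists t, r%:num <= t <= N /\ window_le (fun s => y s - yb s) (t - r%:num) t (h / 2).

Lemma clipped_curve_shift w y (a : R) : 0 <= a -> clipped_curve w y ->
  clipped_curve (sigma a w) (fun s => y (s + a)).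
Proof.
move=> a0 [cy yk]; split=> [|T T0]; first exact: curve_shift.
have Ta : 0 <= T + a by rewrite addr_ge0.
move=> s t /andP[s1 s2] /andP[t1 t2]; have := yk _ Ta (s + a) (t + a).
rewrite !lerD2r s2 t2 !andbT opprD addrACA subrr addr0; apply.
  by rewrite (le_trans s1)// lerDl.
by rewrite (le_trans t1)// lerDl.
Qed.

Lemma window_shift (d : R -> E) (a t k : R) :
  window_le (fun s => d (s + a)) (t - r%:num) t k <-> window_le d (t + a - r%:num) (t + a) k.
Proof.
split=> -[H1 H2]; split=> [s /andP[s1 s2]|s u /andP[s1 s2] /andP[u1 u2]].
- have := H1 (s - a); rewrite subrK; apply.
  by rewrite lerBrDr addrAC s1 lerBlDr.
- have := H2 (s - a) (u - a); rewrite !subrK opprB addrA subrK; apply.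
    by rewrite lerBrDr addrAC s1 lerBlDr.
  by rewrite lerBrDr addrAC u1 lerBlDr.
- by apply: H1; rewrite lerD2r s2 andbT addrAC lerD2r.
- have := H2 (s + a) (u + a); rewrite opprD addrACA subrr addr0; apply.
    by rewrite lerD2r s2 andbT addrAC lerD2r.
  by rewrite lerD2r u2 andbT addrAC lerD2r.
Qed.

(** At [t0] the linear solution and the shadowing error are both at most [eta], so the difference is
    at most [2 eta h] in the sup norm; running one more delay turns this into a W^{1,oo} bound. *)
Lemma local_contraction w0 x0 (v0 : C) : K (w0, x0) -> lip_ball 1 1 v0 ->
  \forall p \near ((w0, x0), v0) & N \near +oo, K p.1 -> lip_ball 1 1 p.2 -> contracting N p.1 p.2.
Proof.
move=> Kp v01; have [y0 gy0] := K_global Kp.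
have [V VE] := lip_ball_histW ler01 v01.
have r0 : 0 <= r%:num by [].
have [c c1 growth] := clipped_curves_growthC rho kap_ge0 r0.
have c0 : 0 < c by exact: lt_le_trans c1.
(* The growth factor [c] over the extra delay turns [2 eta h] into exactly [h / 2]. *)
pose eta := (4 * c)^-1; have eta0 : 0 < eta by rewrite invr_gt0 mulr_gt0.
have [z [lz /(_ eta 0 eta0)[t0 [_ t00 zeta]]]] := linear_decay V Kp gy0.
have [d d0 N1] := linear_shadowing Kp gy0 lz t00 eta0; rewrite VE in N1.
have id0 : 0 < d^-1 by rewrite invr_gt0.
near=> p N => Kp1 pv yb y h gyb cy h0 hN dv.
have Nd : d^-1 <= N by near: N; apply: nbhs_pinfty_ge; rewrite num_real.
have Nt : t0 + r%:num <= N by near: N; apply: nbhs_pinfty_ge; rewrite num_real.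
have hd : h <= d by rewrite (le_trans hN)// -[leRHS]invrK lef_pV2 ?posrE// (lt_le_trans id0).
have H : forall s, - r%:num <= s <= t0 -> `|h^-1 *: (y s - yb s) - z s| <= eta.
  have : K p.1 -> lip_ball 1 1 p.2 ->
    forall yb y h, global_solution p.1.1 p.1.2 yb -> clipped_curve p.1.1 y -> 0 < h -> h <= d ->
    (forall s, I s -> y s - yb s = h *: p.2 s) ->
    forall s, - r%:num <= s <= t0 -> `|h^-1 *: (y s - yb s) - z s| <= eta by near: p.
  by apply.
have dsmall s : t0 - r%:num <= s <= t0 -> `|y s - yb s| <= h * (2 * eta).
  move=> st; have st' := window_sub t00 (lexx t0) st.
  rewrite -ler_pdivrMl// -(gtr0_norm (_ : 0 < h^-1)) ?invr_gt0// -normrZ.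
  rewrite -[_ *: _](subrK (z s)) (le_trans (ler_normD _ _))// mulr_natl mulr2n.
  by rewrite lerD ?H ?zeta.
have Kp' : K (p.1.1, p.1.2) by case: (p.1) Kp1.
have [cyb _ ybk] := K_clip Kp' gyb.
have [cy1 yk1] := clipped_curve_shift t00 cy.
have [cyb1 ybk1] := clipped_curve_shift t00 (conj cyb ybk).
have he0 : 0 <= h * (2 * eta) by rewrite !mulr_ge0 ?ltW.
have [|G1 G2] := growth _ _ _ _ cy1 cyb1 he0 (yk1 _ r0) (ybk1 _ r0).
  by move=> s /andP[s1 s2]; apply: dsmall; rewrite gerDr s2 andbT [leLHS]addrC lerD2r.
have cE : c * (h * (2 * eta)) = h / 2.
  by rewrite /eta; field; rewrite gt_eqF.
exists (r%:num + t0); split; first by rewrite lerDl t00 addrC.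
apply: (@window_shift (fun s => y s - yb s) t0 r%:num (h / 2)).1.
rewrite -cE subrr; split; last exact: G2.
by move=> s /andP[s1 s2]; apply: G1; rewrite s2 andbT (le_trans _ s1)// oppr_le0.
Unshelve. all: by end_near. Qed.

Lemma uniform_contraction : exists T d : R, [/\ 0 < T, 0 < d &
  forall w xb yb y (h : R), K (w, xb) -> global_solution w xb yb -> clipped_curve w y ->
  0 < h -> h <= d -> window_le (fun s => y s - yb s) (- r%:num) 0 h ->
  exists t, r%:num <= t <= T /\ window_le (fun s => y s - yb s) (t - r%:num) t (h / 2)].
Proof.
have cA : compact (K `*` @lip_ball R r n 1 1).
  by apply: compact_setX => //; exact: lip_ball_compact.
have H := (near_covering_withinP _).2 ((compact_near_coveringP _).1 cA).
have [|N0 [_ NP]] := H R +oo%R (fun N p => contracting N p.1 p.2) _.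
  move=> [[w0 x0] v0] [/= Kp v1]; have := local_contraction Kp v1.
  by apply: filterS => -[p N] /= HpN [Kp1 pv]; exact: HpN.
pose N := `|N0| + 1; have N_gt0 : 0 < N by rewrite ltr_wpDl.
exists N, N^-1; split; rewrite ?invr_gt0// => w xb yb y h Kp gyb cy h0 hN [D1 D2].
pose v : C := h^-1 *: (segC r y 0 - segC r yb 0).
have yc := cy.1.1; have ybc := gyb.1.1.
have vE s : v s = h^-1 *: (y (clamp r s) - yb (clamp r s)).
  by rewrite -[clamp r s]add0r -(segC_curve _ _ yc) -(segC_curve _ _ ybc).
have cI s : - r%:num <= clamp r s <= 0 by have := clamp_in r s; rewrite /= in_itv.
have v1 : lip_ball 1 1 v.
  split=> [s|s t]; rewrite !vE -?scalerBr normrZ gtr0_norm ?invr_gt0//.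
    by rewrite ler_pdivrMl// mulr1 D1.
  rewrite mul1r ler_pdivrMl// (le_trans (D2 _ _ (cI s) (cI t)))// ler_wpM2l ?(ltW h0)//.
  exact: clamp_lip.
apply: (NP N _ ((w, xb), v) (conj Kp v1)) => //.
  by rewrite (le_lt_trans (ler_norm _))// ltrDl.
move=> s Is; rewrite vE clamp_id// scalerA mulfV ?scale1r// gt_eqF//.
Qed.

Lemma halving_le (k A B h : R) : 0 <= k -> 0 <= A -> 0 <= h -> B <= 2 ->
  k * (A * B) * (h / 2) <= k * A * h.
Proof.
move=> k0 A0 h0 B2; rewrite (_ : k * (A * B) * (h / 2) = k * A * h * (B / 2)); last by ring.
by rewrite ler_piMr ?mulr_ge0// ler_pdivrMr// mul1r.
Qed.

(** Each halving takes at most the time [T], whence the rate [ln 2 / T]. Before the first halving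
    the growth bound [c] holds, and [e^(a t) <= 2] there explains the constant [2 c]. *)
Lemma exponential_decay : exists d c a : R, [/\ 0 < d, 0 < c, 0 < a &
  forall w xb yb y (h : R), K (w, xb) -> global_solution w xb yb -> clipped_curve w y ->
  0 < h -> h <= d -> window_le (fun s => y s - yb s) (- r%:num) 0 h ->
  forall t, 0 <= t ->
    window_le (fun s => y s - yb s) (t - r%:num) t (c * expR (- (a * t)) * h)].
Proof.
have [T [d [T0 d0 step]]] := uniform_contraction.
have [c c1 growth] := clipped_curves_growth rho kap_ge0 (ltW T0).
have c0 : 0 < c by exact: lt_le_trans c1.
have ln20 : 0 < ln 2 :> R by rewrite ln_gt0 ?ltr1n.
pose a : R := ln 2 / T; have a0 : 0 < a by rewrite divr_gt0.
have aT t : t <= T -> expR (a * t) <= 2.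
  move=> tT; rewrite -[leRHS](@lnK R 2) ?posrE// ler_expR /a mulrAC ler_pdivrMr//.
  by rewrite ler_wpM2l// ltW.
exists d, (2 * c), a; split=> //; first by rewrite mulr_gt0.
(* A halving time is at least one delay, so counting delays gives a terminating induction although
   the halving times vary. *)
suff H (n0 : nat) : forall w xb yb y (h : R), K (w, xb) -> global_solution w xb yb ->
    clipped_curve w y -> 0 < h -> h <= d -> window_le (fun s => y s - yb s) (- r%:num) 0 h ->
    forall t, 0 <= t -> t <= n0%:R * r%:num ->
    window_le (fun s => y s - yb s) (t - r%:num) t (2 * c * expR (- (a * t)) * h).
  move=> w xb yb y h Kp gyb cy h0 hd D t t0.
  apply: (H (Num.truncn (t / r%:num)).+1 w xb yb y h Kp gyb cy h0 hd D t t0).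
  by rewrite -ler_pdivrMr// ltW// truncnS_gt.
elim: n0 => [|n0 IH] w xb yb y h Kp gyb cy h0 hd D t t0 tn.
  have -> : t = 0 by apply/eqP; rewrite eq_le t0 andbT -[leRHS](mul0r r%:num).
  rewrite sub0r mulr0 oppr0 expR0 mulr1; apply: window_leW D => //.
  rewrite ler_peMl ?(ltW h0)//; lra.
have [u [/andP[ru uT] Du]] := step _ _ _ _ _ Kp gyb cy h0 hd D.
have [_ _ ybk] := K_clip Kp gyb; have [cyb _ _] := K_clip Kp gyb.
have [tu|ut] := leP t u.
  have tT := le_trans tu uT.
  have := growth _ _ _ _ cy.1 cyb (ltW h0) (cy.2 _ (ltW T0)) (ybk _ (ltW T0)) D.
  apply: window_leW => //; first by rewrite lerDr.
  rewrite ler_wpM2r ?(ltW h0)// expRN ler_pdivlMr ?expR_gt0//.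
  by rewrite mulrC ler_wpM2r ?(ltW c0)// aT.
have u0 : 0 <= u by rewrite (le_trans _ ru).
have ybw : lip_on (u - r%:num) u kap yb by apply: lip_onW (ybk _ u0) => //; rewrite lerDr.
have gyb' := global_shift gyb u0 kap_ge0 ybw.
have h20 : 0 < h / 2 by rewrite divr_gt0.
have h2d : h / 2 <= d by rewrite (le_trans _ hd)// ler_pdivrMr// ler_pMr// ler1n.
have D' : window_le (fun s => y (s + u) - yb (s + u)) (- r%:num) 0 (h / 2).
  have := (@window_shift (fun s => y s - yb s) u 0 (h / 2)).2.
  by rewrite sub0r add0r; exact.
have tu0 : 0 <= t - u by rewrite subr_ge0 ltW.
have tun : t - u <= n0%:R * r%:num.
  rewrite lerBlDr (le_trans tn)// -addn1 natrD mulrDl mul1r lerD2l//.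
have := IH _ _ _ _ _ (K_segW Kp gyb u0) gyb' (clipped_curve_shift u0 cy) h20 h2d D' _ tu0 tun.
move=> /(@window_shift (fun s => y s - yb s)); rewrite subrK.
apply: window_leW => //.
have -> : - (a * (t - u)) = - (a * t) + a * u by rewrite mulrBr opprB addrC.
by rewrite expRD; apply: halving_le; rewrite ?mulr_ge0 ?expR_ge0 ?aT// ltW.
Qed.

End Contraction.

Lemma K_exponential_stability : exists d c a : R, [/\ 0 < d, 0 < c, 0 < a &
  forall w (xb x : W), K (w, xb) -> `|x - xb| < d ->
    lifespan sigma F tau (w, x) = +oo%E /\
    forall t, 0 <= t ->
      `|state sigma F tau t (w, x) - state sigma F tau t (w, xb)|
        <= c * expR (- (a * t)) * `|x - xb|].
Proof.
have [rho [M [kap [M0 Mk Kk GM K_clip]]]] := K_clip_bounds.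
have kap0 : 0 <= kap by exact: le_trans M0 Mk.
have [d [c [a [d0 c0 a0 decay]]]] := exponential_decay kap0 K_clip.
(* The bound 1 gives the initial history the constant [kap]; [c h <= 1] keeps the clipped curve
   within 1 of [yb], so that it solves the original equation. *)
pose d1 : R := Num.min (Num.min 1 c^-1) d.
have d10 : 0 < d1 by rewrite !lt_min ltr01 invr_gt0 c0.
exists d1, c, a; split=> // w xb x Kp xd.
have [yb gyb] := K_global Kp.
have [cyb ybr ybk] := K_clip _ _ _ Kp gyb.
have [->|xxb] := eqVneq x xb.
  split; first exact: global_lifespan gyb.
  by move=> t t0; rewrite !subrr !normr0 mulr0.
set h := `|x - xb|; have h0 : 0 < h by rewrite normr_gt0 subr_eq0.
have [h1 hc hd] : [/\ h <= 1, h <= c^-1 & h <= d].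
  by move: xd; rewrite -/h !lt_min => /andP[/andP[/ltW ? /ltW ?] /ltW ?].
have xk : `|x| <= kap.
  apply: le_trans (Kk _ _ Kp); rewrite -[x](subrK xb) (le_trans (ler_normD _ _))//.
  by rewrite addrC lerD2l.
have xlip s t : `|x s - x t| <= kap * `|s - t|.
  by apply: le_trans (histW_norm_lip _ _ _) _; rewrite ler_wpM2r.
have [y [cy yx ylip]] := clipped_curve_exists M0 Mk GM w xlip.
have ylipT T : 0 <= T -> lip_on (- r%:num) T kap y by move=> _ s t _ _; exact: ylip.
have D0 : window_le (fun s => y s - yb s) (- r%:num) 0 h.
  have E s : - r%:num <= s <= 0 -> y s - yb s = (x - xb : W) s.
    by move=> sI; rewrite gyb.2 ?in_itv// yx//; case/andP: sI.
  split=> [s sI|s t sI tI]; rewrite !E//; first exact: histW_norm_ub.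
  exact: histW_norm_lip.
have D := decay w xb yb y h Kp gyb (conj cy ylipT) h0 hd D0.
have yc := cy.1; have ybc := gyb.1.1.
have ynear s : - r%:num <= s -> `|y s - yb s| <= 1.
  move=> rs; have [s0|/ltW s0] := leP s 0; first by rewrite (le_trans (D0.1 s _))// rs.
  have [H _] := D s s0; apply: le_trans (H s _) _; first by rewrite lexx andbT gerBl.
  rewrite -(mulfV (lt0r_neq0 c0)) -mulrA ler_wpM2l ?(ltW c0)//.
  rewrite (le_trans _ hc)// ler_piMl ?(ltW h0)// -expR0 ler_expR oppr_le0.
  by rewrite mulr_ge0// ltW.
have gy : global_solution w x y.
  split; last by move=> s; rewrite /= in_itv/= => /andP[_ s0]; exact: yx.
  split=> // t t0; have := cy.2 t t0; rewrite clipped_field_id// => s.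
  rewrite (segC_curve _ _ yc); have /andP[ts _] := @clamp_window _ r t s.
  have rs : - r%:num <= t + clamp r s by rewrite (le_trans _ ts)// lerDr ltW.
  apply: le_trans (ybr _ rs); rewrite -[y _](subrK (yb (t + clamp r s))).
  by rewrite (le_trans (ler_normD _ _))// addrC lerD2l ynear.
split; first exact: global_lifespan gy.
move=> t t0; rewrite (global_state gy t0) (global_state gyb t0).
have lipt (z : R -> E) : (forall T, 0 <= T -> lip_on (- r%:num) T kap z) ->
    lip_on (t - r%:num) t kap z.
  by move=> zk; apply: lip_onW (zk _ t0) => //; rewrite lerDr.
have k0 : 0 <= c * expR (- (a * t)) * h by rewrite !mulr_ge0 ?expR_ge0// ltW.
exact/(segW_dist_leP yc ybc k0 kap0 (lipt _ ylipT) (lipt _ ybk))/D.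
Qed.

(** * The semiflow on [K] and the conclusion *)

Local Notation P := (skew_product sigma F tau).

Lemma skew_product_global w x y (t : R) : global_solution w x y -> 0 <= t ->
  P t (w, x) = (sigma t w, segW r y t).
Proof. by move=> gy t0; rewrite /skew_product (global_state gy t0). Qed.

Lemma skew_product0 p : K p -> P 0 p = p.
Proof.
case: p => w x Kp; have [y gy] := K_global Kp.
by rewrite (skew_product_global gy)// flow0 (segW_init gy.1.1 gy.2).
Qed.

Lemma K_window w x y (t : R) : K (w, x) -> global_solution w x y -> 0 <= t ->
  exists2 k : R, 0 <= k & lip_on (t - r%:num) t k y.
Proof.
move=> Kp gy t0; have [k k0 yk] := global_lip gy t0; exists k => //.
by apply: lip_onW yk => //; rewrite lerDr.
Qed.

Lemma skew_productD (s t : R) p : 0 <= s -> 0 <= t -> K p -> P (s + t) p = P s (P t p).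
Proof.
case: p => w x s0 t0 Kp; have [y gy] := K_global Kp; have yc := gy.1.1.
have [k k0 yk] := K_window Kp gy t0.
rewrite (skew_product_global gy) ?addr_ge0// (skew_product_global gy t0).
rewrite (skew_product_global (global_shift gy t0 k0 yk) s0) flowD.
by rewrite /segW (segC_shift _ _ yc).
Qed.

Lemma skew_product_continuous (t0 : R) p0 : 0 <= t0 -> K p0 -> forall e : R, 0 < e ->
  \forall q \near (t0, p0), 0 <= q.1 -> K q.2 -> ball (P t0 p0) e (P q.1 q.2).
Proof.
case: p0 => w0 x0 t00 Kp0 e e0; have [y0 gy0] := K_global Kp0; have y0c := gy0.1.1.
have [rho [kap [rk Kb]]] := K_curve_bounds; have kap0 : 0 <= kap by exact: le_trans rk.
have e30 : 0 < e / 3 by rewrite divr_gt0.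
have T0 : 0 <= t0 + 1 by rewrite addr_ge0.
have N1 : \forall q \near (t0, (w0, x0)), K q.2 -> forall y, global_solution q.2.1 q.2.2 y ->
    window_le (fun s => y s - y0 s) (- r%:num) (t0 + 1) (e / 3).
  exact: (@cvg_snd _ _ (nbhs t0) (nbhs (w0, x0)) _ _ (K_curves_close Kp0 gy0 T0 e30)).
have N2 : \forall q \near (t0, (w0, x0)), 0 <= q.1 -> `|segW r y0 q.1 - segW r y0 t0| <= e / 3.
  exact: (@cvg_fst _ _ (nbhs t0) (nbhs (w0, x0)) _ _ (K_segW_near Kp0 gy0 t00 e30)).
have N3 : \forall q \near (t0, (w0, x0)), ball (sigma t0 w0) e (sigma q.1 q.2.1).
  have c : {for (t0, (w0, x0)), continuous (fun q : R * (Omega * W) => sigma q.1 q.2.1)}.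
    apply: (@continuous_comp _ _ _ (fun q : R * (Omega * W) => (q.1, q.2.1)) (fun p => sigma p.1 p.2)).
      apply: continuous_pair; first exact: cvg_fst.
      by apply: (@continuous_comp _ _ _ snd fst); [exact: cvg_snd|exact: cvg_fst].
    exact: flow_continuous.
  exact: (c _ (nbhsx_ballx _ _ e0)).
have N4 : \forall q \near (t0, (w0, x0)), q.1 <= t0 + 1.
  have N : \forall t \near t0, t <= t0 + 1.
    by near=> t; apply: ltW; near: t; apply: lt_nbhsl; rewrite ltrDl.
  exact: (@cvg_fst _ _ (nbhs t0) (nbhs (w0, x0)) _ _ N).
have FF := nbhs_filter (t0, (w0, x0)).
apply: (@filterS _ _ FF _ _ _ (filterI (filterI N1 N2) (filterI N3 N4))) => -[t [w x]] [[/= M1 M2] [/= M3 M4]] t_ge0 Kp.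
have [y gy] := K_global Kp; have yc := gy.1.1.
rewrite (skew_product_global gy0 t00) (skew_product_global gy t_ge0); split=> //=.
have lipw w' x' z : K (w', x') -> global_solution w' x' z -> lip_on (t - r%:num) t kap z.
  move=> Kz gz; have [_ zk] := Kb _ _ _ Kz gz; apply: lip_onW (zk _ t_ge0) => //.
  by rewrite lerDr.
have [D1 D2] := M1 Kp _ gy.
have H : `|segW r y t - segW r y0 t| <= e / 3.
  apply/(segW_dist_leP yc y0c (ltW e30) kap0 (lipw _ _ _ Kp gy) (lipw _ _ _ Kp0 gy0)); split.
    by move=> s /(window_sub t_ge0 M4); exact: D1.
  by apply: lip_onW D2 => //; rewrite lerDr.
rewrite -ball_normE /= distrC -(subrKA (segW r y0 t)).
rewrite (le_lt_trans (ler_normD _ _))// (le_lt_trans (lerD H (M2 t_ge0)))//.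
exact: two_thirds_lt.
Unshelve. all: by end_near. Qed.

Hypothesis sigma_minimal : minimal_flow sigma.
Hypothesis K_projects : projects_over_base K.

Lemma fiber_card (N : set (Omega * W)) m : (forall w, fiber N w m) -> k_cover m N.
Proof.
move=> Nm w; have [f [f_inj fN]] := Nm w.
have -> : xsection N w = f @` [set: 'I_m].
  apply/seteqP; split=> [x|x [i _ <-]]; rewrite /xsection/= inE; last by apply/fN; exists i.
  by move=> /fN[i ->]; exists i.
have -> : `I_m = (fun i : 'I_m => i : nat) @` [set: 'I_m].
  by apply/seteqP; split=> [i /= im|_ [i _ <-] /=]; [exists (Ordinal im)|exact: ltn_ord].
apply: (card_eq_trans (inj_card_eq _)); first by move=> i j _ _; exact: f_inj.
by rewrite card_eq_sym; apply: inj_card_eq => i j _ _; exact: val_inj.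
Qed.

Lemma stable_cover : exists k : nat,
    [/\ (0 < k)%N,
        k_cover k K,
        flow_extension sigma F tau K,
        forall w0 : Omega, exists (U : set Omega) (x : 'I_k -> Omega -> histW r n),
          [/\ nbhs w0 U,
              forall j, {within U, continuous (x j)}
            & forall w, U w -> xsection K w = range (fun j => x j w)]
      & exists (l : nat) (M : 'I_l -> set (Omega * histW r n)) (m : 'I_l -> nat),
          [/\ trivIset [set: 'I_l] M,
              K = \bigcup_j M j
            & forall j, [/\ minimal_set sigma F tau (M j), (0 < m j)%N,
                            k_cover (m j) (M j)
                          & exp_stable sigma F tau (M j)]]].
Proof.
have [d [c [a [d0 c0 a0 stab]]]] := K_exponential_stability.
have P_fst t p : (P t p).1 = sigma t p.1 by [].
have P_in (t : R) p : 0 <= t -> K p -> K (P t p).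
  by move=> t0 /K_invariant[_]; exact.
have P_back p : K p -> exists theta : R -> Omega * W,
  [/\ forall s, s <= 0 -> K (theta s), theta 0 = p
    & forall s t, 0 <= t -> s <= - t -> P t (theta s) = theta (t + s)].
  by move=> /K_backward[theta [_ H1 H2 H3]]; exists theta.
have P_contr w x y : K (w, x) -> K (w, y) -> `|x - y| < d -> forall t, 0 <= t ->
    `|(P t (w, x)).2 - (P t (w, y)).2| <= c * expR (- (a * t)) * `|x - y|.
  by move=> _ Ky xy; have [_] := stab w y x Ky xy.
have [k [k0 Kk [Phi PhiP] sec [l [M [m [tM KM MP]]]]]] :=
  skew_product_cover d0 c0 a0 Omega_compact sigma_flow sigma_minimal K_compact K_projects
    P_fst P_in skew_product0 skew_productD skew_product_continuous P_back P_contr.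
exists k; split=> //.
- exact: fiber_card.
- by exists Phi.
- move=> w0; have [U [x [Uw0 xc xK]]] := sec w0; exists U, x; split=> // w Uw.
  apply/seteqP; split=> [y|y [j _ <-]]; rewrite /xsection/= inE.
    by move=> /(xK _ _ Uw)[j ->]; exists j.
  by apply/(xK _ _ Uw); exists j.
exists l, M, m; split=> // j; have [M0 [MK cM MP'] minM m0 Mm] := MP j.
(* The abstract notion of invariance has no lifespan clause; it is inherited from [K]. *)
have pinv N : N `<=` K -> (forall (t : R) p, 0 <= t -> N p -> N (P t p)) ->
    pos_invariant sigma F tau N.
  move=> NK NP p Np; split; first by have [] := K_invariant (NK _ Np).
  by move=> t t0; exact: NP.
have pM : pos_invariant sigma F tau (M j) by exact: pinv.
split=> //.
- split=> // N N0 iN cN NM; apply: minM => //; split=> //.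
    by move=> p /NM/MK.
  by move=> t p t0 Np; have [_] := iN p Np; exact.
- exact: fiber_card.
- split=> //.
    move=> w; have [f [_ fM]] := Mm w; exists (f (Ordinal m0)).
    by apply/fM; exists (Ordinal m0).
  exists d, c, a; split=> // w xb x Mx xd; exact: stab (MK _ Mx) xd.
Qed.

End DelayedField.

Theorem corollary5p7 (R : realType) (r : {posnum R}) (n : nat) (n_gt0 : (0 < n)%N)
    (Omega : metricType R) (Omega_compact : compact [set: Omega])
    (sigma : R -> Omega -> Omega)
    (sigma_flow : is_flow sigma) (sigma_minimal : minimal_flow sigma)
    (F : Omega -> 'rV[R]_n -> 'rV[R]_n -> 'rV[R]_n)
    (tau : Omega -> histC r n -> R)
    (tau_range : forall w x, 0 <= tau w x <= r%:num)
    (F_H1 : H1 F) (tau_H2 : H2 tau)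
    (K : set (Omega * histW r n))
    (K_invariant : pos_invariant sigma F tau K)
    (K_compact : compact K)
    (K_projects : projects_over_base K)
    (K_backward : forall p, K p -> backward_extension sigma F tau K p)
    (K_lyapunov : (upper_lyapunov sigma F tau K < 0)%E) :
  exists k : nat,
    [/\ (0 < k)%N,
        k_cover k K,
        flow_extension sigma F tau K,
        forall w0 : Omega, exists (U : set Omega) (x : 'I_k -> Omega -> histW r n),
          [/\ nbhs w0 U,
              forall j, {within U, continuous (x j)}
            & forall w, U w -> xsection K w = range (fun j => x j w)]
      & exists (l : nat) (M : 'I_l -> set (Omega * histW r n)) (m : 'I_l -> nat),
          [/\ trivIset [set: 'I_l] M,
              K = \bigcup_j M j
            & forall j, [/\ minimal_set sigma F tau (M j), (0 < m j)%N,
                            k_cover (m j) (M j)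
                          & exp_stable sigma F tau (M j)]]].
Proof.
exact: (stable_cover Omega_compact tau_range F_H1 tau_H2 sigma_flow K_invariant K_compact
  K_backward K_lyapunov sigma_minimal K_projects).
Qed.
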